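(* Let $W_\Gamma$ and $W_\Omega$ be Coxeter groups with $\widehat{W_\Gamma}\cong\widehat{W_\Omega}$. Then $W_\Gamma$ is of FC type if and only if $W_\Omega$ is of FC type.
   Context: For a finite simplicial graph $\Gamma$ with edge labels $m\colon E(\Gamma)\to\mathbb{N}_{\ge2}$, $W_\Gamma=\langle V(\Gamma)\mid v^2,\ (vw)^{m(\{v,w\})}\text{ for }\{v,w\}\in E(\Gamma)\rangle$. For $X\subseteq V(\Gamma)$, $W_X$ denotes the subgroup generated by $X$ (a special parabolic subgroup). $W_\Gamma$ is of FC type if for every clique (complete subgraph) $\Delta\subseteq\Gamma$ the subgroup $W_{V(\Delta)}$ is finite. $\widehat{G}$ denotes profinite completion. *)

(* Defs.v *)
From mathcomp Require Import all_boot.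
Set Implicit Arguments. Unset Strict Implicit. Unset Printing Implicit Defensive.

(* Groups presented as setoids: a carrier with an equivalence "geq"   *)
(* (equality of group elements) and operations.  Only used for groups  *)
(* for which the group axioms hold up to geq (here: Coxeter groups).   *)
Record sgroup := SGroup {
  gcar :> Type;
  geq : gcar -> gcar -> Prop;
  gmul : gcar -> gcar -> gcar;
  ginv : gcar -> gcar;
  gone : gcar }.

Section Profinite.
Variable G : sgroup.

Definition fin_index_normal (N : G -> Prop) : Prop :=
  [/\ (forall x y, geq x y -> N x -> N y), N (gone G) &
      (forall x y, N x -> N y -> N (gmul x y))] /\
  [/\ (forall x, N x -> N (ginv x)),
      (forall g n, N n -> N (gmul (gmul g n) (ginv g)))
    & exists (k : nat) (reps : 'I_k -> G), forall g, exists i, N (gmul (ginv (reps i)) g)].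

Definition coset (N : G -> Prop) (g : G) : G -> Prop := fun x => N (gmul (ginv g) x).

(* An element of the profinite completion: a compatible family of cosets,
   one coset of N for every finite-index normal subgroup N
   (= an element of the inverse limit of the G/N). *)
Definition compl_elt (f : (G -> Prop) -> (G -> Prop)) : Prop :=
  [/\ (forall N, fin_index_normal N -> exists g, f N = coset N g),
      (forall N, ~ fin_index_normal N -> f N = (fun _ => False))
    & (forall N M, fin_index_normal N -> fin_index_normal M ->
         (forall x, M x -> N x) -> forall x, f M x -> f N x)].

Definition completion : Type := {f : (G -> Prop) -> (G -> Prop) | compl_elt f}.

Definition compl_prod (x y z : completion) : Prop :=
  forall N, fin_index_normal N -> forall a b,
    proj1_sig x N a -> proj1_sig y N b -> proj1_sig z N (gmul a b).

End Profinite.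

(* Continuity for the inverse-limit topology, whose basic open
   neighbourhoods of x are {x' | x' N = x N}, N finite-index normal. *)
Definition compl_continuous (G H : sgroup) (phi : completion G -> completion H) : Prop :=
  forall (x : completion G) (N' : H -> Prop), fin_index_normal N' ->
    exists N : G -> Prop, fin_index_normal N /\
      forall x' : completion G, proj1_sig x' N = proj1_sig x N ->
        proj1_sig (phi x') N' = proj1_sig (phi x) N'.

Definition profinite_iso (G H : sgroup) : Prop :=
  exists (phi : completion G -> completion H) (psi : completion H -> completion G),
    [/\ cancel phi psi, cancel psi phi,
        (forall x y z, compl_prod x y z -> compl_prod (phi x) (phi y) (phi z)),
        compl_continuous phi
      & compl_continuous psi].

Definition coxeter_graph (V : finType) (e : rel V) (m : V -> V -> nat) : Prop :=
  [/\ (forall v w, e v w = e w v),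
      (forall v, ~~ e v v),
      (forall v w, e v w -> m v w = m w v)
    & (forall v w, e v w -> 2 <= m v w)].

(* The congruence on words generated by the Coxeter relators
   v^2 and (v w)^m(v,w) for edges {v,w}.  The monoid presented this
   way is a group (each generator is an involution) and equals W_Gamma. *)
Inductive cox_eq (V : finType) (e : rel V) (m : V -> V -> nat) : seq V -> seq V -> Prop :=
| cox_refl u : cox_eq e m u u
| cox_sym u w : cox_eq e m u w -> cox_eq e m w u
| cox_trans u v w : cox_eq e m u v -> cox_eq e m v w -> cox_eq e m u w
| cox_sq u v w : cox_eq e m (u ++ [:: v; v] ++ w) (u ++ w)
| cox_edge u v w x : e v w ->
    cox_eq e m (u ++ flatten (nseq (m v w) [:: v; w]) ++ x) (u ++ x).

Definition coxeter_group (V : finType) (e : rel V) (m : V -> V -> nat) : sgroup :=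
  @SGroup (seq V) (cox_eq e m) cat rev [::].

Definition is_clique (V : finType) (e : rel V) (X : {set V}) : Prop :=
  forall v w, v \in X -> w \in X -> v != w -> e v w.

Definition special_parabolic_finite (V : finType) (e : rel V) (m : V -> V -> nat)
    (X : {set V}) : Prop :=
  exists l : seq (seq V), forall w : seq V, all (mem X) w ->
    exists2 u, u \in l & cox_eq e m w u.

Definition FC_type (V : finType) (e : rel V) (m : V -> V -> nat) : Prop :=
  forall X : {set V}, is_clique e X -> special_parabolic_finite e m X.

(* Main.v *)
Require Import Defs.
From mathcomp Require Import all_boot.
From mathcomp Require Import all_order all_fingroup all_algebra all_field.
From mathcomp Require Import boolp ring zify.

(** The generators [s_i] of a clique of [W1] are involutions whose pairwise
    products have finite order, so they go to elements [t_i] of the completion of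
    [W2] with the same property; if [W2] is of FC type, the [t_i] are
    simultaneously conjugate into the subgroup of a clique [X] of [W2], in every
    finite quotient.  Hence the subgroup generated by the [s_i] has images of
    size at most [max |W_X|] in the finite quotients of [W1], and it is finite
    since Coxeter groups are residually finite.

    The conjugation into a clique goes down the amalgams
    [W_Y = W_(Y - a) *_(W_(Y - a - b)) W_(Y - b)] over non-edges [{a, b}].  The
    profinite completion acts on the inverse limit of the quotients of the
    Bass-Serre tree by finite-index normal subgroups.  This limit is a profinite
    tree: every cycle of one quotient graph dies in the next, for suitable
    deeper subgroups.  Smith theory, one prime at a time, shows that the
    dihedral groups [<t_i, t_j>] have fixed vertices and that fixed subgraphs
    are connected, and a Mayer-Vietoris argument gives the Helly property, so
    all [t_i] fix a common vertex.  Everything is done at finite levels of the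
    tower, losing a bounded number of levels at each step.

    To iterate, the closures of special subgroups must intersect as expected
    ([parabolic_intersection]).  This is the canonical completion for special
    cube complexes, applied to the cube complex of the cosets of the subgroups
    [W_X], [X] a clique; a suitable congruence quotient of the Tits
    representation makes it special, because double cosets of special subgroups
    are detected by the coefficients of [omega_t - w omega_t] on simple roots. *)

Set Implicit Arguments.
Unset Strict Implicit.
Unset Printing Implicit Defensive.

Import Order.TTheory GroupScope GRing.Theory Num.Theory.

(** * Words and finite quotients *)

(** The elements [t_i] are profinite, so a finite quotient sees them only through words, and these
    words change with the quotient. Hence the statements about them all have one shape: for a target
    quotient there is another quotient in which relations between words force a conclusion in the
    target. In particular the number of levels lost in the tower has to be bounded before the words
    are known.

    The coset graphs used are those of the amalgam of the whole group, with vertex groups for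
    [V - a] and [V - b]; only the representatives of cosets are confined to words over [Y]. All
    quotients are thus quotients of one group, and [W_Y] is never given a completion of its own. The
    price is that a fixed coset only yields conjugates which agree with words avoiding [a] (or [b])
    but possibly leaving [Y]; this is what the intersection theorem repairs. *)

Record finquot (V : finType) (e : rel V) (m : V -> V -> nat) := FinQuot {
  fqT :> finGroupType;
  fqg : V -> fqT;
  fqg_sq : forall v, fqg v * fqg v = 1;
  fqg_rel : forall v w, e v w -> (fqg v * fqg w) ^+ m v w = 1 }.

Section Words.
Variables (V : finType) (e : rel V) (m : V -> V -> nat).
Implicit Types (u v w x y : seq V) (s t a b : V) (X Y : {set V}).

Local Notation "u ~ w" := (cox_eq e m u w) (at level 70).

Lemma cox_cat u u' w w' : u ~ u' -> w ~ w' -> u ++ w ~ u' ++ w'.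
Proof.
have catl x y z : x ~ y -> z ++ x ~ z ++ y.
  elim=> {x y} [x|x y _ IH|x y y' _ IH1 _ IH2|x a y|x a b y eab].
  - exact: cox_refl.
  - exact: cox_sym.
  - exact: cox_trans IH2.
  - by rewrite [z ++ _]catA [z ++ (_ ++ y)]catA; apply: cox_sq.
  - by rewrite [z ++ _]catA [z ++ (_ ++ y)]catA; apply: cox_edge.
have catr x y z : x ~ y -> x ++ z ~ y ++ z.
  elim=> {x y} [x|x y _ IH|x y y' _ IH1 _ IH2|x a y|x a b y eab].
  - exact: cox_refl.
  - exact: cox_sym.
  - exact: cox_trans IH2.
  - by rewrite -!catA; apply: cox_sq.
  - by rewrite -!catA; apply: cox_edge.
by move=> uu' ww'; apply: cox_trans (catl _ _ _ ww') _; apply: catr.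
Qed.

Lemma cox_catVw u w : u ++ rev u ++ w ~ w.
Proof.
elim: u w => [|s u IHu] w; first exact: cox_refl.
rewrite rev_cons cat_rcons /=.
apply: cox_trans (cox_sq e m [::] s w).
exact: (cox_cat (cox_refl e m [:: s]) (IHu (s :: w))).
Qed.

Lemma cox_catVl u w : rev u ++ u ++ w ~ w.
Proof. by rewrite -{2}[u]revK; apply: cox_catVw. Qed.

Lemma cox_catV u : u ++ rev u ~ [::].
Proof. by have := cox_catVw u [::]; rewrite cats0. Qed.

Lemma cox_Vcat u : rev u ++ u ~ [::].
Proof. by have := cox_catVl u [::]; rewrite cats0. Qed.

Lemma cox_move u v w : u ++ v ~ w -> v ~ rev u ++ w.
Proof.
move=> uvw; apply: cox_trans (cox_cat (cox_refl e m (rev u)) uvw).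
by apply: cox_sym; apply: cox_catVl.
Qed.

Lemma cox_mover u v w : u ++ v ~ w -> u ~ w ++ rev v.
Proof.
move=> uvw; apply: cox_trans (cox_cat uvw (cox_refl e m (rev v))).
rewrite -catA -{1}[u]cats0; apply: cox_cat; first exact: cox_refl.
by apply: cox_sym; apply: cox_catV.
Qed.

Lemma cox_rev u w : u ~ w -> rev u ~ rev w.
Proof.
move=> uw; rewrite -[rev w]cats0; apply: cox_move.
rewrite -[[::]]/([::] ++ [::]).
apply: cox_trans (cox_catV u); apply: cox_cat; [exact: cox_sym | exact: cox_refl].
Qed.

Section Eval.
Variable q : finquot e m.
Definition ev w : q := \prod_(s <- w) fqg q s.

Lemma ev_nil : ev [::] = 1. Proof. exact: big_nil. Qed.
Lemma ev_cons s w : ev (s :: w) = fqg q s * ev w. Proof. exact: big_cons. Qed.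
Lemma ev_cat u w : ev (u ++ w) = ev u * ev w. Proof. exact: big_cat. Qed.
Lemma ev1 s : ev [:: s] = fqg q s. Proof. exact: big_seq1. Qed.

Lemma ev_flatten n w : ev (flatten (nseq n w)) = ev w ^+ n.
Proof.
by elim: n => [|n IHn] /=; rewrite ?ev_nil // ev_cat IHn expgS.
Qed.

Lemma ev_cox u w : u ~ w -> ev u = ev w.
Proof.
elim=> {u w} [//|//|u v w _ -> _ -> //|u v w|u v w x evw].
  by rewrite !ev_cat ev_cons ev1 fqg_sq mul1g.
by rewrite !ev_cat ev_flatten ev_cons ev1 fqg_rel // mul1g.
Qed.

Lemma ev_rev w : ev (rev w) = (ev w)^-1.
Proof.
by apply/eqP; rewrite eq_sym eq_invg_mul -ev_cat (ev_cox (cox_catV w)) ev_nil.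
Qed.

Definition par X : {group q} := <<[set fqg q s | s in X]>>%G.

Lemma ev_par X w : all (mem X) w -> ev w \in par X.
Proof.
elim: w => [|s w IHw] /=; first by rewrite ev_nil group1.
case/andP=> sX /IHw wX; rewrite ev_cons; apply: groupM => //.
by apply: mem_gen; apply/imsetP; exists s.
Qed.

Lemma parP X g : reflect (exists2 w, all (mem X) w & g = ev w) (g \in par X).
Proof.
apply: (iffP idP) => [|[w wX ->]]; last exact: ev_par.
case/gen_prodgP=> n [c cX ->].
elim: n c cX => [|n IHn] c cX; first by rewrite big_ord0; exists [::]; rewrite ?ev_nil.
rewrite big_ord_recl; have [w wX ->] := IHn (fun i => c (lift ord0 i)) (fun i => cX _).
have /imsetP[s sX ->] := cX ord0.
by exists (s :: w); rewrite /= ?sX ?wX // ev_cons.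
Qed.

Lemma par_sub X Y : X \subset Y -> par X \subset par Y.
Proof. by move=> XY; apply: genS; exact: imsetS. Qed.

End Eval.

Lemma sub_word X Y w : X \subset Y -> all (mem X) w -> all (mem Y) w.
Proof. by move/subsetP=> XY; apply: sub_all => s; apply: XY. Qed.

Lemma all_mem_rev X w : all (mem X) (rev w) = all (mem X) w.
Proof. by rewrite all_rev. Qed.

Lemma cox_parity u w : u ~ w -> odd (size u) = odd (size w).
Proof.
elim=> {u w} [//|//|u v w _ -> _ -> //|u v w|u v w x _].
  by rewrite !size_cat /= !oddD /= .
rewrite !size_cat !oddD; congr (_ (+) _).
rewrite size_flatten /shape map_nseq sumn_nseq /= mul2n.
by rewrite odd_double.
Qed.

End Words.

Arguments ev {V e m} q w.
Arguments par {V e m} q X.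

(** * Roots of unity with prescribed argument *)

Local Open Scope ring_scope.

Section RootOfUnity.
Variable n : nat.
Hypothesis n_gt1 : (1 < n)%N.
Let N := n.*2.
Implicit Types z w : algC.

Lemma Im_unit z w : w * w^* = 1 ->
  'Im (z * w^-1) = 'Im z * 'Re w - 'Re z * 'Im w.
Proof.
move=> w1; have wN0 : w != 0 by apply: contra_eq_neq w1 => ->; rewrite mul0r eq_sym oner_eq0.
have -> : w^-1 = w^* by rewrite -[LHS]mul1r -w1 mulrAC mulfV ?mul1r.
by rewrite ImM Re_conj Im_conj mulrN addrC mulrC [in LHS]addrC; ring.
Qed.

Lemma unit_ReIm z : z * z^* = 1 -> 'Re z ^+ 2 + 'Im z ^+ 2 = 1.
Proof. by move=> z1; rewrite -normC2_Re_Im normCK. Qed.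

(* [Im (w / z) < 0] says that [w] has a smaller argument than [z]. *)
Lemma Re_lt_of_arg w z :
  w * w^* = 1 -> z * z^* = 1 -> 0 <= 'Im w -> 0 < 'Im z ->
  'Im (w * z^-1) < 0 -> 'Re z < 'Re w.
Proof.
move=> w1 z1; rewrite (Im_unit _ z1).
move: (unit_ReIm w1) (unit_ReIm z1) (Creal_Re w) (Creal_Re z) (Creal_Im w) (Creal_Im z).
move: ('Re w) ('Re z) ('Im w) ('Im z) => C c S s Cw Cz RC Rc RS Rs S0 s0 lt0.
rewrite real_ltNge //; apply/negP => leCc.
have H1 : S * c < C * s by rewrite -subr_lt0.
have H2 : (S - s) * c < 0.
  rewrite mulrBl subr_lt0; apply: lt_le_trans H1 _.
  by rewrite [s * c]mulrC ler_pM2r.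
have Ss : 0 < S + s by rewrite ltr_wpDl.
have H3 : (S - s) * (S + s) = (c - C) * (c + C).
  apply/eqP; rewrite -subr_eq0.
  have -> : (S - s) * (S + s) - (c - C) * (c + C)
            = (C ^+ 2 + S ^+ 2) - (c ^+ 2 + s ^+ 2) by ring.
  by rewrite Cw Cz subrr.
have H4 : (c - C) * ((c + C) * c) < 0.
  by rewrite mulrA -H3 mulrAC nmulr_rlt0 //.
have cC : 0 <= c - C by rewrite subr_ge0.
have H5 : (c + C) * c < 0.
  rewrite real_ltNge ?rpredM ?rpredD ?real0 //; apply/negP => ge0.
  by move: H4; rewrite real_ltNge ?rpredM ?rpredD ?rpredN ?real0 // mulr_ge0.
have c2 : 0 <= c ^+ 2 by rewrite real_exprn_even_ge0.
have [c0|c0|c0] := real_ltgtP Rc (real0 _).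
- have : 0 < c + C by rewrite -(nmulr_llt0 _ c0).
  by rewrite real_ltNge ?real0 ?rpredD // (le_trans (lerD (lexx c) leCc)) // -mulr2n mulrn_wle0 // ltW.
- have C0 : C < 0.
    have : c + C < 0 by rewrite -(pmulr_llt0 _ c0).
    rewrite -ltrBrDl sub0r => lt1; apply: lt_trans lt1 _; by rewrite oppr_lt0.
  have : S * c < 0 by apply: lt_trans H1 _; rewrite nmulr_rlt0.
  by rewrite real_ltNge ?real0 ?rpredM // mulr_ge0 // ltW.
by move: H5; rewrite c0 mulr0 ltxx.
Qed.

Lemma unity_norm k z : (0 < k)%N -> z ^+ k = 1 -> z * z^* = 1.
Proof.
move=> k0 zk; rewrite -normCK.
have /eqP : `|z| ^+ k = 1 by rewrite -normrX zk normr1.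
by rewrite pexpr_eq1 // => /eqP->; rewrite expr1n.
Qed.

(** [algC] has no exponential function, so [exp (i pi / n)] is characterised as the [2n]-th root of
    unity in the open upper half plane with the largest real part. *)
Lemma max_Re_root : exists z, [/\ z ^+ N = 1, 0 < 'Im z &
  forall w, w ^+ N = 1 -> 0 < 'Im w -> 'Re w <= 'Re z].
Proof.
have N0 : (0 < N)%N by rewrite double_gt0 ltnW.
have [r pr] := C_prim_root_exists N0.
have rk k : (r ^+ k) ^+ N = 1 by rewrite exprAC (prim_expr_order pr) expr1n.
have r1 k : (r ^+ k) * (r ^+ k)^* = 1 by apply: (unity_norm N0).
have [i0 Pi0] : exists i : 'I_N, 0 < 'Im (r ^+ i).
  have N2 : (2 < N)%N by rewrite /N -(subnKC n_gt1) .
  have Nm1 : (N.-1 < N)%N by rewrite prednK.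
  have rI : 'Im r != 0.
    apply/eqP=> I0; have := r1 1%N; rewrite expr1.
    have /Creal_ImP/CrealP-> := I0; rewrite -expr2 => /eqP.
    rewrite -(prim_order_dvd pr) => dv.
    by have := dvdn_leq (isT : (0 < 2)%N) dv; rewrite leqNgt N2.
  have [Ir|Ir|Ir] := real_ltgtP (Creal_Im r) (real0 _).
  - exists (Ordinal Nm1) => /=.
    have -> : r ^+ N.-1 = r^*.
      have := r1 1%N; rewrite expr1 => rr.
      have r0 : r != 0 by apply: contra_eq_neq rr => ->; rewrite mul0r eq_sym oner_eq0.
      by apply: (mulfI r0); rewrite rr -exprS prednK // (prim_expr_order pr).
    by rewrite Im_conj oppr_gt0.
  - have lt1 : (1 < N)%N by apply: ltn_trans N2.
    by exists (Ordinal lt1); rewrite expr1.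
  - by rewrite Ir eqxx in rI.
have [i Pi Hi] := @real_arg_maxP _ _ i0 (fun i : 'I_N => 0 < 'Im (r ^+ i))
   (fun i : 'I_N => 'Re (r ^+ i)) Pi0 (fun i _ => Creal_Re (r ^+ i)).
exists (r ^+ i); split=> // w wN Iw.
have [j Dj] := prim_rootP pr wN.
by move: Iw; rewrite Dj; apply: Hi.
Qed.

Lemma exists_zeta : exists z : algC, [/\ z ^+ n = -1, 0 < 'Im z, z ^+ N = 1 &
  forall k, (k <= n)%N -> 0 <= 'Im (z ^+ k)].
Proof.
have N0 : (0 < N)%N by rewrite double_gt0 ltnW.
have [z [zN Iz zmax]] := max_Re_root.
have z1 := unity_norm N0 zN.
have zk k : (z ^+ k) ^+ N = 1 by rewrite exprAC zN expr1n.
have zk1 k : (z ^+ k) * (z ^+ k)^* = 1 by apply: (unity_norm N0).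
have z0 : z != 0 by apply: contra_eq_neq z1 => ->; rewrite mul0r eq_sym oner_eq0.
have real1 w : w * w^* = 1 -> 'Im w = 0 -> w = 1 \/ w = -1.
  move=> w1 /Creal_ImP/CrealP wr; move: w1; rewrite wr -expr2 => /eqP.
  by rewrite sqrf_eq1 => /orP[]/eqP->; [left|right].
have zV : z^-1 = z^* by apply: (mulfI z0); rewrite z1 mulfV.
have IzV : 'Im z^-1 < 0 by rewrite zV Im_conj oppr_lt0.
(* By [Re_lt_of_arg], a root with argument strictly below that of [z] would have a larger real part;
   only [w = 1] escapes the maximality of [z]. *)
have below w : w ^+ N = 1 -> 0 <= 'Im w -> 'Im (w * z^-1) < 0 -> w = 1.
  move=> wN; have w1 := unity_norm N0 wN.
  rewrite le_eqVlt => /orP[/eqP/esym Iw0|Iw] lt0.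
    have [//|w1'] := real1 _ w1 Iw0; move: lt0.
    by rewrite w1' mulN1r raddfN /= oppr_lt0 real_ltNge ?Creal_Im ?real0 // ltW.
  have := Re_lt_of_arg w1 z1 (ltW Iw) Iz lt0.
  by rewrite real_ltNge ?Creal_Re // zmax.
have exk : exists k, 'Im (z ^+ k.+1) < 0.
  exists N.-2; rewrite prednK ?(ltn_predRL, leq_double n_gt1) //.
    suff -> : z ^+ N.-1 = z^-1 by [].
    by apply: (mulfI z0); rewrite mulfV // -exprS prednK.
  by rewrite -ltnS prednK // /N -(subnKC n_gt1).
pose k := ex_minn exk.
have [zk_lt kmin] : 'Im (z ^+ k.+1) < 0 /\ forall j, (j <= k)%N -> 0 <= 'Im (z ^+ j).
  rewrite /k; case: ex_minnP => k' lt0 min; split=> // -[|j] jk.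
    by rewrite expr0 ImE conjC1 subrr mulr0 mul0r.
  rewrite real_leNgt ?Creal_Im ?real0 //; apply/negP => /min.
  by rewrite leqNgt jk.
have zkN1 : z ^+ k = -1.
  apply/eqP; rewrite -eqr_oppLR -[_ == _](inj_eq invr_inj) invr1; apply/eqP.
  have Vc j : (z ^+ j)^-1 = (z ^+ j)^*.
    by apply: (mulfI (expf_neq0 j z0)); rewrite zk1 mulfV ?expf_neq0.
  apply: below.
  - by rewrite invrN exprNn -exprVn exprAC exprVn zN invr1 expr1n -signr_odd odd_double mulr1.
  - by rewrite invrN Vc raddfN /= Im_conj opprK kmin.
  - by rewrite invrN mulNr -invfM -exprSr Vc raddfN /= Im_conj opprK.
have k_gt0 : (0 < k)%N.
  rewrite lt0n; apply/eqP => k0; move/eqP: zkN1.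
  by rewrite k0 expr0 -subr_eq0 opprK -[1 + 1]/(2%:R) pnatr_eq0.
(* Divide [w] by [z] until it leaves the closed upper half plane: the last quotient before that is
   1. This makes the order of [z] exactly [N]. *)
have pow w : w ^+ N = 1 -> 0 < 'Im w -> exists j, w = z ^+ j.
  move=> wN Iw.
  have exi : exists i, 'Im (w * (z ^+ i)^-1) < 0.
    by exists k; rewrite zkN1 invrN invr1 mulrN1 raddfN /= oppr_lt0.
  case: (ex_minnP exi) => -[|j] lt0 min.
    by move: lt0; rewrite expr0 invr1 mulr1 real_ltNge ?Creal_Im ?real0 // ltW.
  exists j; apply: (divIf (expf_neq0 j z0)); rewrite divff ?expf_neq0 //.
  apply: below.
  - by rewrite exprMn wN mul1r exprVn zk invr1.
  - rewrite real_leNgt ?Creal_Im ?real0 //; apply/negP => /min; by rewrite ltnn.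
  - by move: lt0; rewrite exprSr invfM mulrA mulrAC.
have [r pr] := C_prim_root_exists N0.
have rN := prim_expr_order pr.
have r1 := unity_norm N0 rN.
have r0 : r != 0 by apply: contra_eq_neq r1 => ->; rewrite mul0r eq_sym oner_eq0.
have N2 : (2 < N)%N by rewrite /N -(subnKC n_gt1).
have dvdz i : z ^+ i = 1 -> (N %| i)%N.
  move=> zi; rewrite (prim_order_dvd pr); apply/eqP.
  have [Ir|Ir|Ir] := real_ltgtP (Creal_Im r) (real0 _).
  - have rV : r^-1 = r^* by apply: (mulfI r0); rewrite r1 mulfV.
    have [||j rj] := pow r^-1; first by rewrite exprVn rN invr1.
      by rewrite rV Im_conj oppr_gt0.
    by apply: invr_inj; rewrite invr1 -exprVn rj exprAC zi expr1n.
  - by have [j ->] := pow _ rN Ir; rewrite exprAC zi expr1n.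
  have [r1'|r1'] := real1 _ r1 Ir; first by rewrite r1' expr1n.
  have /eqP : r ^+ 2 = 1 by rewrite r1' sqrrN expr1n.
  rewrite -(prim_order_dvd pr) => dv.
  by have := dvdn_leq (isT : (0 < 2)%N) dv; rewrite leqNgt N2.
exists z; split=> // [|j jn].
  have : (z ^+ n) ^+ 2 = 1 by rewrite -exprM muln2.
  move/eqP; rewrite sqrf_eq1 => /orP[/eqP/dvdz|/eqP//].
  move/dvdn_leq => /(_ (ltnW n_gt1)); rewrite leqNgt /N -addnn -{1}[n]addn0 ltn_add2l.
  by rewrite ltnW.
apply: kmin; apply: leq_trans jn _.
have : (N %| k.*2)%N by apply: dvdz; rewrite -muln2 exprM zkN1 sqrrN expr1n.
by move/dvdn_leq; rewrite double_gt0 leq_double; apply.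
Qed.

(* The sequence [sin (k * pi / n) / sin (pi / n)], as a linear recurrence. *)
Fixpoint sin_ratio (c : algC) k : algC :=
  if k is k1.+1 then if k1 is k2.+1 then c * sin_ratio c k1 - sin_ratio c k2 else 1
  else 0.

Lemma sin_ratioSS c k :
  sin_ratio c k.+2 = c * sin_ratio c k.+1 - sin_ratio c k.
Proof. by []. Qed.

Lemma sin_ratioE (z : algC) k : 
  (z - z^-1) * sin_ratio (z + z^-1) k = z ^+ k - z^-1 ^+ k.
Proof.
have [->|z0] := eqVneq z 0.
  by rewrite invr0 subrr mul0r subrr.
elim/ltn_ind: k => -[|[|k]] IH; first by rewrite !expr0 subrr mulr0.
  by rewrite !expr1 mulr1.
rewrite sin_ratioSS mulrBr mulrCA IH // IH // !exprS.
have -> : (z + z^-1) * (z * z ^+ k - z^-1 * z^-1 ^+ k) =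
   z * (z * z ^+ k) - z^-1 * (z^-1 * z^-1 ^+ k) + (z * z^-1) * (z ^+ k - z^-1 ^+ k).
  by ring.
by rewrite mulfV // mul1r addrK.
Qed.

End RootOfUnity.

Lemma exists_cos n : (1 < n)%N -> exists z : algC, [/\ z ^+ n.*2 = 1, z != 0, 
  z - z^-1 != 0 & forall k, (k <= n)%N -> 0 <= sin_ratio (z + z^-1) k].
Proof.
move=> n1; have [z [zn Iz zN Ik]] := exists_zeta n1.
have N0 : (0 < n.*2)%N by rewrite double_gt0 ltnW.
have z1 := unity_norm N0 zN.
have z0 : z != 0 by apply: contra_eq_neq z1 => ->; rewrite mul0r eq_sym oner_eq0.
have zV : z^-1 = z^* by apply: (mulfI z0); rewrite z1 mulfV.
have subE w : w - w^* = 2 * 'i * 'Im w.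
  rewrite ImE mulrA mulrC; have -> : 2 * 'i * ('i * (w^* - w)) = 2 * ('i ^+ 2) * (w^* - w) by ring.
  by rewrite sqrCi; have := pnatr_eq0 algC 2; move/negbT=> n2; field.
have i2 : 2 * 'i != 0 :> algC by rewrite mulf_neq0 ?pnatr_eq0 ?neq0Ci.
have d0 : z - z^-1 != 0 by rewrite zV subE mulf_neq0 // gt_eqF.
exists z; split=> // k kn.
have := sin_ratioE z k; rewrite zV -rmorphXn !subE => E0.
have E : 'Im z * sin_ratio (z + z^*) k = 'Im (z ^+ k).
  by apply: (mulfI i2); rewrite mulrA.
have -> : sin_ratio (z + z^*) k = 'Im (z ^+ k) / 'Im z.
  by apply: (mulfI (lt0r_neq0 Iz)); rewrite E mulrCA mulfV ?mulr1 ?lt0r_neq0.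
by rewrite divr_ge0 ?Ik // ltW.
Qed.

Local Close Scope ring_scope.

(** * The numbers game and positivity of roots *)

Local Open Scope ring_scope.

Definition zeta (n : nat) : algC :=
  if pselect (1 < n)%N is left n1 then sval (cid (exists_cos n1)) else 1.

Lemma zetaP n : (1 < n)%N -> [/\ zeta n ^+ n.*2 = 1, zeta n != 0, 
  zeta n - (zeta n)^-1 != 0 &
  forall k, (k <= n)%N -> 0 <= sin_ratio (zeta n + (zeta n)^-1) k].
Proof. by move=> n1; rewrite /zeta; case: pselect => // h; case: cid. Qed.

Lemma sin_ratio2 k : sin_ratio 2 k = k%:R.
Proof.
elim/ltn_ind: k => -[|[|k]] IH //; rewrite sin_ratioSS !IH //.
by rewrite -[in RHS]addn2 natrD -[k.+1]addn1 natrD; ring.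
Qed.

Section NumbersGame.
Variables (V : finType) (e : rel V) (m : V -> V -> nat).
Hypothesis cg : coxeter_graph e m.
Implicit Types (u w : seq V) (s t a b v : V) (X : {set V}).
Local Notation "u ~ w" := (cox_eq e m u w) (at level 70).
Local Notation vec := {ffun V -> algC}.
Implicit Types (x y : vec).

(** Minus twice the Tits form on two distinct simple roots; the value 2 on non-edges is the case of
    infinite order. *)
Definition two_cos s t : algC :=
  if e s t then zeta (m s t) + (zeta (m s t))^-1 else 2.

Lemma two_cosC s t : two_cos s t = two_cos t s.
Proof.
case: cg => eC _ mC _; rewrite /two_cos -[e t s]eC.
by case: ifP => // /mC->.
Qed.

(* Mozes' numbers game: the affine reflection
   [x |-> x - (<x, alpha_s> + y_s) alpha_s] in coordinates on the simple roots.
   Here [y] stands for a combination of fundamental weights: the reflection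
   changes it by a multiple of [alpha_s], which is accounted for in [x]. *)
Definition refl s y x : vec :=
  [ffun v => if v == s then - x s + \sum_(t | t != s) two_cos s t * x t - y s
             else x v].

Definition scale (c : algC) x : vec := [ffun v => c * x v].

Definition play y w x : vec := foldr (fun s => refl s y) x w.

Definition sroot s : vec := [ffun v => (v == s)%:R].

Lemma play_cat y u w x : play y (u ++ w) x = play y u (play y w x).
Proof. by rewrite /play foldr_cat. Qed.

Lemma play_cons y s w x : play y (s :: w) x = refl s y (play y w x).
Proof. by []. Qed.

Lemma refl_other s y x v : v != s -> refl s y x v = x v.
Proof. by move/negPf=> vs; rewrite ffunE vs. Qed.

Lemma refl_self s y x :
  refl s y x s = - x s + \sum_(t | t != s) two_cos s t * x t - y s.
Proof. by rewrite ffunE eqxx. Qed.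

Lemma reflD s y y' x x' : refl s (y + y') (x + x') = refl s y x + refl s y' x'.
Proof.
apply/ffunP=> v; rewrite [RHS]ffunE.
have [->|vs] := eqVneq v s; last by rewrite !refl_other // ffunE.
rewrite !refl_self !ffunE.
under eq_bigr => t _ do rewrite ffunE mulrDr.
by rewrite big_split /=; ring.
Qed.

Lemma reflZ c s y x : refl s (scale c y) (scale c x) = scale c (refl s y x).
Proof.
apply/ffunP=> v; rewrite [RHS]ffunE.
have [->|vs] := eqVneq v s; last by rewrite !refl_other // ffunE.
rewrite !refl_self !ffunE; under eq_bigr => t _ do rewrite ffunE mulrCA.
by rewrite -mulr_sumr; ring.
Qed.

Lemma playD w y y' x x' : play (y + y') w (x + x') = play y w x + play y' w x'.
Proof. by elim: w => //= s w ->; rewrite reflD. Qed.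

Lemma playZ c w y x : play (scale c y) w (scale c x) = scale c (play y w x).
Proof. by elim: w => //= s w ->; rewrite reflZ. Qed.

Lemma play0D w x x' : play 0 w (x + x') = play 0 w x + play 0 w x'.
Proof. by rewrite -playD addr0. Qed.

Lemma play0Z c w x : play 0 w (scale c x) = scale c (play 0 w x).
Proof.
rewrite -playZ; congr play; apply/ffunP=> v; by rewrite !ffunE mulr0.
Qed.

Lemma play00 w : play 0 w 0 = 0.
Proof. by apply: (addrI (play 0 w 0)); rewrite -play0D !addr0. Qed.

Lemma play0_sum (I : finType) (P : pred I) (F : I -> vec) w :
  play 0 w (\sum_(i | P i) F i) = \sum_(i | P i) play 0 w (F i).
Proof. by apply: (big_morph (play 0 w)) => [x x'|]; rewrite ?play0D ?play00. Qed.

Lemma refl_root s : refl s 0 (sroot s) = - sroot s.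
Proof.
apply/ffunP=> v; rewrite [RHS]ffunE.
have [->|vs] := eqVneq v s; last by rewrite refl_other // !ffunE (negPf vs) oppr0.
rewrite refl_self !ffunE subr0 big1 ?addr0 // => t /negPf ts.
by rewrite ffunE ts mulr0.
Qed.

Lemma refl_root_neq s t : s != t -> refl t 0 (sroot s) = sroot s + scale (two_cos t s) (sroot t).
Proof.
move=> st; apply/ffunP=> v; rewrite [RHS]ffunE.
have [->|vt] := eqVneq v t; last first.
  by rewrite refl_other // !ffunE (negPf vt) /= mulr0 addr0.
rewrite refl_self !ffunE eqxx subr0 eq_sym (negPf st) oppr0 !add0r.
rewrite (bigD1 s) //= big1 ?addr0 => [|r /andP[_ /negPf rs]]; rewrite ffunE ?eqxx ?rs ?mulr0 //.
Qed.

Lemma reflK s y : involutive (refl s y).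
Proof.
move=> x; apply/ffunP=> v.
have [->|vs] := eqVneq v s; last by rewrite !refl_other.
have E : \sum_(t | t != s) two_cos s t * refl s y x t = \sum_(t | t != s) two_cos s t * x t.
  by apply: eq_bigr => t ts; rewrite refl_other.
by rewrite !refl_self E; ring.
Qed.

(* In the eigencoordinates [x_t - z x_s] and [x_t - z^-1 x_s], taken relative
   to the fixed point of [refl s] and [refl t], the rotation
   [refl s \o refl t] is diagonal, with eigenvalues [z ^+ 2] and [z ^- 2]. *)
Lemma braid_act s t y x : e s t -> play y (flatten (nseq (m s t) [:: s; t])) x = x.
Proof.
case: cg => eC eI mC m2 est.
have st : s != t by apply: contraTneq est => ->; rewrite (negPf (eI t)).
have [zN z0 d0 _] := zetaP (m2 _ _ est).
have Ecst : two_cos s t = zeta (m s t) + (zeta (m s t))^-1 by rewrite /two_cos est.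
move: (zeta _) zN z0 d0 Ecst => z zN z0 d0 Ecst.
have Ects : two_cos t s = z + z^-1 by rewrite two_cosC.
pose p := \sum_(r | (r != s) && (r != t)) two_cos s r * x r - y s.
pose q := \sum_(r | (r != s) && (r != t)) two_cos t r * x r - y t.
have zz : z * z^-1 = 1 by rewrite mulfV.
have c4 : 4 - (z + z^-1) ^+ 2 != 0.
  have -> : 4 - (z + z^-1) ^+ 2 = - (z - z^-1) ^+ 2 by field.
  by rewrite oppr_eq0 expf_neq0.
have [a [b [Ha Hb]]] : exists a b : algC, 2 * a = (z + z^-1) * b + p /\ 2 * b = (z + z^-1) * a + q.
  exists ((2 * p + (z + z^-1) * q) / (4 - (z + z^-1) ^+ 2)),
         ((2 * q + (z + z^-1) * p) / (4 - (z + z^-1) ^+ 2)).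
  move: (z + z^-1) c4 => c c4; by split; field.
pose same (x' : vec) := forall r, r != s -> r != t -> x' r = x r.
have step_s x' : same x' -> refl s y x' s = - x' s + (z + z^-1) * x' t + p.
  move=> Sx; have E : \sum_(r | (r != s) && (r != t)) two_cos s r * x' r = p + y s.
    by rewrite /p subrK; apply: eq_bigr => r /andP[rs rt]; rewrite Sx.
  by rewrite refl_self (bigD1 t) 1?eq_sym //= E Ecst; ring.
have step_t x' : same x' -> refl t y x' t = - x' t + (z + z^-1) * x' s + q.
  move=> Sx; have E : \sum_(r | (r != t) && (r != s)) two_cos t r * x' r = q + y t.
    rewrite /q subrK (eq_bigl (fun r => (r != s) && (r != t))) => [|r]; last by rewrite andbC.
    by apply: eq_bigr => r /andP[rs rt]; rewrite Sx.
  by rewrite refl_self (bigD1 s) //= E Ects; ring.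
pose P (x' : vec) := x' t - b - z * (x' s - a).
pose M (x' : vec) := x' t - b - z^-1 * (x' s - a).
have inv n : let x' := play y (flatten (nseq n [:: s; t])) x in
    [/\ same x', P x' = z ^+ n.*2 * P x & M x' = z^-1 ^+ n.*2 * M x].
  elim: n => [|n [Sx Px Mx]] /=; first by split; rewrite ?expr0 ?mul1r.
  set x1 := play _ _ x in Sx Px Mx *.
  have S2 : same (refl t y x1) by move=> r rs rt; rewrite refl_other ?Sx.
  have S3 : same (refl s y (refl t y x1)) by move=> r rs rt; rewrite refl_other ?S2.
  have vs : refl t y x1 s = x1 s by rewrite refl_other.
  have Q1 : q = 2 * b - (z + z^-1) * a by rewrite Hb; ring.
  have P1 : p = 2 * a - (z + z^-1) * b by rewrite Ha; ring.
  rewrite doubleS !exprS -!mulrA (mulrCA z) (mulrCA z^-1) -Px -Mx; split=> //.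
    rewrite /P (refl_other _ _ (_ : t != s)) 1?eq_sym // step_s // vs step_t // Q1 P1.
    by field.
  rewrite /M (refl_other _ _ (_ : t != s)) 1?eq_sym // step_s // vs step_t // Q1 P1.
  by field.
have [S1 P1 M1] := inv (m s t).
move: S1 P1 M1; set x' := play _ _ _ => S1.
rewrite exprVn zN invr1 !mul1r => P1 M1.
have Es : x' s = x s.
  apply: (addIr (- a)); apply: (mulfI d0).
  have D (f : vec) : (z - z^-1) * (f s - a) = M f - P f by rewrite /M /P; ring.
  by rewrite !D M1 P1.
apply/ffunP=> r; have [->//|rs] := eqVneq r s; have [->|rt] := eqVneq r t; last exact: S1.
by move: P1; rewrite /P Es => /addIr/addIr.
Qed.

Lemma play_cox u w y x : u ~ w -> play y u x = play y w x.
Proof.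
move=> uw; elim: uw x => {u w} [//|u w _ IH x|u u1 w _ IH1 _ IH2 x|u s w x|u s t w est x].
- by rewrite IH.
- by rewrite IH1 IH2.
- by rewrite !play_cat /= reflK.
- by rewrite !play_cat braid_act.
Qed.

End NumbersGame.

Section Alternating.
Variable V : eqType.
Implicit Types (s t : V).

Definition alt s t k := mkseq (fun i => if odd i then t else s) k.

Lemma size_alt s t k : size (alt s t k) = k.
Proof. exact: size_mkseq. Qed.

Lemma altS s t k : alt s t k.+1 = s :: alt t s k.
Proof.
rewrite /alt /mkseq /= -[1%N]add1n iotaDl -map_comp; congr (_ :: _).
by apply: eq_map => i /=; case: (odd i).
Qed.

Lemma alt_rcons s t k : alt s t k.+1 = rcons (alt s t k) (if odd k then t else s).
Proof. by rewrite /alt mkseqS. Qed.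

Lemma alt_double s t n : alt s t n.*2 = flatten (nseq n [:: s; t]).
Proof. by elim: n => // n IHn; rewrite doubleS !altS IHn. Qed.

Lemma alt_cat s t i j : exists r, alt s t (i + j) = alt s t i ++ r /\ size r = j.
Proof.
elim: i s t => [|i IHi] s t; first by exists (alt s t j); rewrite size_alt.
by have [r [Er sr]] := IHi t s; exists r; rewrite addSn !altS Er.
Qed.

Lemma alt_path s t u : all (pred2 s t) u -> path (fun p q => p != q) s u -> s != t ->
  u = alt t s (size u).
Proof.
elim: u s t => //= r u IHu s t /andP[/pred2P[->|->]]; first by rewrite eqxx.
move=> uA /andP[st pu] _; rewrite altS -IHu 1?eq_sym //.
by apply: sub_all uA => x /=; rewrite orbC.
Qed.

End Alternating.

Section Positivity.
Variables (V : finType) (e : rel V) (m : V -> V -> nat).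
Hypothesis cg : coxeter_graph e m.
Implicit Types (u w : seq V) (s t a b v : V) (X : {set V}).
Local Notation "u ~ w" := (cox_eq e m u w) (at level 70).
Local Notation vec := {ffun V -> algC}.

Local Notation c := (@two_cos V e m).
Local Notation play := (@play V e m).

Implicit Types (x y : vec).

(** Minimality is among words over [X]: the length meant is that of [W_X], as required for shortest
    representatives of double cosets inside [W_X]. *)
Definition reduced X w :=
  all (mem X) w /\ forall u, all (mem X) u -> u ~ w -> (size w <= size u)%N.

Lemma exists_reduced X w : all (mem X) w -> exists2 w', reduced X w' & w' ~ w.
Proof.
have [n] := ubnP (size w); elim: n w => // n IHn w wn wX.
have [[u [uX uw lt]]|no] := pselect (exists u, [/\ all (mem X) u, u ~ w & (size u < size w)%N]).
  have [|w' rw' w'u] := IHn u _ uX; first by apply: leq_trans lt _.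
  by exists w' => //; apply: cox_trans uw.
exists w; last exact: cox_refl.
split=> // u uX uw; rewrite leqNgt; apply/negP=> lt; apply: no; by exists u.
Qed.

Lemma reduced_catl X u w : reduced X (u ++ w) -> reduced X u.
Proof.
rewrite /reduced all_cat => -[/andP[uX wX] min]; split=> // u' u'X u'u.
have := min (u' ++ w); rewrite all_cat u'X wX !size_cat leq_add2r; apply=> //.
by apply: cox_cat => //; apply: cox_refl.
Qed.

Lemma reduced_catr X u w : reduced X (u ++ w) -> reduced X w.
Proof.
rewrite /reduced all_cat => -[/andP[uX wX] min]; split=> // u' u'X u'u.
have := min (u ++ u'); rewrite all_cat u'X uX !size_cat leq_add2l; apply=> //.
by apply: cox_cat => //; apply: cox_refl.
Qed.

Lemma reduced_cox X u w : all (mem X) u -> u ~ w -> size u = size w -> 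
  reduced X w -> reduced X u.
Proof.
move=> uX uw su [wX min]; split=> // u' u'X u'u; rewrite su; apply: min => //.
exact: cox_trans uw.
Qed.

Lemma reduced_rev X w : reduced X w -> reduced X (rev w).
Proof.
move=> [wX min]; split=> [|u uX urw]; first by rewrite all_mem_rev.
rewrite size_rev -[size u]size_rev; apply: min; rewrite ?all_mem_rev //.
by rewrite -[w]revK; apply: cox_rev.
Qed.

Lemma not_reduced_nn X u s w : ~ reduced X (u ++ [:: s; s] ++ w).
Proof.
move=> [wX /(_ (u ++ w))]; rewrite !size_cat /= => H.
suff : (size u + (size w).+2 <= size u + size w)%N by rewrite leq_add2l ltnNge leqnSn.
apply: H; last by apply/cox_sym/cox_sq.
by move: wX; rewrite !all_cat /= => /andP[-> /andP[_ ->]].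
Qed.

Lemma reduced_path X s w : reduced X (s :: w) -> path (fun p q => p != q) s w.
Proof.
elim: w s => //= t w IHw s rw; apply/andP; split.
  by apply/negP=> /eqP st; move: rw; rewrite st; apply: (@not_reduced_nn X [::]).
by apply: IHw; apply: (@reduced_catr X [:: s]).
Qed.

(** An alternating word of [m + 1] letters equals the inverse of the remaining [m - 1] letters of
    the relator. *)
Lemma alt_long X s t k : e s t -> reduced X (alt s t k) -> (k <= m s t)%N.
Proof.
move=> est; case: (cg) => _ _ _ /(_ _ _ est) m2 red; rewrite leqNgt; apply/negP=> lt.
have [k' Ek] : exists k', k = ((m s t).+1 + k')%N by exists (k - (m s t).+1)%N; rewrite subnKC.
have [r1 [E1 _]] := alt_cat s t (m s t).+1 k'; rewrite -Ek in E1.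
have {red} red : reduced X (alt s t (m s t).+1) by move: red; rewrite E1 => /reduced_catl.
have [r [E sr]] := alt_cat s t (m s t).+1 (m s t).-1.
have E2 : alt s t (m s t).+1 ++ r ~ [::].
  rewrite -E (_ : _ + _ = (m s t).*2)%N; last by rewrite -addnn; lia.
  rewrite alt_double -[flatten _]cats0 -[_ ++ _]cat0s -[X in _ ~ X]cat0s.
  exact: cox_edge.
have [aX /(_ (rev r))] := red; rewrite size_alt size_rev sr all_mem_rev => H.
suff : (m s t < (m s t).-1)%N by lia.
apply: H; last by apply/cox_sym; apply: (cox_mover E2).
have [sX tX] : s \in X /\ t \in X.
  have : (1 < (m s t).+1)%N by lia.
  by move: aX; case: (m s t).+1 => [|[|n]] //; rewrite !altS /= => /and3P[].
have : all (mem X) (alt s t ((m s t).+1 + (m s t).-1)).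
  by apply/allP => p /mapP[i _ ->]; case: (odd i).
rewrite E all_cat => /andP[_ rX]; exact: rX.
Qed.

(** The recurrence of [sin_ratio] is the effect of one reflection on the two coefficients of a root
    of the dihedral group. *)
Lemma play_alt s t k : s != t ->
  play 0 (rev (alt t s k)) (sroot s) =
  if odd k then scale (sin_ratio (c s t) k) (sroot s) + scale (sin_ratio (c s t) k.+1) (sroot t)
  else scale (sin_ratio (c s t) k.+1) (sroot s) + scale (sin_ratio (c s t) k) (sroot t).
Proof.
move=> st; elim: k => [|k IHk].
  by apply/ffunP=> v; rewrite !ffunE /= mul1r mul0r addr0.
have reflT a b (x x' : algC) : a != b ->
    refl e m b 0 (scale x (sroot a) + scale x' (sroot b)) =
    scale x (sroot a) + scale (c a b * x - x') (sroot b).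
  move=> ab; rewrite -[X in refl _ _ _ X]addr0 reflD.
  have -> : 0 = scale x 0 :> vec by apply/ffunP=> v; rewrite !ffunE mulr0.
  rewrite reflZ refl_root_neq //.
  have -> : scale x 0 = scale x' 0 :> vec by apply/ffunP=> v; rewrite !ffunE !mulr0.
  rewrite reflZ refl_root; apply/ffunP=> v; rewrite !ffunE (two_cosC cg b a); ring.
rewrite alt_rcons rev_rcons play_cons IHk sin_ratioSS -[odd k.+1]/(~~ odd k) if_neg.
case: (odd k); last by rewrite reflT.
by rewrite [X in refl _ _ _ _ X]addrC reflT 1?eq_sym // (two_cosC cg t s) addrC.
Qed.

Definition nonneg x := forall v, 0 <= x v.

Lemma nonnegD x x' : nonneg x -> nonneg x' -> nonneg (x + x').
Proof. by move=> x0 x'0 v; rewrite ffunE addr_ge0. Qed.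

Lemma nonneg_scale (r : algC) x : 0 <= r -> nonneg x -> nonneg (scale r x).
Proof. by move=> r0 x0 v; rewrite ffunE mulr_ge0. Qed.

Lemma sin_ratio_ge0 s t k : (e s t -> k <= m s t)%N -> 0 <= sin_ratio (c s t) k.
Proof.
rewrite /two_cos; case: ifP => [est /(_ isT) km|_ _]; last by rewrite sin_ratio2 ler0n.
by case: (cg) => _ _ _ /(_ _ _ est)/zetaP[_ _ _]; apply.
Qed.

(** The classical dihedral reduction. With [t] the last letter of [w], write [w = u r] where [r] is
    a word in [s] and [t] and [u] is as short as possible. Then [r] sends [alpha_s] to a nonnegative
    combination of [alpha_s] and [alpha_t], and induction applies to [u s] and [u t]. *)
Theorem play_root_nonneg X w s : reduced X (rcons w s) -> nonneg (play 0 w (sroot s)).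
Proof.
have [n] := ubnP (size w); elim: n w s => // n IHn w s.
case: (lastP w) => [|w' t]; first by move=> _ _ v /=; rewrite ffunE ler0n.
rewrite size_rcons ltnS => wn red.
have ts : t != s.
  by apply/eqP => ts; move: red; rewrite ts -!cats1 -catA; apply: not_reduced_nn.
have rw : reduced X (rcons w' t) by move: red; rewrite -cats1; apply: reduced_catl.
pose dec k := `[< exists u r, [/\ size u = k, u ++ r ~ rcons w' t, all (mem X) u,
   all (pred2 s t) r & (size u + size r)%N = (size w').+1] >].
have exdec : exists k, dec k.
  exists (size w'); apply/asboolP; exists w', [:: t]; split=> //.
  - by rewrite cats1; apply: cox_refl.
  - by case: rw => +_; rewrite all_rcons => /andP[].
  - by rewrite /= eqxx orbT.
  - by rewrite addn1.
case: (ex_minnP exdec) => k /asboolP[u [r [uk ur uX rst sur]]] min.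
have kw : (k <= size w')%N.
  apply: min; apply/asboolP; exists w', [:: t]; split=> //.
  - by rewrite cats1; apply: cox_refl.
  - by case: rw => +_; rewrite all_rcons => /andP[].
  - by rewrite /= eqxx orbT.
  - by rewrite addn1.
have [sX tX] : s \in X /\ t \in X.
  by case: red => + _; rewrite !all_rcons => /and3P[].
have rX : all (mem X) r by apply: sub_all rst => z /pred2P[]->.
have red_ur : reduced X (u ++ r).
  apply: reduced_cox ur _ rw; rewrite ?all_cat ?uX //.
  by rewrite size_cat size_rcons.
(* If [u z] had a shorter expression, moving [z] to the front of [r] would contradict the choice of
   [u]. *)
have up z : z = s \/ z = t -> reduced X (rcons u z).
  move=> Dz; have zX : z \in X by case: Dz => ->.
  have uzX : all (mem X) (rcons u z) by rewrite all_rcons uX andbT.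
  have [u' ru' u'uz] := exists_reduced uzX.
  case: (ltnP (size u') (size (rcons u z))) => [lt|ge]; last first.
    apply: reduced_cox (cox_sym u'uz) _ (ru') => //; apply/eqP; rewrite eqn_leq ge /=.
    by case: ru' => u'X; apply=> //; apply: cox_sym.
  have lt' : (size u' < size u)%N.
    have := cox_parity u'uz; move: lt; rewrite size_rcons ltnS leq_eqVlt => /orP[/eqP->|//].
    by rewrite /=; case: (odd _).
  have u'X := ru'.1.
  have dec' : u' ++ (z :: r) ~ rcons w' t.
    apply: cox_trans (cox_cat u'uz (cox_refl e m (z :: r))) _.
    by rewrite cat_rcons; apply: cox_trans ur; apply: cox_sq.
  have sz : (size u' + size (z :: r))%N = (size w').+1.
    apply/eqP; rewrite eqn_leq; apply/andP; split; first by rewrite -sur addnS -addSn leq_add2r.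
    have := rw.2 (u' ++ z :: r); rewrite size_rcons size_cat; apply=> //.
    by rewrite all_cat u'X /= zX.
  have : dec (size u').
    apply/asboolP; exists u', (z :: r); split=> //=; rewrite rst andbT.
    by case: Dz => ->; rewrite eqxx ?orbT.
  by move/min; rewrite -uk leqNgt lt'.
have uN : (size u < n)%N by rewrite uk; apply: leq_ltn_trans kw wn.
have us := IHn u s uN (up s (or_introl erefl)).
have ut := IHn u t uN (up t (or_intror erefl)).
have red_s : reduced X (rcons r s).
  apply: (@reduced_catr X u); rewrite -rcons_cat.
  apply: reduced_cox red.
  - by rewrite all_rcons all_cat uX rX /= sX.
  - rewrite -(cats1 _ s) -(cats1 (rcons _ _)); apply: cox_cat => //; exact: cox_refl.
  - by rewrite !size_rcons size_cat sur.
have rev_s := reduced_rev red_s; rewrite rev_rcons in rev_s.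
have Er : rev r = alt t s (size r).
  rewrite -size_rev; apply: alt_path; rewrite ?all_rev //; last by rewrite eq_sym.
  exact: reduced_path rev_s.
(* The inverse of [r s] is reduced and alternating, so its length stays in the range where
   [sin_ratio] is nonnegative. *)
have kbound : e s t -> ((size r).+1 <= m s t)%N.
  by move=> est; apply: (@alt_long X) => //; rewrite altS -Er.
rewrite -(play_cox cg _ _ ur) play_cat -[r]revK Er play_alt 1?eq_sym //.
have a1 := sin_ratio_ge0 kbound.
have a0 : 0 <= sin_ratio (c s t) (size r).
  by apply: sin_ratio_ge0 => /kbound; apply: leq_trans.
by case: ifP => _; rewrite play0D !play0Z; apply: nonnegD; apply: nonneg_scale.
Qed.

End Positivity.

Local Close Scope ring_scope.

(** * Special double cosets *)

Local Open Scope ring_scope.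

Section DoubleCosets.
Variables (V : finType) (e : rel V) (m : V -> V -> nat).
Hypothesis cg : coxeter_graph e m.
Implicit Types (u w z : seq V) (s t a b v : V) (X : {set V}).
Local Notation "u ~ w" := (cox_eq e m u w) (at level 70).
Local Notation vec := {ffun V -> algC}.
Local Notation play := (@play V e m).
Implicit Types (x y : vec).

Lemma reduced_of_parity X w : all (mem X) w ->
  (forall u, all (mem X) u -> u ~ w -> (size w <= (size u).+1)%N) -> reduced e m X w.
Proof.
move=> wX H; split=> // u uX uw; move: (H u uX uw).
rewrite leq_eqVlt ltnS => /orP[/eqP sw|//].
by have := cox_parity uw; rewrite sw /=; case: (odd _).
Qed.

Lemma play_support X w x r : all (mem X) w -> r \notin X -> play 0 w x r = x r.
Proof.
move=> + rX; elim: w => //= s w IHw /andP[sX wX]; rewrite -play_cons play_cons refl_other ?IHw //.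
by apply: contraNneq rX => ->.
Qed.

Lemma sroot_expand x : x = \sum_r scale (x r) (sroot r).
Proof.
apply/ffunP=> v; rewrite sum_ffunE (bigD1 v) //= big1 => [|r rv].
  by rewrite !ffunE eqxx mulr1 addr0.
by rewrite !ffunE eq_sym (negPf rv) mulr0.
Qed.

(** If [w' s] is reduced and fixes [alpha_s], then [w' alpha_s = - alpha_s], against positivity. *)
Lemma play_faithful w : (forall s, play 0 w (sroot s) = sroot s) -> w ~ [::].
Proof.
have wT : all (mem [set: V]) w by apply/allP => s _; rewrite inE.
have [w' rw' w'w] := exists_reduced e m wT; move=> fw.
apply: cox_trans (cox_sym w'w) _; case/lastP: w' rw' w'w => [|w' s] rw' w'w; first exact: cox_refl.
have pos : 0 <= play 0 w' (sroot s) s := play_root_nonneg cg rw' s.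
have : play 0 (rcons w' s) (sroot s) = sroot s by rewrite (play_cox cg _ _ w'w) fw.
rewrite -cats1 play_cat /= refl_root => E.
have : play 0 w' (sroot s) + play 0 w' (- sroot s) = 0 by rewrite -play0D subrr play00.
rewrite E => /ffunP/(_ s); rewrite !ffunE eqxx => E2.
by have : (0 : algC) < 1 := ltr01; rewrite -(ltrD2l (play 0 w' (sroot s) s)) E2 addr0 => /(le_lt_trans pos); rewrite ltxx.
Qed.

(** The coefficient of [alpha_v] in [omega_t - w omega_t]: when [y = sroot t], a position [x] stands
    for [omega_t + x]. *)
Definition weight t w v : algC := - play (sroot t) w 0 v.

Lemma weight_cox t u w v : u ~ w -> weight t u v = weight t w v.
Proof. by move=> uw; rewrite /weight (play_cox cg _ _ uw). Qed.

Lemma weight_rcons t w s v :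
  weight t (rcons w s) v = weight t w v + (if s == t then play 0 w (sroot t) v else 0).
Proof.
rewrite /weight -cats1 play_cat play_cons.
have -> : refl e m s (sroot t) 0 = if s == t then - sroot t else 0.
  apply/ffunP=> r; have [->|rs] := eqVneq r s; last first.
    rewrite refl_other // ; case: eqP => [st|_]; rewrite !ffunE //.
    by rewrite -st (negPf rs) oppr0.
  rewrite refl_self !ffunE big1 => [|a _]; last by rewrite ffunE mulr0.
  rewrite oppr0 !add0r; case: eqP => [->|/eqP st]; rewrite !ffunE ?eqxx //.
  by rewrite oppr0.
case: eqP => st; last by rewrite addr0.
have D : play (sroot t) w (- sroot t) + play 0 w (sroot t) = play (sroot t) w 0.
  by rewrite -playD addr0 addNr.
by rewrite -D ffunE opprD subrK.
Qed.

Lemma weight_catl t u w v : v \notin u -> weight t (u ++ w) v = weight t w v.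
Proof.
elim: u => //= s u IHu; rewrite inE negb_or => /andP[vs vu].
by rewrite -(IHu vu) /weight play_cons refl_other.
Qed.

Lemma weight_catr t u w v : t \notin w -> weight t (u ++ w) v = weight t u v.
Proof.
elim/last_ind: w => [|w s IHw]; rewrite ?cats0 // mem_rcons inE negb_or => /andP[ts tw].
by rewrite -rcons_cat weight_rcons eq_sym (negPf ts) addr0 IHw.
Qed.

Lemma weight_nonneg X t w v : reduced e m X w -> 0 <= weight t w v.
Proof.
elim/last_ind: w => [|w s IHw] red; first by rewrite /weight /= ffunE oppr0.
rewrite weight_rcons addr_ge0 //.
  by apply: IHw; move: red; rewrite -cats1 => /reduced_catl.
by case: eqP => // <-; apply: (play_root_nonneg cg red).
Qed.

(* With [z] shortest in its double coset and last letter [t], the positive root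
   [beta := z' alpha_t] has no [alpha_v]-component, so [z^-1 beta] is positive;
   but [z^-1 beta = - alpha_t]. *)
Theorem weight0_double_coset X v t z : all (mem X) z -> weight t z v = 0 ->
  exists y1 y2 : seq V, [/\ all (mem (X :\ v)) y1, all (mem (X :\ t)) y2 & z ~ y1 ++ y2].
Proof.
move=> zX wz.
pose dec k := `[< exists y1 z' y2 : seq V, [/\ all (mem (X :\ v)) y1, all (mem X) z', size z' = k,
   all (mem (X :\ t)) y2 & z ~ y1 ++ z' ++ y2] >].
have exdec : exists k, dec k.
  exists (size z); apply/asboolP; exists [::], z, [::]; split=> //.
  by rewrite cats0; apply: cox_refl.
case: (ex_minnP exdec) => k /asboolP[y1 [z' [y2 [y1X z'X sz y2X zz']]]] min.
have minX u (y1' y2' : seq V) : all (mem (X :\ v)) y1' -> all (mem (X :\ t)) y2' -> all (mem X) u -> 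
    z ~ y1' ++ u ++ y2' -> (size z' <= size u)%N.
  move=> ????; rewrite sz; apply: min; apply/asboolP; by exists y1', u, y2'.
have red : reduced e m X z'.
  split=> // u uX uz'; apply: (minX _ y1 y2) => //.
  apply: cox_trans zz' _; apply: cox_cat; first exact: cox_refl.
  by apply: cox_cat; [exact: cox_sym | exact: cox_refl].
have notin a u : all (mem (X :\ a)) u -> a \notin u.
  by move/allP=> H; apply/negP=> /H /=; rewrite !inE eqxx.
have wz' : weight t z' v = 0.
  by rewrite -wz (weight_cox _ _ zz') weight_catl ?notin // weight_catr ?notin.
case/lastP: z' => [|z1 l] in z'X sz zz' red wz' minX *.
  by exists y1, y2.
have [lX z1X] : l \in X /\ all (mem X) z1 by move: z'X; rewrite all_rcons => /andP[].
have lt : l = t.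
  apply/eqP; apply/negPn/negP=> lt.
  have := minX z1 y1 (l :: y2); rewrite size_rcons ltnn => H; suff: false by [].
  apply: H => //=; first by rewrite !inE lt lX.
  by rewrite -cat_rcons.
subst l; set beta := play 0 z1 (sroot t).
have beta0 : nonneg beta by apply: (play_root_nonneg cg red).
have betav : beta v = 0.
  move: wz'; rewrite weight_rcons eqxx => /eqP.
  rewrite paddr_eq0 ?beta0 // => [/andP[_ /eqP] //|].
  by apply: (@weight_nonneg X); move: red; rewrite -cats1 => /reduced_catl.
have betaX r : r \notin X -> beta r = 0.
  move=> rX; rewrite /beta (play_support _ z1X rX) ffunE.
  by case: eqP rX => // ->; rewrite lX.
have rz'X : all (mem X) (rev (rcons z1 t)) by rewrite all_mem_rev.
(* A letter [r] of [X] other than [v], put in front of [z'], can be absorbed into [y1]; by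
   minimality it does not shorten [z']. *)
have pos r : r \in X -> r != v -> nonneg (play 0 (rev (rcons z1 t)) (sroot r)).
  move=> rX rv; apply: (play_root_nonneg cg (X := X)).
  rewrite -rev_cons; apply: reduced_rev; apply: reduced_of_parity; first by rewrite /= rX.
  move=> u uX uz; rewrite [size (_ :: _)]/= ltnS; apply: (minX u (rcons y1 r) y2) => //.
    by rewrite all_rcons y1X /= !inE rv rX.
  apply: cox_trans zz' _; rewrite [rcons y1 r ++ _]cat_rcons; apply: cox_cat; first exact: cox_refl.
  rewrite -cat_cons; apply: cox_cat; last exact: cox_refl.
  apply: cox_trans (cox_sym (cox_sq e m [::] r _)) _.
  by rewrite /=; apply: (cox_cat (cox_refl e m [:: r])); apply: cox_sym.
have : nonneg (play 0 (rev (rcons z1 t)) beta).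
  rewrite (sroot_expand beta) play0_sum => i; rewrite sum_ffunE sumr_ge0 // => r _.
  rewrite play0Z ffunE; have [rX|/betaX->] := boolP (r \in X); last by rewrite mul0r.
  by have [->|rv] := eqVneq r v; [rewrite betav mul0r | rewrite mulr_ge0 ?beta0 ?pos].
have -> : play 0 (rev (rcons z1 t)) beta = - sroot t.
  rewrite /beta -play_cat rev_rcons cat_cons play_cons (play_cox cg _ _ (cox_Vcat e m z1)).
  exact: refl_root.
by move/(_ t); rewrite !ffunE eqxx oppr_ge0 => /(le_lt_trans)/(_ ltr01); rewrite ltxx.
Qed.

End DoubleCosets.

Local Close Scope ring_scope.

(** * Constructing finite quotients *)

Section FinQuot.
Variables (V : finType) (e : rel V) (m : V -> V -> nat).
Implicit Types (u w z : seq V) (s t a b v : V) (X : {set V}).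
Local Notation "u ~ w" := (cox_eq e m u w) (at level 70).

Definition refines (q q' : finquot e m) := forall w, ev q w = 1 -> ev q' w = 1.

Lemma refines_eq q q' u w : refines q q' -> ev q u = ev q w -> ev q' u = ev q' w.
Proof.
move=> H E; apply/eqP; rewrite eq_sym eq_mulVg1 -ev_rev -ev_cat; apply/eqP/H.
by rewrite ev_cat ev_rev E mulVg.
Qed.

Lemma refines_trans q1 q2 q3 : refines q1 q2 -> refines q2 q3 -> refines q1 q3.
Proof. by move=> H1 H2 w /H1/H2. Qed.

Section Trivial.
Let trivT : finGroupType := {perm 'I_0}.
Lemma triv1 (x y : trivT) : x = y. Proof. by apply/permP => -[]. Qed.
Definition trivq : finquot e m :=
  @FinQuot V e m trivT (fun=> 1) (fun=> triv1 _ _) (fun _ _ _ => triv1 _ _).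
End Trivial.

Section Product.
Variables q1 q2 : finquot e m.
Definition prodg v : q1 * q2 := (fqg q1 v, fqg q2 v).
Lemma prodg_sq v : prodg v * prodg v = 1.
Proof. by congr pair; rewrite fqg_sq. Qed.
Lemma prodgX v t n : (prodg v * prodg t) ^+ n = 
  ((fqg q1 v * fqg q1 t) ^+ n, (fqg q2 v * fqg q2 t) ^+ n).
Proof. by elim: n => // n IHn; rewrite !expgS IHn. Qed.
Lemma prodg_rel v t : e v t -> (prodg v * prodg t) ^+ m v t = 1.
Proof. by move=> evt; rewrite prodgX !fqg_rel. Qed.
Definition prodq := FinQuot prodg_sq prodg_rel.
Lemma ev_prodq w : ev prodq w = (ev q1 w, ev q2 w).
Proof.
elim: w => [|s w IHw]; first by rewrite !ev_nil.
by rewrite !ev_cons IHw.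
Qed.
Lemma prodq1 : refines prodq q1.
Proof. by move=> w; rewrite ev_prodq => -[]. Qed.
Lemma prodq2 : refines prodq q2.
Proof. by move=> w; rewrite ev_prodq => -[]. Qed.
End Product.

Lemma common_refinement (I : eqType) (l : seq I) (P : I -> finquot e m -> Prop) :
  (forall i q q', refines q' q -> P i q -> P i q') ->
  (forall i, exists q, P i q) -> exists q, forall i, i \in l -> P i q.
Proof.
move=> mono ex; elim: l => [|i l [q IHl]]; first by exists trivq.
have [q' Pq'] := ex i; exists (prodq q' q) => j; rewrite inE => /predU1P[->|/IHl].
  exact: mono (@prodq1 _ _) Pq'.
exact: mono (@prodq2 _ _).
Qed.

Section OfRel.
Variable R : seq V -> seq V -> Prop.
Hypothesis R_sym : forall u w, R u w -> R w u.
Hypothesis R_trans : forall u z w, R u z -> R z w -> R u w.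
Hypothesis R_cons : forall s u w, R u w -> R (s :: u) (s :: w).
Hypothesis R_cox : forall u w, u ~ w -> R u w.
Variables (T : finType) (F : seq V -> T).
Hypothesis F_R : forall u w, F u = F w -> R u w.

Let rep (t : T) : seq V :=
  if pselect (exists w, F w = t) is left h then sval (cid h) else [::].
Let repF w : R (rep (F w)) w.
Proof. by apply: F_R; rewrite /rep; case: pselect => [h|[]]; [case: cid | exists w]. Qed.
(** A canonical index for the class of [w]: [pick] depends only on the predicate, hence only on the
    class, whereas [F] may vary within a class. *)
Let kappa w : T := odflt (F w) [pick k | `[< R (rep k) w >]].
Let kappaP w : R (rep (kappa w)) w.
Proof. by rewrite /kappa; case: pickP => [t /asboolP|_] //=; exact: repF. Qed.
Let kappa_eq u w : R u w -> kappa u = kappa w.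
Proof.
move=> Ruw; rewrite /kappa.
have E : (fun k : T => `[< R (rep k) u >]) =1 (fun k => `[< R (rep k) w >]).
  move=> k; apply/asboolP/asboolP => [H|H]; first exact: R_trans Ruw.
  by apply: R_trans H _; apply: R_sym.
rewrite (eq_pick E); case: pickP => // /(_ (F w)) /asboolP [].
exact: repF.
Qed.
(** Indices that are not canonical are left fixed, so that [step s] is an involution of all of
    [T]. *)
Let step s (t : T) : T := if kappa (rep t) == t then kappa (s :: rep t) else t.
Let step_kappa s w : step s (kappa w) = kappa (s :: w).
Proof.
rewrite /step (kappa_eq (kappaP w)) eqxx; apply: kappa_eq.
exact: R_cons (kappaP w).
Qed.
Let stepK s : involutive (step s).
Proof.
move=> t; rewrite {2}/step; case: ifP => [/eqP E|E]; last by rewrite /step E.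
rewrite step_kappa -[in RHS]E; apply: kappa_eq.
by apply: R_cox; apply: (cox_sq e m [::]).
Qed.
Let sigma s : {perm T} := perm (inv_inj (stepK s)).
(** Permutations compose from left to right, so the product along [w] acts as left multiplication by
    [rev w]. *)
Let big_kappa (w u : seq V) : (\prod_(s <- w) sigma s) (kappa u) = kappa (rev w ++ u).
Proof.
elim: w u => [|s w IHw] u; first by rewrite big_nil perm1.
by rewrite big_cons permM permE step_kappa IHw rev_cons cat_rcons.
Qed.
Let big_bad (w : seq V) (t : T) : kappa (rep t) != t -> (\prod_(s <- w) sigma s) t = t.
Proof.
move=> bad; elim: w => [|s w IHw]; first by rewrite big_nil perm1.
by rewrite big_cons permM permE /step (negPf bad) IHw.
Qed.
Let big_cox (w : seq V) : w ~ [::] -> \prod_(s <- w) sigma s = 1.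
Proof.
move=> w1; apply/permP=> t; rewrite perm1.
have [E|bad] := eqVneq (kappa (rep t)) t; last exact: big_bad.
rewrite -{1}E big_kappa -[RHS]E; apply: kappa_eq; apply: R_cox.
exact: (cox_cat (cox_rev w1) (cox_refl e m (rep t))).
Qed.
Let sigma_sq s : sigma s * sigma s = 1.
Proof.
have := big_cox (cox_sq e m [::] s [::]); by rewrite big_cons big_seq1.
Qed.
Let sigma_rel s t : e s t -> (sigma s * sigma t) ^+ m s t = 1.
Proof.
move=> est; have := @cox_edge V e m [::] s t [::] est; rewrite cats0 => /big_cox.
suff -> n : \prod_(r <- flatten (nseq n [:: s; t])) sigma r = (sigma s * sigma t) ^+ n by [].
elim: n => [|n IHn] /=; first by rewrite big_nil.
by rewrite !big_cons IHn expgS mulgA.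
Qed.

(** [R] is a left-invariant equivalence of finite index. Left multiplication permutes its classes,
    and a word that acts trivially fixes the class of the empty word. *)
Lemma finquot_of_rel : exists q : finquot e m, forall w, ev q w = 1 -> R w [::].
Proof.
exists (FinQuot sigma_sq sigma_rel) => w; rewrite /ev /= => /permP/(_ (kappa [::])).
rewrite big_kappa perm1 cats0 => E.
have H : R (rev w) [::].
  apply: R_trans (kappaP _); rewrite -E; apply/R_sym; exact: kappaP.
have R_catl z u u' : R u u' -> R (z ++ u) (z ++ u').
  by elim: z => //= s z IHz /IHz; apply: R_cons.
have := R_catl w _ _ H; rewrite cats0 => H'.
by apply: R_trans (R_sym H') _; apply: R_cox; apply: cox_catV.
Qed.

End OfRel.
End FinQuot.

(** * Congruence quotients *)

Local Open Scope ring_scope.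

Lemma minCpoly_const_neq0 (a : algC) : a != 0 -> (minCpoly a)`_0 != 0.
Proof.
move=> a0; have [p [-> pmon] dv] := minCpolyP a.
rewrite coef_map /= fmorph_eq0; apply/eqP => p0.
have [r Dr] : exists r, p = r * 'X.
  have : root p 0 by rewrite /root horner_coef0 p0.
  by case/factor_theorem=> r; rewrite subr0; exists r.
have pn0 := monic_neq0 pmon.
have : root (map_poly ratr p) a by rewrite dv dvdpp.
rewrite {1}Dr rmorphM /= map_polyX rootM rootX (negPf a0) orbF dv => /dvdp_leq.
have r0 : r != 0 by apply: contraNneq pn0 => r0; rewrite Dr r0 mul0r.
by move/(_ r0); rewrite {1}Dr size_mulX // ltnn.
Qed.

(** A nonzero algebraic integer [a] divides the constant coefficient [c] of its minimal polynomial,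
    a nonzero integer. If [k] exceeds the absolute value of [c], it does not divide [c], hence not
    [a]. *)
Lemma Aint_not_dvdn (a : algC) : a \in Aint -> a != 0 ->
  exists k : nat, (0 < k)%N && ~~ (k%:R %| a)%A.
Proof.
move=> aA a0; have c0 := minCpoly_const_neq0 a0.
have pint : minCpoly a \is a polyOver Num.int by [].
set p := minCpoly a in c0 pint; set c := p`_0 in c0.
have cint : c \in Num.int by apply: (polyOverP pint).
have [b bA Eb] : exists2 b, b \in Aint & c = a * b.
  exists (- (\poly_(i < (size p).-1) p`_i.+1).[a]).
    rewrite rpredN; apply: rpred_horner => //.
    apply/polyOverP => i; rewrite coef_poly; case: ifP => _; last by rewrite Aint0.
    by apply/Aint_Cint/(polyOverP pint).
  have pa : p.[a] = 0 by apply/eqP; apply: root_minCpoly.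
  have Ep : p = (\poly_(i < (size p).-1) p`_i.+1) * 'X + c%:P.
    apply/polyP=> -[|i]; rewrite coefD coefMX coefC /= ?add0r // addr0 coef_poly.
    case: ltnP => // le; apply/esym; rewrite nth_default //; lia.
  move: pa; rewrite {1}Ep hornerMXaddC => /eqP; rewrite addrC addr_eq0 => /eqP->.
  by rewrite mulrN mulrC.
pose k := (Num.truncn `|c|).+1.
exists k; rewrite /= /dvdA unfold_in pnatr_eq0 /=; apply/negP => akA.
have : c / k%:R \in Aint by rewrite Eb mulrAC rpredM.
move/Cint_rat_Aint => H.
have ck : c / k%:R \in Num.int.
  by apply: H; have /intrP[z ->] := cint; rewrite rpred_div ?rpred_int ?rpred_nat.
have := norm_intr_ge1 ck; rewrite mulf_neq0 ?invr_eq0 ?pnatr_eq0 // => /(_ isT).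
rewrite normrM normfV [`|k%:R|]ger0_norm ?ler0n // ler_pdivlMr ?ltr0n // mul1r.
by rewrite real_leNgt ?normr_real ?realn // real_truncnS_gt // normr_real.
Qed.

Lemma dvdA_mull (k c x : algC) : c \in Aint -> (k %| x)%A -> (k %| c * x)%A.
Proof.
move=> cA; rewrite /dvdA !unfold_in; case: eqP => _; first by move/eqP->; rewrite mulr0.
by move=> xA; rewrite -mulrA; exact: (rpredM cA xA).
Qed.

Section Congruence.
Variables (V : finType) (e : rel V) (m : V -> V -> nat).
Hypothesis cg : coxeter_graph e m.
Implicit Types (u w z : seq V) (s t v : V) (X : {set V}).
Local Notation "u ~ w" := (cox_eq e m u w) (at level 70).
Local Notation vec := {ffun V -> algC}.
Local Notation play := (@play V e m).
Implicit Types (x y : vec).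

Lemma two_cos_Aint s t : two_cos e m s t \in Aint.
Proof.
rewrite /two_cos; case: ifP => [est|_]; last by rewrite -[2]/(2%:~R) Aint_int.
case: cg => _ _ _ /(_ _ _ est) m2; have [zN z0 _ _] := zetaP m2.
have N0 : (0 < (m s t).*2)%N by rewrite double_gt0 ltnW.
rewrite rpredD //; apply: (Aint_unity_root N0); apply/unity_rootP => //.
by rewrite exprVn zN invr1.
Qed.

(* The starting positions of the numbers game that have to be tracked:
   simple roots [(0, alpha_s)] and fundamental weights [(y, 0)], [y = alpha_s]. *)
Definition start (b : bool) s : vec * vec := if b then (sroot s, 0) else (0, sroot s).

Definition play_start w b s : vec := play (start b s).1 w (start b s).2.

Lemma play_start_Aint u b s v : play_start u b s v \in Aint.
Proof.
rewrite /play_start; elim: u v => [|r u IHu] v.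
  by rewrite /=; case: b; rewrite /= ?ffunE //; case: eqP.
rewrite play_cons; have [->|vr] := eqVneq v r; last by rewrite refl_other.
rewrite refl_self rpredB //; last by case: b {IHu}; rewrite /= ffunE //; case: eqP.
by rewrite rpredD ?rpredN // rpred_sum // => t _; rewrite rpredM // two_cos_Aint.
Qed.

Definition cong k u w := forall b s v,
  (k%:R %| play_start u b s v - play_start w b s v)%A.

Lemma cong_cons k r u w : cong k u w -> cong k (r :: u) (r :: w).
Proof.
move=> H b s v; rewrite /play_start !play_cons.
have [->|vr] := eqVneq v r; last by rewrite !refl_other //; apply: H.
rewrite !refl_self.
set A := play_start u b s; set B := play_start w b s.
rewrite -[play _ u _]/A -[play _ w _]/B; set y := (start b s).1.
have -> : forall a1 a2 b1 b2 c : algC, - a1 + a2 - c - (- b1 + b2 - c) = (a2 - b2) - (a1 - b1).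
  by move=> *; ring.
rewrite rpredB ?H // -sumrB; apply: rpred_sum => t _; rewrite -mulrBr.
by have := H b s t; apply: dvdA_mull; apply: two_cos_Aint.
Qed.

(** All coefficients lie in a ring [S] that contains the numbers [two_cos s t] and is finitely
    generated as an abelian group; reducing integer coordinates modulo [k] leaves finitely many
    congruence classes. *)
Lemma exists_cong_quot k : (0 < k)%N ->
  exists q : finquot e m, forall w, ev q w = 1%g -> cong k w [::].
Proof.
move=> k0.
pose L := [seq two_cos e m p.1 p.2 | p : V * V].
have LA : {subset L <= Aint} by move=> _ /mapP[p _ ->]; apply: two_cos_Aint.
have [S [Sring LS] [[n Y] /= YS Yspan]] := Aint_subring_exists LA.
have [S1 SB SM] := Sring.
have S0 : 0 \in S by rewrite -(subrr 1) SB.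
have SN a : a \in S -> - a \in S by move=> aS; rewrite -sub0r SB.
have SD a b : a \in S -> b \in S -> a + b \in S by move=> aS /SN bS; rewrite -[b]opprK SB.
have Ssum (P : pred V) f : (forall i, P i -> f i \in S) -> \sum_(i | P i) f i \in S.
  by move=> fS; apply: (big_ind (fun a => a \in S)).
have Sroot s v : sroot s v \in S by rewrite ffunE; case: eqP.
have playS w b s v : play_start w b s v \in S.
  rewrite /play_start; elim: w v => [|r w IHw] v.
    by rewrite /=; case: b; rewrite /= ?ffunE //; case: eqP.
  rewrite play_cons; have [->|vr] := eqVneq v r; last by rewrite refl_other.
  rewrite refl_self; apply: (SB); last by case: b {IHw}; rewrite /= ffunE //; case: eqP.
  apply: SD; first exact/SN/IHw.
  apply: Ssum => t _; apply: SM; last exact: IHw.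
  by apply/LS/mapP; exists (r, t) => //; rewrite mem_enum.
have SA : {subset S <= Aint} := fin_Csubring_Aint Sring Yspan.
have coefS a : a \in S -> {c : int ^ n | a = \sum_(i < n) Y`_i *~ c i}.
  by move/Yspan => H; apply: cid; case: H => c ->; exists c.
have k0' : (0 < k)%N := k0.
pose res (z : int) : 'I_k := Ordinal (ltn_pmod `|(z %% k)%Z| k0').
have resP (z z' : int) : res z = res z' -> (k %| z - z')%Z.
  move/(congr1 val) => /=; rewrite !modn_small; last 2 first.
  - by rewrite -ltz_nat gez0_abs ?modz_ge0 ?ltz_pmod // -?lt0n; lia.
  - by rewrite -ltz_nat gez0_abs ?modz_ge0 ?ltz_pmod // -?lt0n; lia.
  move=> E; have E' : (z %% k)%Z = (z' %% k)%Z.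
    by rewrite -[LHS]gez0_abs ?modz_ge0 ?E ?gez0_abs ?modz_ge0 //; lia.
  by rewrite -eqz_mod_dvd; apply/eqP.
pose F w : {ffun bool * V * V -> {ffun 'I_n -> 'I_k}} :=
  [ffun p => [ffun i => res (sval (coefS _ (playS w p.1.1 p.1.2 p.2)) i)]].
apply: (@finquot_of_rel V e m (cong k) _ _ _ _ _ F).
- by move=> u w H b s v; rewrite -opprB rpredN.
- move=> u1 u2 u3 H1 H2 b s v.
  by rewrite -[X in X - _](subrK (play_start u2 b s v)) -addrA rpredD // ?H1 ?H2.
- exact: cong_cons.
- by move=> u w uw b s v; rewrite /play_start (play_cox cg _ _ uw) subrr rpred0.
move=> u w /ffunP E b s v; have := E (b, s, v); rewrite !ffunE /=.
case: (coefS _ _) => c Dc; case: (coefS _ _) => c' Dc' /= /ffunP Ec.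
rewrite Dc Dc' -sumrB rpred_sum // => i _; rewrite -mulrzBr -mulrzr.
have /resP/dvdzP[d ->] : res (c i) = res (c' i) by have := Ec i; rewrite !ffunE.
rewrite intrM mulrA; apply: dvdA_mull.
  apply: (rpredM _ (Aint_int _)).
  by apply: SA; apply: YS; apply: mem_nth; rewrite size_tuple.
have kn0 : (k%:R : algC) != 0 by rewrite pnatr_eq0 -lt0n.
by rewrite -pmulrn /dvdA unfold_in (negPf kn0) mulfV.
Qed.

Theorem residually_finite w : ~ (w ~ [::]) -> exists q : finquot e m, ev q w <> 1%g.
Proof.
move=> w1; have [s Ns] : exists s, play 0 w (sroot s) <> sroot s.
  by apply/existsNP => H; apply: w1; apply: play_faithful.
have [v Nv] : exists v, play_start w false s v - play_start [::] false s v <> 0.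
  apply/existsNP => H; apply: Ns; apply/ffunP=> v; apply/eqP; rewrite -subr_eq0; apply/eqP.
  exact: H.
have [|k /andP[k0 ndvd]] :=
  Aint_not_dvdn (rpredB (play_start_Aint w false s v) (play_start_Aint [::] false s v)).
  exact/eqP.
have [q Hq] := exists_cong_quot k0.
by exists q => /Hq /(_ false s v); apply/negP.
Qed.

(** [weight t z v] is nonzero, hence nonzero modulo some [k], while the weight of [y1 ++ y2]
    vanishes. The words [y1] and [y2] range over all of [V], because the links to which this is
    applied may leave [X]. *)
Theorem double_coset_separated X v t z : all (mem X) z ->
  ~ (exists y1 y2 : seq V, [/\ all (mem (X :\ v)) y1, all (mem (X :\ t)) y2 & z ~ y1 ++ y2]) ->
  exists q : finquot e m, forall y1 y2 : seq V, v \notin y1 -> t \notin y2 ->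
    ev q z <> ev q (y1 ++ y2).
Proof.
move=> zX no; have wz : weight e m t z v != 0.
  by apply/eqP=> w0; apply: no; apply: weight0_double_coset w0.
have [|k /andP[k0 ndvd]] := Aint_not_dvdn _ wz.
  by rewrite /weight rpredN; apply: (play_start_Aint z true).
have [q Hq] := exists_cong_quot k0.
exists q => y1 y2 vy1 ty2 E.
have /Hq C : ev q (rev (y1 ++ y2) ++ z) = 1%g by rewrite ev_cat ev_rev E mulVg.
have cong_catl (x : seq V) u u' : cong k u u' -> cong k (x ++ u) (x ++ u').
  by elim: x => //= l x IHx /IHx; apply: cong_cons.
have W0 : play (sroot t) (y1 ++ y2) 0 v = 0.
  apply: oppr_inj; rewrite -/(weight e m t (y1 ++ y2) v) weight_catl //.
  by rewrite -[y2]cat0s weight_catr // /weight /= ffunE.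
have := cong_catl (y1 ++ y2) _ _ C true t v.
rewrite cats0 /play_start (play_cox cg _ _ (cox_catVw e m _ _)) /= W0 subr0.
by move: ndvd; rewrite /weight rpredN => /negP.
Qed.

End Congruence.

Local Close Scope ring_scope.

(** * Intersections of special subgroups in finite quotients *)

Section Special.
Variables (V : finType) (e : rel V) (m : V -> V -> nat).
Hypothesis cg : coxeter_graph e m.
Implicit Types (u w y z : seq V) (s t a v : V) (X Y : {set V}).
Local Notation "u ~ w" := (cox_eq e m u w) (at level 70).

Definition splits X v t z :=
  exists y1 y2, [/\ all (mem (X :\ v)) y1, all (mem (X :\ t)) y2 & z ~ y1 ++ y2].

(** Excludes the bad configurations of hyperplanes in the quotient complex: self-osculation by the
    case [v = t], inter-osculation by the case of adjacent [v] and [t]. *)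
Definition special (q : finquot e m) := forall X v t z y1 y2,
  is_clique e X -> all (mem X) z -> v \notin y1 -> t \notin y2 ->
  ev q z = ev q (y1 ++ y2) -> splits X v t z.

Lemma splits_cox X v t z z' : z ~ z' -> splits X v t z -> splits X v t z'.
Proof.
move=> zz' [y1 [y2 [y1X y2X zy]]]; exists y1, y2; split=> //.
by apply: cox_trans zy; apply: cox_sym.
Qed.

Lemma FC_covers : FC_type e m -> exists L : {set V} -> seq (seq V),
  forall X, is_clique e X -> forall w, all (mem X) w -> exists2 u, u \in L X & w ~ u.
Proof.
move=> fc.
suff /choice[L HL] : forall X, exists l : seq (seq V), is_clique e X ->
  forall w, all (mem X) w -> exists2 u, u \in l & w ~ u by exists L.
move=> X; have [/fc[l Hl]|nc] := pselect (is_clique e X); last by exists [::].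
by exists l.
Qed.

(** FC type leaves finitely many elements in the clique subgroups, so finitely many double coset
    separations suffice, and they have a common refinement. *)
Lemma exists_special : FC_type e m -> exists q, special q.
Proof.
move=> fc.
have [L LP] := FC_covers fc.
pose P (i : {set V} * V * V * seq V) (q : finquot e m) := forall z y1 y2, let: (X, v, t, u) := i in
  all (mem X) z -> z ~ u -> v \notin y1 -> t \notin y2 ->
  ev q z = ev q (y1 ++ y2) -> splits X v t z.
have mono i q q' : refines q' q -> P i q -> P i q'.
  move: i => [[[X v] t] u] rq Pq z y1 y2 zX zu vy1 ty2 E.
  exact: Pq (refines_eq rq E).
have ex i : exists q, P i q.
  move: i => [[[X v] t] u].
  have [[z0 z0X z0u]|no] := pselect (exists2 z, all (mem X) z & z ~ u); last first.
    by exists (trivq e m) => z y1 y2 zX zu; case: no; exists z.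
  have zz z : z ~ u -> z0 ~ z by move=> zu; apply: cox_trans z0u _; apply: cox_sym.
  have [spl|/(double_coset_separated cg z0X)[q Hq]] := pselect (splits X v t z0).
    by exists (trivq e m) => z y1 y2 zX /zz z0z _ _ _; apply: splits_cox spl.
  exists q => z y1 y2 zX /zz z0z vy1 ty2 E; exfalso.
  by apply: (Hq y1 y2 vy1 ty2); rewrite (ev_cox q z0z).
pose l := flatten [seq [seq (p, u) | u <- L p.1.1] | p <- enum [set: {set V} * V * V]].
have [q Hq] := @common_refinement V e m _ l P mono ex.
exists q => X v t z y1 y2 cX zX vy1 ty2 E; have [u uL zu] := LP X cX z zX.
suff : (X, v, t, u) \in l by move/Hq => /(_ z y1 y2 zX zu vy1 ty2 E).
apply/flattenP; exists [seq ((X, v, t), u) | u <- L X].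
  by apply/mapP; exists (X, v, t); rewrite // mem_enum inE.
by apply/mapP; exists u.
Qed.

(** * The canonical completion: toggles across hyperplanes *)

Section Toggle.
Variables (Q G : finquot e m) (Y : {set V}).
Hypothesis spQ : special Q.
(** The factor [Q] carries the colours of hyperplanes; the factor [G] is the quotient in which the
    conclusion is stated. *)
Let D := prodq Q G.
Let link v : {set V} := [set u | e v u].
(** The chambers of parallel edges of type [v] differ by elements of the link subgroup, so this
    coset labels a hyperplane of the quotient complex. *)
Let colour v (q : Q) : {set Q} := q *: par Q (link v).
Implicit Types (x h : D) (c : {set Q}) (Z : {set V} * {set D}).

Let clique X := [forall v in X, X :\ v \subset link v].
Let vertex X x : {set V} * {set D} := (X, x *: par D X).
Let flip v X := if v \in X then X :\ v else v |: X.

(* [(X, x W_X)] is a vertex of the cube complex, and [toggle v c] crosses its edge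
   of type [v] and colour [c] if there is one; [x] is a chamber in the star of
   both ends of this edge. *)
Let movable v c Z x :=
  [&& clique Z.1, Z.1 \subset Y, x \in par D Y & Z == vertex Z.1 x] &&
  [&& colour v x.1 == c, v \in Y & Z.1 :\ v \subset link v].

Let toggle v c Z :=
  if [pick x | movable v c Z x] is Some x then vertex (flip v Z.1) x else Z.

Let D1 w : (ev D w).1 = ev Q w.
Proof. by rewrite /D ev_prodq. Qed.

Let D1M (x h : D) : (x * h).1 = x.1 * h.1. Proof. by []. Qed.
Let D1V (x : D) : (x^-1).1 = x.1^-1. Proof. by []. Qed.

Let vertex_eq X x h : h \in par D X -> vertex X (x * h) = vertex X x.
Proof. by move=> hX; rewrite /vertex lcosetM lcoset_id. Qed.

Let vertex_mem X x x' : vertex X x = vertex X x' -> x^-1 * x' \in par D X.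
Proof. by case=> E; rewrite -mem_lcoset E lcoset_refl. Qed.

Let colour_par X v x h : X \subset link v -> h \in par D X ->
  colour v (x * h).1 = colour v x.1.
Proof.
move=> Xv /parP[w wX ->]; rewrite /colour D1M D1.
rewrite lcosetM lcoset_id //; apply: ev_par; exact: sub_word wX.
Qed.

Let clique_is X : clique X -> is_clique e X.
Proof.
move=> /forall_inP cX v t vX tX vt; have /subsetP/(_ t) := cX v vX.
by rewrite !inE tX eq_sym vt => /(_ isT).
Qed.

(* The property [special] makes two hyperplanes that cross somewhere in the
   quotient cross at every common vertex. *)
Let cross X v t x x' q : clique X -> x^-1 * x' \in par D X ->
  colour v x.1 = colour v q -> colour t x'.1 = colour t q ->
  exists h1 h2, [/\ h1 \in par D (X :\ v), h2 \in par D (X :\ t) & x^-1 * x' = h1 * h2].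
Proof.
move=> cX /parP[z zX Ez] Ev Et.
have notin_link a : a \notin link a by rewrite inE; case: cg => _ ->.
have word a (b : Q) : b \in colour a q -> exists2 y, a \notin y & b = q * ev Q y.
  rewrite mem_lcoset => /parP[y yl Ey]; exists y; last by rewrite -Ey mulKVg.
  by apply/negP => /(allP yl) /=; apply/negP.
have x1q : x.1 \in colour v q by rewrite -Ev; apply: lcoset_refl.
have x2q : x'.1 \in colour t q by rewrite -Et; apply: lcoset_refl.
have [[y1 vy1 E1] [y2 ty2 E2]] := (word _ _ x1q, word _ _ x2q).
have [|||y1' [y2' [y1X y2X zy]]] := @spQ X v t z (rev y1) y2 (clique_is cX) zX.
- by rewrite mem_rev.
- by [].
- rewrite -D1 -Ez D1M D1V E1 E2 ev_cat ev_rev.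
  by rewrite invMg -mulgA mulKg.
exists (ev D y1'), (ev D y2'); rewrite !ev_par //; split=> //.
by rewrite Ez (ev_cox D zy) ev_cat.
Qed.

Let in_flip v X r : (r \in flip v X) = (r == v) (+) (r \in X).
Proof.
rewrite /flip; case: ifP => vX; rewrite !inE; last by case: eqP => // ->; rewrite vX.
by case: eqP => [->|]; rewrite ?vX.
Qed.

Let flipK v : involutive (flip v).
Proof. by move=> X; apply/setP => r; rewrite !in_flip addKb. Qed.

Let flipD1 v X : flip v X :\ v = X :\ v.
Proof.
rewrite /flip; case: ifP => vX; apply/setP => u; rewrite !inE; case: eqP => //.
Qed.

Let flip_clique v X : clique X -> X :\ v \subset link v -> clique (flip v X).
Proof.
move=> /forall_inP cX Xv; apply/forall_inP => u; rewrite /flip; case: ifP => vX.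
  rewrite inE => /andP[uv uX]; apply: subset_trans (cX u uX).
  by apply: setSD; apply: subD1set.
have eC : forall a b, e a b = e b a by case: cg.
rewrite in_setU1 => /predU1P[->|uX].
  by apply: subset_trans Xv; apply/subsetP=> r; rewrite !inE; case: eqP.
have uv : u != v by apply: contraFneq vX => <-.
apply/subsetP => r; rewrite !inE => /andP[ru /predU1P[->|rX]].
  by rewrite eC; have /subsetP/(_ u) := Xv; rewrite !inE uX uv => /(_ isT).
by have /subsetP/(_ r) := cX u uX; rewrite !inE ru rX => /(_ isT).
Qed.

(** No self-osculation: two chambers at [Z] with the same [v]-colour differ by an element of
    [par D (Z.1 :\ v)], so the edge crossed does not depend on the chamber that [pick] returns. *)
Let toggleE v c Z x : movable v c Z x -> toggle v c Z = vertex (flip v Z.1) x.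
Proof.
move=> mx; rewrite /toggle; case: pickP => [x' mx'|/(_ x)]; last by rewrite mx.
case/andP: mx => /and4P[cZ ZY xY /eqP Zx] /and3P[/eqP colx vY Zv].
case/andP: mx' => /and4P[_ _ x'Y /eqP Zx'] /and3P[/eqP colx' _ _].
have xx' : x^-1 * x' \in par D Z.1 by apply: vertex_mem; rewrite -Zx -Zx'.
suff H : x^-1 * x' \in par D (flip v Z.1) by rewrite -(vertex_eq x H) mulKVg.
rewrite /flip; case: ifP => vZ; last by apply: (subsetP (par_sub D _)) xx'; apply: subsetUr.
have [h1 [h2 [h1X h2X ->]]] := cross cZ xx' (erefl (colour v x.1)) (etrans colx' (esym colx)).
by rewrite groupM.
Qed.

Let movable_toggle v t c c' Z x : movable v c Z x -> movable t c' Z x -> 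
  (v == t) || e v t -> movable t c' (toggle v c Z) x.
Proof.
move=> mv mt vt; rewrite (toggleE mv).
case/andP: mv => /and4P[cZ ZY xY /eqP Zx] /and3P[/eqP colx vY Zv].
case/andP: mt => _ /and3P[/eqP colt tY Zt].
have fY : flip v Z.1 \subset Y.
  rewrite /flip; case: ifP => _; first by apply: subset_trans ZY; apply: subD1set.
  by rewrite subUset sub1set vY.
rewrite /movable /= flip_clique // fY xY eqxx colt eqxx tY /=.
case/predU1P: vt => [<-|evt]; first by rewrite flipD1.
apply: (@subset_trans _ _ (v |: Z.1 :\ t)); last first.
  by rewrite subUset Zt sub1set inE; case: cg => <-; rewrite evt.
rewrite /flip; case: ifP => _; apply/subsetP => r; rewrite !inE.
  by move=> /and3P[-> _ ->]; rewrite orbT.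
by move=> /andP[-> /predU1P[->|->]]; rewrite ?eqxx // orbT.
Qed.

Let toggleK v c : involutive (toggle v c).
Proof.
move=> Z; have [[x mx]|no] := pselect (exists x, movable v c Z x); last first.
  have E : toggle v c Z = Z by rewrite /toggle; case: pickP => // x mx; case: no; exists x.
  by rewrite !E.
have mx' := movable_toggle mx mx; rewrite eqxx in mx'.
rewrite (toggleE (mx' isT)) (toggleE mx) /= flipK.
by case/andP: mx => /and4P[_ _ _ /eqP].
Qed.

(** No inter-osculation: edges at [Z] of adjacent types, with colours taken at one [q], span a
    square. The factorisation from [cross] provides its chamber [x * h1]. *)
Let common Z s t q x x' : e s t -> 
  movable s (colour s q) Z x -> movable t (colour t q) Z x' ->
  exists x'', movable s (colour s q) Z x'' && movable t (colour t q) Z x''.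
Proof.
move=> est /andP[/and4P[cZ ZY xY /eqP Zx] /and3P[/eqP colx sY Zs]].
move=> /andP[/and4P[_ _ x'Y /eqP Zx'] /and3P[/eqP colx' tY Zt]].
have xx' : x^-1 * x' \in par D Z.1 by apply: vertex_mem; rewrite -Zx -Zx'.
have [h1 [h2 [h1X h2X E]]] := cross cZ xx' colx colx'.
have h1Z : h1 \in par D Z.1 by apply: (subsetP (par_sub D _)) h1X; apply: subD1set.
have Ex' : x * h1 = x' * h2^-1 by rewrite -[x'](mulKVg x) E !mulgA mulgK.
exists (x * h1); rewrite /movable cZ ZY sY tY Zs Zt (colour_par _ Zs h1X) colx eqxx.
rewrite groupM //; last by apply: (subsetP (par_sub D ZY)).
rewrite vertex_eq // -Zx eqxx Ex' (colour_par _ Zt) ?groupV // colx' eqxx.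
by [].
Qed.

Let toggleC s t q : e s t -> forall Z,
  toggle s (colour s q) (toggle t (colour t q) Z) =
  toggle t (colour t q) (toggle s (colour s q) Z).
Proof.
move=> est.
have ets : e t s by case: cg => ->.
have stay v c Z : ~ (exists x, movable v c Z x) -> toggle v c Z = Z.
  by move=> no; rewrite /toggle; case: pickP => // x mx; case: no; exists x.
have keep a b Z : e a b -> (exists x, movable a (colour a q) Z x) ->
    (exists x, movable b (colour b q) Z x) ->
    exists x, movable b (colour b q) (toggle a (colour a q) Z) x.
  move=> eab [x mx] [x' mx']; have [x'' /andP[m1 m2]] := common eab mx mx'.
  by exists x''; apply: movable_toggle => //; rewrite eab orbT.
have self a Z : (exists x, movable a (colour a q) Z x) ->
    exists x, movable a (colour a q) (toggle a (colour a q) Z) x.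
  by move=> [x mx]; exists x; apply: movable_toggle => //; rewrite eqxx.
(* If crossing [a] made a [b]-edge available, then, by [keep], crossing back would make it available
   at [Z]. *)
have oneside a b Z : e a b -> (exists x, movable a (colour a q) Z x) ->
    ~ (exists x, movable b (colour b q) Z x) ->
    ~ (exists x, movable b (colour b q) (toggle a (colour a q) Z) x).
  move=> eab ma nb mb; apply: nb; rewrite -[Z](toggleK a (colour a q)).
  by apply: keep => //; apply: self.
move=> Z; have [ms|ns] := pselect (exists x, movable s (colour s q) Z x); last first.
  rewrite [toggle s _ Z]stay //.
  have [mt|nt] := pselect (exists x, movable t (colour t q) Z x); last by rewrite !stay.
  by rewrite stay //; apply: oneside.
have [mt|nt] := pselect (exists x, movable t (colour t q) Z x); last first.
  by rewrite [toggle t _ Z]stay // [RHS]stay //; apply: oneside.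
have [[x mx] [x' mx']] := (ms, mt); have [x'' /andP[m1 m2]] := common est mx mx'.
have m3 := movable_toggle m1 m2; rewrite est orbT in m3.
have m4 := movable_toggle m2 m1; rewrite ets orbT in m4.
rewrite (toggleE (m3 isT)) (toggleE (m4 isT)) (toggleE m1) (toggleE m2) /=.
by congr vertex; apply/setP => r; rewrite !in_flip addbCA.
Qed.

Let T : finType := (Q * ({set V} * {set D}))%type.
(** From the chamber [q] to [q s] the path in the cube complex passes through the vertex of type
    [[set s]] and crosses two edges, of colours [colour s q] and [colour s (q s)]; hence two
    toggles. *)
Let step s (p : T) : T := let q := p.1 * fqg Q s in
  (q, toggle s (colour s q) (toggle s (colour s p.1) p.2)).

Let stepK s : involutive (step s).
Proof. by move=> [q Z]; rewrite /step /= -!mulgA fqg_sq mulg1 !toggleK. Qed.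

Let sigma s : {perm T} := perm (inv_inj (stepK s)).

Let sigma_sq s : sigma s * sigma s = 1.
Proof. by apply/permP => p; rewrite permM !permE stepK. Qed.

Let sigma_rel s t : e s t -> (sigma s * sigma t) ^+ m s t = 1.
Proof.
move=> est; have ets : e t s by case: cg => ->.
have colourM a b q : e a b -> colour a (q * fqg Q b) = colour a q.
  move=> eab; rewrite /colour lcosetM lcoset_id //.
  by apply: mem_gen; apply/imsetP; exists b; rewrite ?inE.
(* Each of [s], [t] lies in the link of the other, so along the relator toggles repeat their colours
   and cancel, up to commutation, except at the two ends. Those cancel once [q] has returned. *)
have inv n q Z : ((sigma s * sigma t) ^+ n) (q, Z) =
    let q' := q * (fqg Q s * fqg Q t) ^+ n in
    (q', toggle s (colour s q') (toggle t (colour t q')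
           (toggle t (colour t q) (toggle s (colour s q) Z)))).
  elim: n => [|n IHn]; first by rewrite perm1 /= mulg1 !toggleK.
  rewrite expgSr permM IHn permM !permE /step /= !toggleK.
  rewrite [in RHS]expgSr !mulgA; set q' := q * _ ^+ n.
  rewrite -(colourM t s q') // -(toggleC _ est) toggleK.
  rewrite -(colourM s t (q' * fqg Q s)) // (toggleC _ est).
  by [].
by apply/permP => -[q Z]; rewrite inv perm1 /= fqg_rel // mulg1 !toggleK.
Qed.

Let B := FinQuot sigma_sq sigma_rel.
Let base : T := (1, vertex set0 1).

(** For letters of [Y] no toggle is blocked: the position goes from [(set0, x)] through type
    [[set s]] to [(set0, x s)], following the chamber. *)
Let ev_base y : all (mem Y) y -> (ev B y : {perm T}) base = (ev Q y, vertex set0 (ev D y)).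
Proof.
elim/last_ind: y => [|y s IHy]; first by rewrite ev_nil perm1 !ev_nil.
rewrite all_rcons => /andP[sY yY]; rewrite -!cats1 !ev_cat !ev1 permM IHy // permE.
rewrite /step /=; congr pair; have yD : ev D y \in par D Y by apply: ev_par.
have sD : fqg D s \in par D Y by apply: mem_gen; apply/imsetP; exists s.
have cl0 : clique set0 by apply/forall_inP => v; rewrite inE.
rewrite (@toggleE s (colour s (ev Q y)) (vertex set0 (ev D y)) (ev D y)); last first.
  apply/andP; split; first by apply/and4P; split; [exact: cl0|exact: sub0set|exact: yD|exact: eqxx].
  by apply/and3P; split; rewrite ?D1 ?eqxx // set0D sub0set.
have fl : flip s set0 = [set s] by rewrite /flip inE setU0.
rewrite [(vertex set0 _).1](erefl : _ = set0) fl.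
have Es : vertex [set s] (ev D y) = vertex [set s] (ev D y * fqg D s).
  by rewrite vertex_eq //; apply: mem_gen; apply/imsetP; exists s; rewrite ?inE.
rewrite Es (@toggleE s _ _ (ev D y * fqg D s)); first by rewrite -fl /= flipK.
apply/andP; split; last first.
  by apply/and3P; split; rewrite ?D1M ?D1 ?eqxx //= setDv sub0set.
apply/and4P; split; [|by rewrite sub1set|by rewrite groupM|exact: eqxx].
by apply/forall_inP => v; rewrite inE => /eqP->; rewrite setDv sub0set.
Qed.

Let toggle_stab a s c X x : a != s -> X \subset Y :\ a -> x \in par D (Y :\ a) ->
  exists X' x', [/\ X' \subset Y :\ a, x' \in par D (Y :\ a) &
    toggle s c (vertex X x) = vertex X' x'].
Proof.
move=> as_ XY xY; rewrite /toggle; case: pickP => [x'|_]; last by exists X, x.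
case/andP=> /and4P[_ _ _ /eqP /= E] /and3P[_ sY _]; exists (flip s X), x'; split=> //.
  rewrite /flip; case: ifP => _; first by apply: subset_trans XY; apply: subD1set.
  by rewrite subUset XY sub1set !inE eq_sym as_ sY.
rewrite -[x'](mulKVg x) groupM // (subsetP (par_sub D XY)) //; exact: vertex_mem.
Qed.

(** Without the letter [a] only edges of other types are crossed, so the position stays in the part
    spanned by [Y :\ a], even if [w] leaves [Y]. Compared with [ev_base], this gives the
    intersection property. *)
Let ev_base_stab a w : a \notin w -> exists X x,
  [/\ X \subset Y :\ a, x \in par D (Y :\ a) & ((ev B w : {perm T}) base).2 = vertex X x].
Proof.
elim/last_ind: w => [|w s IHw].
  by exists set0, 1; rewrite sub0set group1 ev_nil perm1.
rewrite mem_rcons inE negb_or => /andP[as_ /IHw[X [x [XY xY E]]]].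
rewrite -cats1 ev_cat ev1 permM permE /step /= E.
have [X1 [x1 [X1Y x1Y ->]]] := toggle_stab (colour s ((ev B w : {perm T}) base).1) as_ XY xY.
exact: toggle_stab.
Qed.

Lemma toggle_quot : exists q : finquot e m, forall a y w, all (mem Y) y -> a \notin w ->
  ev q y = ev q w -> exists2 y', all (mem (Y :\ a)) y' & ev G y = ev G y'.
Proof.
exists B => a y w yY aw E; have [X [x [XY xY]]] := ev_base_stab aw.
rewrite -E ev_base //= => -[<-] Ex.
have : ev D y \in x *: par D set0 by rewrite -Ex lcoset_refl.
rewrite mem_lcoset => H.
have /parP[y' y'Y Ey'] : ev D y \in par D (Y :\ a).
  by rewrite -[ev D y](mulKVg x) groupM // (subsetP (par_sub D (sub0set _))).
exists y' => //; by move: Ey'; rewrite !ev_prodq => -[].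
Qed.

End Toggle.

Theorem parabolic_intersection : FC_type e m -> forall (G : finquot e m) Y,
  exists q : finquot e m, forall a y w, all (mem Y) y -> a \notin w ->
  ev q y = ev q w -> exists2 y', all (mem (Y :\ a)) y' & ev G y = ev G y'.
Proof. by move=> /exists_special[Q spQ] G Y; apply: toggle_quot spQ. Qed.

End Special.

(** * Chains on finite graphs *)

Local Open Scope ring_scope.

Lemma inj_iter (T : Type) (f : T -> T) n : injective f -> injective (iter n f).
Proof. by move=> fI; elim: n => //= n IHn x y /fI/IHn. Qed.

(** * Orbits of prime length *)

Section OrbitCounter.
Variables (E : finType) (f : E -> E) (p : nat).
Hypotheses (f_inj : injective f) (p_pr : prime p).

Lemma order_prime x : iter p f x = x -> f x <> x -> fingraph.order f x = p.
Proof.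
move=> fp fx.
have dv : (fingraph.order f x %| p)%N.
  rewrite /dvdn; apply/eqP.
  have o0 := fingraph.order_gt0 f x.
  have it q : iter (q * fingraph.order f x) f x = x.
    by elim: q => // q IHq; rewrite mulSn iterD IHq iter_order.
  have E1 : iter (p %% fingraph.order f x) f x = x.
    by rewrite -[RHS]fp {2}(divn_eq p (fingraph.order f x)) addnC iterD it.
  by rewrite -(findex_iter (ltn_pmod p o0)) E1 findex0.
have /primeP[_ /(_ _ dv)/pred2P[o1|//]] := p_pr.
by case: fx; rewrite -[RHS](iter_order f_inj) o1.
Qed.

(** A discrete logarithm along the orbit: on orbits of length [p], [f] adds 1 to it. *)
Definition orbit_count x : 'F_p := (findex f (froot f x) x)%:R.

Lemma orbit_countS x : iter p f x = x -> f x <> x ->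
  orbit_count (f x) = orbit_count x + 1.
Proof.
move=> fp fx; rewrite /orbit_count.
have cs := fconnect_sym f_inj.
set r := froot f x.
have xr : fconnect f r x by rewrite cs connect_root.
have -> : froot f (f x) = r by apply/eqP; rewrite (root_connect cs) cs fconnect1.
have Ex := iter_findex xr; set i := findex f r x in Ex *.
have oxp : fingraph.order f r = p.
  apply: order_prime => [|fr].
    by apply: (inj_iter (n := i) f_inj); rewrite -iterD addnC iterD Ex.
  apply: fx; rewrite -Ex -iterS iterSr fr.
  by [].
have ip : (i < p)%N by rewrite -oxp findex_max.
have [lt|ge] := ltnP i.+1 p.
  by rewrite -Ex -iterS findex_iter ?oxp // -natr1.
have Ei : i.+1 = p by apply/eqP; rewrite eqn_leq ip ge.
have -> : f x = r by rewrite -Ex -iterS Ei -oxp iter_order.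
by rewrite findex0 natr1 Ei pchar_Fp_0.
Qed.

(** The indicator of one point in each orbit of length [p]; inserting its orbit sum, which is 1,
    unfolds sums over orbits. *)
Definition orbit_zero x : 'F_p := (orbit_count x == 0)%:R.

Lemma sum_orbit_zero x : iter p f x = x -> f x <> x ->
  \sum_(k < p) orbit_zero (iter k f x) = 1.
Proof.
move=> fp fx.
have Ek k : orbit_count (iter k f x) = orbit_count x + k%:R.
  elim: k => [|k IHk]; first by rewrite addr0.
  rewrite iterS orbit_countS; first by rewrite IHk -natr1 addrA.
    by rewrite -iterD addnC iterD fp.
  by move=> H; apply: fx; apply: (inj_iter (n := k) f_inj); rewrite -iterSr.
have Fp_nat (z : 'F_p) : (z : nat)%:R = z by rewrite natr_Zp.
have zp (z : 'F_p) : ((z : nat) < p)%N by have := ltn_ord z; rewrite [X in (_ < X)%N]Fp_cast.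
pose k0 : 'I_p := Ordinal (zp (- orbit_count x)).
have Ek0 : (k0 : nat)%:R = - orbit_count x :> 'F_p by apply: Fp_nat.
rewrite (bigD1 k0) //= big1 => [|k kk].
  by rewrite addr0 /orbit_zero Ek Ek0 addrN eqxx.
rewrite /orbit_zero Ek; case: eqP => // /eqP; rewrite addrC addr_eq0 => /eqP E0.
case/eqP: kk; apply: val_inj; have := congr1 (fun z : 'F_p => (z : nat)) E0.
by rewrite val_Fp_nat // modn_small.
Qed.

End OrbitCounter.

Section SmithSums.
Variables (E : finType) (f : E -> E) (p : nat).
Hypotheses (f_inj : injective f) (p_pr : prime p).

Lemma sum_free_orbits (h : E -> 'F_p) : (forall x, h (f x) = h x) ->
  (forall x, h x != 0 -> iter p f x = x) -> \sum_(x | f x != x) h x = 0.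
Proof.
move=> hf hp.
have hk k x : h (iter k f x) = h x by elim: k => //= k <-.
pose g x := if f x == x then 0 else h x.
have gf x : g (f x) = g x.
  by rewrite /g hf (inj_eq f_inj).
have gk k x : g (iter k f x) = g x by elim: k => //= k <-.
have -> : \sum_(x | f x != x) h x = \sum_x \sum_(k < p) g (iter k f x) * orbit_zero f p (iter k f x).
  rewrite big_mkcond; apply: eq_bigr => x _.
  rewrite (eq_bigr (fun k : 'I_p => g x * orbit_zero f p (iter k f x))) => [|k _]; last by rewrite gk.
  rewrite -mulr_sumr /g; case: eqP => [_|fx]; first by rewrite mul0r.
  have [->|/hp hx] := eqVneq (h x) 0; first by rewrite mul0r.
  by rewrite sum_orbit_zero // mulr1.
rewrite exchange_big /= (eq_bigr (fun=> \sum_x g x * orbit_zero f p x)) => [|k _].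
  by rewrite sumr_const card_ord -mulr_natr pchar_Fp_0 // mulr0.
by rewrite [RHS](reindex_inj (inj_iter (n := k) f_inj)).
Qed.
End SmithSums.

(** * Smith theory and connectedness through chains *)

Section Graph.
Variables (E U : finType) (d0 d1 : E -> U).

(** The boundary of [c] tested on [th]: the equation [pairing c th = th v - th u] for all [th] says
    that this boundary is [v - u]. *)
Definition pairing (R : nzRingType) (c : E -> R) (th : U -> R) : R :=
  \sum_x c x * (th (d1 x) - th (d0 x)).

Section Smith.
Variables (f : E -> E) (g : U -> U) (p : nat).
Hypotheses (f_inj : injective f) (g_inj : injective g) (p_pr : prime p).
Hypotheses (fg0 : forall x, d0 (f x) = g (d0 x)) (fg1 : forall x, d1 (f x) = g (d1 x)).

(** [c 0] joins [u] to [g u], [c k] is its translate by the [k]-th power of [f], and the translates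
    add up to the zero chain. Without a fixed vertex the orbit counter has an invariant coboundary;
    unfolding with [orbit_zero] turns its pairing with [c 0], which is 1, into a pairing with that
    zero sum. *)
Lemma smith_fixed (SU : U -> Prop) (c : nat -> E -> 'F_p) u :
  (forall x, c 0%N x != 0 -> SU (d0 x) /\ SU (d1 x)) ->
  (forall v, SU v -> SU (g v)) -> (forall v, SU v -> iter p g v = v) -> SU u ->
  (forall k x, c k (iter k f x) = c 0%N x) ->
  (forall x, \sum_(k < p) c k x = 0) ->
  (forall th : U -> 'F_p, pairing (c 0%N) th = th (g u) - th u) ->
  exists2 v, SU v & g v = v.
Proof.
move=> cS Sg Sp Su ck norm bd; apply: contrapT => no.
have nofix v : SU v -> g v <> v by move=> Sv gv; apply: no; exists v.
have d0k k x : d0 (iter k f x) = iter k g (d0 x) by elim: k => //= k <-.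
have th_S v : SU v -> orbit_count g p (g v) = orbit_count g p v + 1.
  by move=> Sv; apply: orbit_countS => //; [exact: Sp | exact: nofix].
have Sk k v : SU v -> SU (iter k g v) by move=> Sv; elim: k => //= k; exact: Sg.
pose eta x : 'F_p := orbit_count g p (d1 x) - orbit_count g p (d0 x).
have etak k x : c 0%N x != 0 -> eta (iter k f x) = eta x.
  move=> /cS[S0 S1]; elim: k => //= k <-; rewrite /eta fg0 fg1.
  have d1k : d1 (iter k f x) = iter k g (d1 x) by elim: k => //= k <-.
  rewrite !th_S ?d0k ?d1k; [by ring | exact: Sk | exact: Sk].
pose rho x := orbit_zero g p (d0 x).
have : pairing (c 0%N) (orbit_count g p) = 1 by rewrite bd th_S // addrC addKr.
suff -> : pairing (c 0%N) (orbit_count g p) = 0 by move/eqP; rewrite eq_sym oner_eq0.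
have -> : pairing (c 0%N) (orbit_count g p) =
    \sum_x \sum_(k < p) c k (iter k f x) * eta (iter k f x) * rho (iter k f x).
  apply: eq_bigr => x _.
  rewrite (eq_bigr (fun k : 'I_p => c 0%N x * eta x * rho (iter k f x))) => [|k _].
    have [->|nz] := eqVneq (c 0%N x) 0.
      by rewrite !mul0r big1 // => k _; rewrite !mul0r.
    rewrite -mulr_sumr (eq_bigr (fun k : 'I_p => orbit_zero g p (iter k g (d0 x)))).
      by rewrite sum_orbit_zero ?mulr1 //; have [S0 _] := cS x nz; [exact: Sp | exact: nofix].
    by move=> k _; rewrite /rho d0k.
  rewrite ck; have [->|nz] := eqVneq (c 0%N x) 0; first by rewrite !mul0r.
  by rewrite etak.
rewrite exchange_big /=.
rewrite (eq_bigr (fun k : 'I_p => \sum_x c k x * (eta x * rho x))) => [|k _].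
  rewrite exchange_big /= big1 // => x _.
  by rewrite -mulr_suml norm mul0r.
rewrite [RHS](reindex_inj (inj_iter (n := k) f_inj)) /=.
by apply: eq_bigr => x _; rewrite mulrA.
Qed.

(** Test functions are set to 0 off the fixed vertices. The edges of [c] that are not fixed then
    form orbits of length [p] with constant contributions, which vanish modulo [p]. *)
Lemma smith_restrict (c : E -> 'F_p) u v :
  (forall x, c (f x) = c x) -> (forall x, c x != 0 -> iter p f x = x) ->
  g u = u -> g v = v ->
  (forall th : U -> 'F_p, pairing c th = th v - th u) ->
  forall th : U -> 'F_p, pairing (fun x => if f x == x then c x else 0) th = th v - th u.
Proof.
move=> cf cp gu gv bd th.
pose th' w := if g w == w then th w else 0.
have := bd th'; rewrite /th' gu gv !eqxx => <-.
rewrite /pairing [RHS](bigID (fun x => f x == x)) /= -/th'.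
have -> : \sum_(x | f x != x) c x * (th' (d1 x) - th' (d0 x)) = 0.
  apply: (sum_free_orbits f_inj p_pr) => x.
    rewrite cf fg0 fg1; have E1 w : th' (g w) = th' w.
      by rewrite /th' (inj_eq g_inj); case: eqP => // ->.
    by rewrite !E1.
  by rewrite mulf_eq0 negb_or => /andP[/cp].
rewrite addr0 [RHS]big_mkcond /=; apply: eq_bigr => x _.
case: eqP => [fx|]; last by rewrite mul0r.
by rewrite /th' -fg0 -fg1 fx !eqxx.
Qed.
End Smith.

(** The joining chain is integral, so that it can be paired with functions into every ['F_p]. *)
Definition linked (S : E -> Prop) u v := exists c : E -> int,
  (forall x, c x != 0 -> S x) /\
  forall (R : nzRingType) (th : U -> R), pairing (fun x => (c x)%:~R) th = th v - th u.

Lemma linked_refl S u : linked S u u.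
Proof.
exists (fun=> 0); split=> [x|R th]; first by rewrite eqxx.
by rewrite subrr /pairing big1 // => x _; rewrite mul0r.
Qed.

Lemma linked_trans S u v w : linked S u v -> linked S v w -> linked S u w.
Proof.
move=> [c [cS cb]] [c' [c'S c'b]]; exists (fun x => c x + c' x); split=> [x|R th].
  by have [->|/cS//] := eqVneq (c x) 0; rewrite add0r => /c'S.
have -> : th w - th u = (th v - th u) + (th w - th v) by rewrite [RHS]addrC subrKA.
rewrite -cb -c'b /pairing -big_split /=; apply: eq_bigr => x _.
by rewrite intrD mulrDl.
Qed.

Lemma linked_sym S u v : linked S u v -> linked S v u.
Proof.
move=> [c [cS cb]]; exists (fun x => - c x); split=> [x|R th].
  by rewrite oppr_eq0; apply: cS.
rewrite -opprB -cb /pairing -sumrN; apply: eq_bigr => x _.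
by rewrite intrN mulNr.
Qed.

Lemma linked_edge (S : E -> Prop) x : S x -> linked S (d0 x) (d1 x).
Proof.
move=> Sx; exists (fun y => (y == x)%:R); split=> [y|R th].
  by case: (eqVneq y x) => [->|]; rewrite ?eqxx.
rewrite /pairing (bigD1 x) //= big1 ?addr0 => [|y /negPf->]; last by rewrite mul0r.
by rewrite eqxx mul1r.
Qed.

Lemma linked_sub (S S' : E -> Prop) u v :
  (forall x, S x -> S' x) -> linked S u v -> linked S' u v.
Proof. by move=> SS [c [cS cb]]; exists c; split=> // x /cS/SS. Qed.

(* Since connectedness does not depend on the coefficients, Smith theory can be
   applied for several primes in succession. *)
Lemma linked_of_chain (R : nzRingType) (S : E -> Prop) (c : E -> R) u v :
  (forall x, c x != 0 -> S x) ->
  (forall th : U -> R, pairing c th = th v - th u) -> linked S u v.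
Proof.
move=> cS cb.
pose adj w w' := [exists x, `[< S x >] && (((w == d0 x) && (w' == d1 x)) || ((w == d1 x) && (w' == d0 x)))].
have : connect adj u v.
  apply/negPn/negP => nuv.
  have := cb (fun w => (connect adj u w)%:R).
  rewrite connect0 (negPf nuv) sub0r => /eqP; apply/negP.
  rewrite /pairing big1 ?(eq_sym 0) ?oppr_eq0 ?oner_eq0 // => x _.
  have [->|/cS Sx] := eqVneq (c x) 0; first by rewrite mul0r.
  have E1 : connect adj u (d1 x) = connect adj u (d0 x).
    apply/idP/idP => H; apply: (connect_trans H); apply: connect1; apply/existsP; exists x;
      by rewrite asboolT //= !eqxx ?orbT.
  by rewrite E1 subrr mulr0.
case/connectP=> q + ->; elim: q u {cb} => [|w q IHq] u /=; first by move=> _; apply: linked_refl.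
case/andP=> /existsP[x /andP[/asboolP Sx uw]] /IHq; apply: linked_trans.
by case/orP: uw => /andP[/eqP-> /eqP->]; [|apply: linked_sym]; apply: linked_edge.
Qed.

(* Otherwise the indicator function of [I] pairs to 0 with every edge of [c],
   but to -1 with the boundary of [c]. *)
Lemma helly_edges (R : nzRingType) (I A : U -> Prop) (c : E -> R) u v :
  (forall x, c x != 0 -> (I (d0 x) /\ I (d1 x)) \/ (A (d0 x) /\ A (d1 x))) ->
  (forall th : U -> R, pairing c th = th v - th u) ->
  I u -> A v -> exists w, I w /\ A w.
Proof.
move=> cS cb Iu Av; apply: contrapT => no.
have AI w : A w -> ~ I w by move=> Aw Iw; apply: no; exists w.
have := cb (fun w => `[< I w >]%:R); rewrite (asboolT Iu) (asboolF (AI _ Av)) sub0r.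
move/eqP; apply/negP; rewrite /pairing big1 ?(eq_sym 0) ?oppr_eq0 ?oner_eq0 // => x _.
have [->|/cS[[S0 S1]|[S0 S1]]] := eqVneq (c x) 0; first by rewrite mul0r.
  by rewrite !asboolT // subrr mulr0.
by rewrite (asboolF (AI _ S0)) (asboolF (AI _ S1)) subrr mulr0.
Qed.

End Graph.

Local Close Scope ring_scope.

(** * Coset graphs of an amalgam over a non-edge *)

Local Open Scope ring_scope.

Lemma Zp_int_eq0 K p (z : int) : (1 < K)%N -> prime p -> (p %| K)%N ->
  (z%:~R : 'Z_K) = 0 -> (z%:~R : 'F_p) = 0.
Proof.
move=> K1 pp pK; suff nat0 n : (n%:R : 'Z_K) = 0 -> (n%:R : 'F_p) = 0.
  case: z => n; first exact: nat0.
  by rewrite NegzE !intrN => /eqP; rewrite oppr_eq0 => /eqP/nat0; rewrite -pmulrn => ->; rewrite oppr0.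
move/(congr1 (fun z : 'Z_K => (z : nat))); rewrite val_Zp_nat //= => nK.
apply/eqP; rewrite -(dvdn_pcharf (pchar_Fp pp)); apply: dvdn_trans pK _.
by rewrite /dvdn nK.
Qed.

Section Classes.
Variables (V : finType) (e : rel V) (m : V -> V -> nat).
Implicit Types (u w : seq V) (X Y : {set V}).

Definition cls (G : finquot e m) X w : {set G} := (ev G w *: par G X)%g.

Lemma cls_cat G X u w : cls G X (u ++ w) = (ev G u *: cls G X w)%g.
Proof. by rewrite /cls ev_cat lcosetM. Qed.

Lemma cls_catr G X u w : all (mem X) w -> cls G X (u ++ w) = cls G X u.
Proof. by move=> wX; rewrite /cls ev_cat lcosetM lcoset_id // ev_par. Qed.

Lemma cls_eqP G X u w : cls G X u = cls G X w ->
  exists2 h, all (mem X) h & ev G w = ev G (u ++ h).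
Proof.
move=> E; have : ev G w \in cls G X u by rewrite E; apply: lcoset_refl.
by rewrite mem_lcoset => /parP[h hX Eh]; exists h; rewrite // ev_cat -Eh mulKVg.
Qed.

Lemma cls_sub G X Y w : X \subset Y -> (cls G X w * par G Y)%g = cls G Y w.
Proof.
by move=> XY; rewrite /cls -mulgA mulSGid // par_sub.
Qed.

Lemma cls_refines (G' G : finquot e m) X u w :
  refines G' G -> cls G' X u = cls G' X w -> cls G X u = cls G X w.
Proof.
move=> r /cls_eqP[h hX /(refines_eq r) E].
by rewrite -(cls_catr G u hX) /cls E.
Qed.

End Classes.

Section Refine.
Variables (V : finType) (e : rel V) (m : V -> V -> nat).
Hypothesis cg : coxeter_graph e m.
Variables (a b : V).
Hypotheses (ab : a != b) (nab : ~~ e a b).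
Implicit Types (u w : seq V) (s t : V) (X : {set V}).
Local Notation "u ~ w" := (cox_eq e m u w) (at level 70).

Definition side (tau : bool) : {set V} := if tau then [set~ b] else [set~ a].
Definition edge_set : {set V} := [set~ a] :\ b.

Lemma edge_side tau : edge_set \subset side tau.
Proof.
by apply/subsetP => s; rewrite /side; case: tau; rewrite !inE => /andP[].
Qed.

Section Cross.
Variable G : finquot e m.
Implicit Types (q : G) (Z : {set G}).
Local Notation chain := {ffun {set G} -> int}.

Definition eset q : {set G} := (q *: par G edge_set)%g.

Definition delta Z : chain := [ffun Z' => (Z' == Z)%:R].

(* Signed crossings of the path labelled [w] from [q] in the coset graph of the
   amalgam over the non-edge [{a, b}], counted from [side false] vertices. *)
Fixpoint cross q w : chain :=
  if w is s :: w' then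
    (if s == a then delta (eset (q * fqg G s)%g) - delta (eset q)
     else 0) + cross (q * fqg G s)%g w'
  else 0.

Lemma cross_cat q u w : cross q (u ++ w) = cross q u + cross (q * ev G u)%g w.
Proof.
elim: u q => [|s u IHu] q /=; first by rewrite ev_nil mulg1 add0r.
by rewrite IHu addrA ev_cons mulgA.
Qed.

Lemma cross_sideA q w : all (mem (side false)) w -> cross q w = 0.
Proof.
elim: w q => //= s w IHw q /andP[]; rewrite !inE => /negPf-> /IHw->.
by rewrite addr0.
Qed.

Lemma cross_sideB q w : all (mem (side true)) w ->
  cross q w = delta (eset (q * ev G w)%g) - delta (eset q).
Proof.
elim: w q => [|s w IHw] q /=; first by rewrite ev_nil mulg1 subrr.
rewrite !inE => /andP[sb /IHw->]; rewrite ev_cons mulgA.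
case: eqP => [_|/eqP sa]; first by rewrite addrC subrKA.
rewrite add0r; congr (_ - delta _); rewrite /eset lcosetM lcoset_id //.
by apply: mem_gen; apply/imsetP; exists s; rewrite // !inE sa sb.
Qed.

(** As [{a, b}] is not an edge, every relator lies in one of the two vertex groups, where closed
    paths have zero crossing chain. *)
Lemma cross_rel q s t : e s t -> cross q (flatten (nseq (m s t) [:: s; t])) = 0.
Proof.
move=> est; have ets : e t s by case: cg => ->.
have all_side tau : s \in side tau -> t \in side tau ->
    all (mem (side tau)) (flatten (nseq (m s t) [:: s; t])).
  by move=> sS tS; elim: (m s t) => //= n ->; rewrite sS tS.
have [E|/eqP sa] := eqVneq s a; last first.
  have [E|/eqP ta] := eqVneq t a; last first.
    by rewrite cross_sideA // all_side // !inE; apply/eqP.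
  rewrite cross_sideB ?all_side // ?inE.
  - by rewrite ev_flatten ev_cons ev1 fqg_rel // mulg1 subrr.
  - by apply: contraNneq nab => <-; rewrite -E.
  - by rewrite E.
rewrite cross_sideB ?all_side // ?inE.
- by rewrite ev_flatten ev_cons ev1 fqg_rel // mulg1 subrr.
- by rewrite E.
- by apply: contraNneq nab => <-; rewrite -E.
Qed.

Lemma cross_sq q s : cross q [:: s; s] = 0.
Proof.
have [E|sa] := eqVneq s a; last by rewrite /= (negPf sa) !addr0.
rewrite cross_sideB; last by rewrite /= !inE E ab.
by rewrite ev_cons ev1 fqg_sq mulg1 subrr.
Qed.

Lemma cross_cox q u w : u ~ w -> cross q u = cross q w.
Proof.
move=> uw; elim: uw q => {u w} [//|u w _ IH q|u v w _ IH1 _ IH2 q|u s w q|u s t w est q].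
- by rewrite IH.
- by rewrite IH1.
- rewrite !cross_cat cross_sq add0r; congr (_ + cross _ _).
  by rewrite ev_cons ev1 fqg_sq mulg1.
- rewrite !cross_cat cross_rel // add0r; congr (_ + cross _ _).
  by rewrite ev_flatten ev_cons ev1 fqg_rel // mulg1.
Qed.

Lemma chainD (c c' : chain) Z : (c + c') Z = c Z + c' Z.
Proof. by rewrite ffunE. Qed.
Lemma chainN (c : chain) Z : (- c) Z = - c Z.
Proof. by rewrite ffunE. Qed.
Lemma chainB (c c' : chain) Z : (c - c') Z = c Z - c' Z.
Proof. by rewrite chainD chainN. Qed.

Lemma cross_shift g q w Z : cross (g * q)%g w (g *: Z)%g = cross q w Z.
Proof.
have dS q' : delta (eset (g * q')%g) (g *: Z)%g = delta (eset q') Z.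
  rewrite !ffunE /eset lcosetM; congr (nat_of_bool _)%:R.
  by apply/eqP/eqP => [/lcoset_inj|->].
elim: w q => [|s w IHw] q /=; first by rewrite !ffunE.
rewrite !chainD -mulgA IHw; congr (_ + _).
by case: eqP => _; [rewrite !chainD !chainN !dS | rewrite !ffunE].
Qed.

(** A chain from the base vertex [vx (false, [::])] to [vx x]. In a tree it would be determined by
    the vertex; in the coset graph of [G] it depends on the word. *)
Definition pot (x : bool * seq V) : chain :=
  cross 1%g x.2 - (if x.1 then delta (cls G edge_set x.2) else 0).

Definition vx (x : bool * seq V) : bool * {set G} := (x.1, cls G (side x.1) x.2).

Definition end0 Z : bool * {set G} := (true, (Z * par G (side true))%g).
Definition end1 Z : bool * {set G} := (false, (Z * par G (side false))%g).

Lemma end0_cls w : end0 (cls G edge_set w) = vx (true, w).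
Proof. by rewrite /end0 cls_sub // edge_side. Qed.
Lemma end1_cls w : end1 (cls G edge_set w) = vx (false, w).
Proof. by rewrite /end1 cls_sub // edge_side. Qed.

Lemma pairing_delta (R : nzRingType) Z (th : bool * {set G} -> R) :
  pairing end0 end1 (fun x => (delta Z x)%:~R) th = th (end1 Z) - th (end0 Z).
Proof.
rewrite /pairing (bigD1 Z) //= big1 ?addr0 => [|Z' /negPf ZZ].
  by rewrite ffunE eqxx mul1r.
by rewrite ffunE ZZ mul0r.
Qed.

Lemma pairingB (R : nzRingType) (c c' : chain) (th : bool * {set G} -> R) :
  pairing end0 end1 (fun x => ((c - c') x)%:~R) th =
  pairing end0 end1 (fun x => (c x)%:~R) th - pairing end0 end1 (fun x => (c' x)%:~R) th.
Proof.
rewrite /pairing -sumrB; apply: eq_bigr => x _.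
by rewrite !ffunE intrB mulrBl.
Qed.

Lemma pairing_pot (R : nzRingType) x (th : bool * {set G} -> R) :
  pairing end0 end1 (fun Z => (pot x Z)%:~R) th = th (vx x) - th (vx (false, [::])).
Proof.
have cr w : pairing end0 end1 (fun Z => (cross 1%g w Z)%:~R) th =
    th (vx (false, w)) - th (vx (false, [::])).
  elim/last_ind: w => [|w s IHw].
    by rewrite subrr /pairing big1 // => Z _; rewrite ffunE mul0r.
  have -> : cross 1%g (rcons w s) = cross 1%g w -
      (if s == a then delta (cls G edge_set w) - delta (cls G edge_set (rcons w s)) else 0).
    rewrite -cats1 cross_cat /= addr0 mul1g; congr (_ + _).
    by case: ifP => _; rewrite ?oppr0 // opprB /cls ev_cat ev1.
  rewrite pairingB IHw; case: eqP => [sa|/eqP sa].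
    rewrite pairingB !pairing_delta !end0_cls !end1_cls.
    have -> : vx (true, rcons w s) = vx (true, w).
      by rewrite /vx -cats1 cls_catr //= !inE sa ab.
    by rewrite opprB (opprB (th (vx (false, w)))) subrKA addrC subrKA.
  have -> : vx (false, rcons w s) = vx (false, w).
    by rewrite /vx -cats1 cls_catr //= !inE sa.
  by rewrite /pairing [X in _ - X]big1 ?subr0 // => Z _; rewrite ffunE mul0r.
case: x => tau w; rewrite /pot pairingB cr /=; case: tau.
  rewrite pairing_delta end0_cls end1_cls.
  by rewrite opprB addrC subrKA.
by rewrite /pairing [X in _ - X]big1 ?subr0 // => Z _; rewrite ffunE mul0r.
Qed.

Lemma pot_edge w : pot (false, w) - pot (true, w) = delta (cls G edge_set w).
Proof. by rewrite /pot /= subr0 opprB addrC subrK. Qed.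

(** [pot] is not equivariant, since the base vertex moves; the correction [cross 1 u] is common to
    both ends and cancels. *)
Lemma pot_shift u x y Z :
  (pot (y.1, u ++ y.2) - pot (x.1, u ++ x.2)) (ev G u *: Z)%g = (pot y - pot x) Z.
Proof.
have one z : pot (z.1, u ++ z.2) (ev G u *: Z)%g = cross 1%g u (ev G u *: Z)%g + pot z Z.
  rewrite /pot /= cross_cat -addrA !chainD; congr (_ + _).
  rewrite mul1g -{1}[ev G u]mulg1 cross_shift !chainN; congr (_ - _).
  case: z.1; rewrite !ffunE //; congr (nat_of_bool _)%:R.
  by rewrite cls_cat; apply/eqP/eqP => [/lcoset_inj|->].
by rewrite (chainB (pot _)) !one (chainB (pot y)); ring.
Qed.

End Cross.

Section Refinement.
Variables (K : nat) (G : finquot e m).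
Hypothesis K_gt1 : (1 < K)%N.
Local Notation chain := {ffun {set G} -> int}.
Let modK (c : chain) : {ffun {set G} -> 'Z_K} := [ffun Z => (c Z)%:~R].
Let modKD c c' : modK (c + c') = modK c + modK c'.
Proof. by apply/ffunP => Z; rewrite !ffunE intrD. Qed.
Let modK0 : modK 0 = 0.
Proof. by apply/ffunP => Z; rewrite !ffunE. Qed.
Let T : finType := (G * {ffun {set G} -> 'Z_K})%type.
Let move_by (p : T) w : T := (p.1 * ev G w, p.2 + modK (cross p.1 w))%g.
Let step s p := move_by p [:: s].
Let move_cat p u w : move_by (move_by p u) w = move_by p (u ++ w).
Proof. by rewrite /move_by /= ev_cat mulgA cross_cat modKD addrA. Qed.
Let move_cox p u w : u ~ w -> move_by p u = move_by p w.
Proof. by move=> uw; rewrite /move_by (ev_cox G uw) (cross_cox _ uw). Qed.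
Let move_nil p : move_by p [::] = p.
Proof. by case: p => q c; rewrite /move_by /= ev_nil mulg1 modK0 addr0. Qed.
Let stepK s : involutive (step s).
Proof.
move=> p; rewrite /step move_cat (move_cox _ (_ : _ ~ [::])) //.
exact: (cox_sq e m [::] s [::]).
Qed.
Let sigma s : {perm T} := perm (inv_inj (stepK s)).
Let prod_sigma w p : (\prod_(s <- w) sigma s)%g p = move_by p w.
Proof.
elim: w p => [|s w IHw] p; first by rewrite big_nil perm1 move_nil.
by rewrite big_cons permM permE IHw /step move_cat.
Qed.
Let prod_cox w : w ~ [::] -> (\prod_(s <- w) sigma s)%g = 1%g.
Proof.
by move=> w1; apply/permP => p; rewrite prod_sigma (move_cox _ w1) move_nil perm1.
Qed.
Let sigma_sq s : (sigma s * sigma s = 1)%g.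
Proof.
have := prod_cox (cox_sq e m [::] s [::]); by rewrite big_cons big_seq1.
Qed.
Let sigma_rel s t : e s t -> ((sigma s * sigma t) ^+ m s t = 1)%g.
Proof.
move=> est; have := @cox_edge V e m [::] s t [::] est; rewrite cats0 => /prod_cox.
suff -> n : (\prod_(r <- flatten (nseq n [:: s; t])) sigma r = (sigma s * sigma t) ^+ n)%g by [].
elim: n => [|n IHn] /=; first by rewrite big_nil.
by rewrite !big_cons IHn expgS mulgA.
Qed.

(* In the kernel all crossing numbers vanish modulo [K], so that the potential
   [pot G] is well defined modulo [K] on the vertices of the coset graph of
   [refine]: cycles of that graph die in the coset graph of [G]. *)
Definition refine := FinQuot sigma_sq sigma_rel.

Lemma refineP w : ev refine w = 1%g -> ev G w = 1%g /\
  forall (q : G) Z p, prime p -> (p %| K)%N -> ((cross q w Z)%:~R : 'F_p) = 0.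
Proof.
move=> w1; have H (q : G) : move_by (q, 0) w = (q, 0).
  by rewrite -prod_sigma -[(\prod_(s <- w) sigma s)%g]/(ev refine w) w1 perm1.
split; first by have := H 1%g; rewrite /move_by /= mul1g => -[].
move=> q Z p pp pK; have := H q; rewrite /move_by /= add0r => -[_ /ffunP/(_ Z)].
by rewrite !ffunE; apply: Zp_int_eq0.
Qed.

Lemma refine_refines : refines refine G.
Proof. by move=> w /refineP[]. Qed.

(** Two words for one vertex differ by a word of the side group, whose crossings match the change of
    the edge term in [pot], and by a kernel word, whose crossings vanish modulo [p]. *)
Lemma pot_class x y Z p : prime p -> (p %| K)%N -> vx refine x = vx refine y ->
  ((pot G x Z)%:~R : 'F_p) = (pot G y Z)%:~R.
Proof.
case: x y => [tau w] [tau' w'] pp pK; rewrite /vx /= => -[<- E].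
have [h hX Eh] := @cls_eqP V e m refine (side tau) w w' E; pose n := rev (w ++ h) ++ w'.
have n1 : ev refine n = 1%g by rewrite ev_cat ev_rev Eh mulVg.
have [n1G cn] := refineP n1.
have w'_dec : w' ~ (w ++ h) ++ n by apply: cox_sym; apply: cox_catVw.
have Ecls : cls G edge_set w' = cls G edge_set (w ++ h).
  by rewrite /cls (ev_cox G w'_dec) ev_cat n1G mulg1.
rewrite /pot /= (cross_cox _ w'_dec) (cross_cat _ _ n) (cross_cat _ w) Ecls.
rewrite !chainB !chainD !intrB !intrD cn // addr0.
case: tau hX {E} => hX; last by rewrite (cross_sideA _ hX) ffunE addr0 mulr0z.
rewrite (cross_sideB _ hX) !chainB /eset mul1g /cls ev_cat intrB.
by rewrite [X in _ = X - _]addrCA addrAC subrr add0r.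
Qed.

End Refinement.
End Refine.

(** * Fixed points in the tower of coset graphs *)

Section Tower.
Variables (V : finType) (e : rel V) (m : V -> V -> nat).
Hypothesis cg : coxeter_graph e m.
Variables (a b : V).
Hypotheses (ab : a != b) (nab : ~~ e a b).
Variables (Y : {set V}) (K : nat) (G0 : finquot e m).
Hypothesis K_gt1 : (1 < K)%N.
Implicit Types (u w : seq V) (s t : V) (X : {set V}) (H : seq (seq V)).
Implicit Types (x y : bool * seq V).
Local Notation "u ~ w" := (cox_eq e m u w) (at level 70).

Definition tower j : finquot e m := iter j (refine cg ab nab K) G0.

Lemma tower_refines i j : (i <= j)%N -> refines (tower j) (tower i).
Proof.
move=> /subnK <-; elim: (j - i)%N => // n IHn; apply: refines_trans IHn.
by apply: refine_refines.
Qed.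

Local Notation vert := (vx a b).
Local Notation pot := (pot a b).
Local Notation end0 := (@end0 V e m a b _).
Local Notation end1 := (@end1 V e m a b _).
Local Notation side := (side a b).
Local Notation ec j w := (cls (tower j) (edge_set a b) w).

Definition fixes j X H w := forall h, h \in H -> cls (tower j) X (h ++ w) = cls (tower j) X w.

Definition fixed_pt j H x := all (mem Y) x.2 /\ fixes j (side x.1) H x.2.

Definition fixed_edge j H (Z : {set tower j}) :=
  exists w, [/\ all (mem Y) w, fixes j (edge_set a b) H w & Z = ec j w].

Definition fixed_vertex j H (u : bool * {set tower j}) :=
  exists x, fixed_pt j H x /\ u = vert (tower j) x.

Lemma fixes_le i j X H w : (i <= j)%N -> fixes j X H w -> fixes i X H w.
Proof. by move=> ij fw h hH; apply: (cls_refines (tower_refines ij)); apply: fw. Qed.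

Lemma fixed_pt_le i j H x : (i <= j)%N -> fixed_pt j H x -> fixed_pt i H x.
Proof. by move=> ij [xY fx]; split=> //; apply: fixes_le fx. Qed.

Lemma fixes_sub X X' H j w : X \subset X' -> fixes j X H w -> fixes j X' H w.
Proof. by move=> XX fw h hH; rewrite -!(cls_sub _ _ XX) fw. Qed.

Lemma fixes_cat j X H H' w : fixes j X (H ++ H') w <-> fixes j X H w /\ fixes j X H' w.
Proof.
split=> [fw|[f1 f2] h]; last by rewrite mem_cat => /orP[/f1|/f2].
by split=> h hH; apply: fw; rewrite mem_cat hH ?orbT.
Qed.

Lemma fixed_edge_ends j H Z : fixed_edge H Z ->
  fixed_vertex H (end0 Z) /\ @fixed_vertex j H (end1 Z).
Proof.
move=> [w [wY fw ->]]; rewrite end0_cls end1_cls.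
by split; [exists (true, w) | exists (false, w)]; split=> //; split=> //;
  apply: fixes_sub fw; apply: edge_side.
Qed.

Definition level_linked j H x y :=
  linked end0 end1 (@fixed_edge j H) (vert (tower j) x) (vert (tower j) y).

(** Connectedness of the fixed subgraph of the limit, at a cost of [d] levels. The bound [M] is
    there because the words of [H] satisfy their relations only up to a finite level. *)
Definition conn M d H := forall j x y, (j + d <= M)%N ->
  fixed_pt (j + d) H x -> fixed_pt (j + d) H y -> level_linked j H x y.

Definition nonempty M d H := forall j, (j + d <= M)%N -> exists x, fixed_pt j H x.

Lemma conn_le M d d' H : (d <= d')%N -> conn M d H -> conn M d' H.
Proof.
move=> dd cH j x y jM fx fy; apply: cH; first by apply: leq_trans jM; rewrite leq_add2l.
  by apply: fixed_pt_le fx; rewrite leq_add2l.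
by apply: fixed_pt_le fy; rewrite leq_add2l.
Qed.

Lemma nonempty_le M d d' H : (d <= d')%N -> nonempty M d H -> nonempty M d' H.
Proof. by move=> dd nH j jM; apply: nH; apply: leq_trans jM; rewrite leq_add2l. Qed.

Definition same_fixed M H H' := forall j X w, (j <= M)%N -> all (mem Y) w ->
  fixes j X H w <-> fixes j X H' w.

Lemma nonempty_same M d H H' : same_fixed M H H' -> nonempty M d H -> nonempty M d H'.
Proof.
move=> E nH j jM; have [x [xY fx]] := nH j jM; exists x; split=> //.
by apply/E => //; apply: leq_trans jM; apply: leq_addr.
Qed.

Lemma conn_same M d H H' : same_fixed M H H' -> conn M d H -> conn M d H'.
Proof.
move=> E cH j x y jM [xY fx] [yY fy].
have jM' : (j <= M)%N by apply: leq_trans jM; apply: leq_addr.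
apply: (linked_sub (S := @fixed_edge j H)) => [Z [w [wY fw ->]]|].
  by exists w; split=> //; apply/E.
by apply: cH => //; split=> //; apply/E.
Qed.

Section Chain.
Variable p : nat.
Hypotheses (p_pr : prime p) (pK : (p %| K)%N).

Definition path_chain j x y (Z : {set tower j}) : 'F_p :=
  ((pot (tower j) y - pot (tower j) x) Z)%:~R.

Lemma path_chainE j x y Z :
  @path_chain j x y Z = (pot (tower j) y Z)%:~R - (pot (tower j) x Z)%:~R.
Proof. by rewrite /path_chain (chainB (pot _ _)) intrB. Qed.

(** By [pot_class], potentials of level [j] are functions on the vertices of level [j.+1]. Pairing
    them with a fixed chain of that level shows that [path_chain x y] is its image, as if paths were
    unique; hence its edges are fixed. *)
Lemma path_chain_support j H x y Z : level_linked j.+1 H x y ->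
  @path_chain j x y Z != 0 -> fixed_edge H Z.
Proof.
move=> [c [cS cb]] nz.
pose th (u : bool * {set tower j.+1}) : 'F_p :=
  if pselect (exists z, vert (tower j.+1) z = u) is left h
  then (pot (tower j) (sval (cid h)) Z)%:~R else 0.
have thE z : th (vert (tower j.+1) z) = (pot (tower j) z Z)%:~R.
  rewrite /th; case: pselect => [h|[]]; last by exists z.
  by case: cid => z' /= /(pot_class K_gt1 Z p_pr pK).
have : \sum_x0 (c x0)%:~R * (th (end1 x0) - th (end0 x0)) != 0 :> 'F_p.
  by rewrite [X in X != 0]cb !thE -path_chainE.
move=> nz'; have [Z' nzZ'] : exists Z', (c Z')%:~R * (th (end1 Z') - th (end0 Z')) != 0 :> 'F_p.
  apply: contrapT => no; case/eqP: nz'; apply: big1 => Z' _; apply/eqP.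
  by apply/negPn/negP => H1; apply: no; exists Z'.
move: nzZ'; rewrite mulf_eq0 negb_or => /andP[cZ'].
have [|w [wY fw ->]] := cS Z'; first by apply: contraNneq cZ' => ->.
rewrite end0_cls end1_cls !thE -intrB -chainB pot_edge ffunE.
have [-> _|] := eqVneq Z (ec j w); last by rewrite mulr0z eqxx.
by exists w; split=> //; apply: fixes_le fw.
Qed.

Lemma path_chain_pairing j x y (th : bool * {set tower j} -> 'F_p) :
  pairing end0 end1 (path_chain x y) th = th (vert (tower j) y) - th (vert (tower j) x).
Proof. by rewrite /path_chain pairingB !pairing_pot // opprB subrKA. Qed.

Let act j u (v : bool * {set tower j}) := (v.1, (ev (tower j) u *: v.2)%g).
Let acte j u (Z : {set tower j}) := (ev (tower j) u *: Z)%g.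

Let act_inj j u : injective (@act j u).
Proof. by move=> [s Z] [s' Z'] [-> /lcoset_inj->]. Qed.
Let acte_inj j u : injective (@acte j u).
Proof. exact: lcoset_inj. Qed.

Let end0_act j u Z : end0 (@acte j u Z) = act u (end0 Z).
Proof. by rewrite /end0 /act /= mulgA. Qed.
Let end1_act j u Z : end1 (@acte j u Z) = act u (end1 Z).
Proof. by rewrite /end1 /act /= mulgA. Qed.

Let wpow (t : seq V) k := flatten (nseq k t).

Let act_vx j u x : act u (vert (tower j) x) = vert (tower j) (x.1, u ++ x.2).
Proof. by rewrite /vx cls_cat. Qed.

Let iter_acte j (t : seq V) k Z : iter k (@acte j t) Z = acte (wpow t k) Z.
Proof.
rewrite /acte /wpow ev_flatten; elim: k => [|k IHk] /=; first by rewrite lcoset1.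
by rewrite IHk -lcosetM -expgS.
Qed.

Let iter_act j (t : seq V) k v : iter k (@act j t) v = act (wpow t k) v.
Proof.
rewrite /act /wpow ev_flatten; elim: k => [|k IHk] /=; first by rewrite lcoset1; case: v.
by rewrite IHk /= -lcosetM -expgS.
Qed.

Let path_chain_shift j u x y Z :
  @path_chain j (x.1, u ++ x.2) (y.1, u ++ y.2) (acte u Z) = path_chain x y Z.
Proof. by rewrite /path_chain pot_shift. Qed.

(** On what [H] fixes, [t] acts with trivial [p]-th power. For the fixed point, [nH] and [cH] cost
    [d] levels each and [path_chain_support] one more, whence [d + d.+1]. *)
Lemma smith M d H (t : seq V) : all (mem Y) t ->
  (forall j X w, (j <= M)%N -> all (mem Y) w -> fixes j X H w -> fixes j X H (t ++ w)) ->
  (forall j X w, (j <= M)%N -> all (mem Y) w -> fixes j X H w ->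
     cls (tower j) X (wpow t p ++ w) = cls (tower j) X w) ->
  conn M d H -> nonempty M d H ->
  conn M (d + d.+1) (t :: H) /\ nonempty M (d + d.+1) (t :: H).
Proof.
move=> tY hN hP cH nH.
have fixed_t j x : (j <= M)%N -> fixed_pt j H x -> fixed_pt j H (x.1, t ++ x.2).
  by move=> jM [xY fx]; split; rewrite /= ?all_cat ?tY //; apply: hN.
have p0 := prime_gt0 p_pr.
split.
  move=> j x y jM; have jM1 : (j.+1 + d <= M)%N by lia.
  have fixH z : fixed_pt (j + (d + d.+1)) (t :: H) z ->
      fixed_pt (j.+1 + d) H z /\ vert (tower j.+1) (z.1, t ++ z.2) = vert (tower j.+1) z.
    move=> [zY fz]; split.
      apply: (@fixed_pt_le _ (j + (d + d.+1))); first by lia.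
      by split=> // h hH; apply: fz; rewrite inE hH orbT.
    have le : (j.+1 <= j + (d + d.+1))%N by lia.
    rewrite /vx /=; congr pair; apply: (cls_refines (tower_refines le)).
    by apply: fz; rewrite inE eqxx.
  move=> /fixH[fx tx] /fixH[fy ty].
  have lk := cH _ _ _ jM1 fx fy.
  have supp := fun Z => path_chain_support (Z := Z) lk.
  have tinv (Z : {set tower j}) : path_chain x y (acte t Z) = path_chain x y Z :> 'F_p.
    rewrite -[RHS](path_chain_shift t) !path_chainE.
    by rewrite (pot_class K_gt1 _ p_pr pK tx) (pot_class K_gt1 _ p_pr pK ty).
  have edge_p (Z : {set tower j}) : fixed_edge H Z -> iter p (@acte j t) Z = Z.
    move=> [w [wY fw ->]]; rewrite iter_acte /acte -cls_cat.
    by apply: hP => //; lia.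
  have fix_t z : vert (tower j.+1) (z.1, t ++ z.2) = vert (tower j.+1) z ->
      act t (vert (tower j) z) = vert (tower j) z.
    case=> E; rewrite act_vx /vx; congr pair.
    exact: (cls_refines (tower_refines (leqnSn j)) E).
  apply: (@linked_of_chain _ _ _ _ 'F_p _
      (fun Z => if acte t Z == Z then path_chain x y Z else 0)).
    move=> Z; case: (@eqP _ (acte t Z) Z) => [tZ /supp [w [wY fw EZ]]|]; last by rewrite eqxx.
    exists w; split=> // h; rewrite inE => /predU1P[->|/fw//].
    by rewrite cls_cat -EZ.
  apply: (smith_restrict (f := @acte j t) (g := @act j t) (@acte_inj j t) (@act_inj j t) p_pr
     (@end0_act j t) (@end1_act j t)) => //.
  - by move=> Z /supp; apply: edge_p.
  - exact: fix_t.
  - exact: fix_t.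
  - exact: path_chain_pairing.
move=> j jM; have [|x fx] := nH (j.+1 + d)%N; first by lia.
have ftx := fixed_t _ _ (_ : j.+1 + d <= M)%N fx.
have jM1 : (j.+1 + d <= M)%N by lia.
have lk := cH _ _ _ jM1 fx (ftx jM1).
(* From the [k]-th translate of [x] under [t] to the next one. The sum over [k < p] telescopes to a
   difference of two potentials whose vertices coincide at level [j.+1]. *)
pose c k (Z : {set tower j}) : 'F_p := path_chain (x.1, wpow t k ++ x.2) (x.1, wpow t k.+1 ++ x.2) Z.
have c0E Z : c 0%N Z = @path_chain j x (x.1, t ++ x.2) Z.
  by rewrite /c /wpow /= cats0; case: (x) => ? ?.
have [v [z [[zY fz] ->]] gv] : exists2 v, fixed_vertex H v & @act j t v = v.
  apply: (smith_fixed (E := {set tower j}) (f := @acte j t) (g := @act j t) (@acte_inj j t)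
    (@act_inj j t) p_pr (@end0_act j t) (@end1_act j t) (SU := fixed_vertex H) (c := c)
    (u := vert (tower j) x)).
  - by move=> Z; rewrite c0E => /(path_chain_support lk)/fixed_edge_ends.
  - move=> v [z [fz ->]]; exists (z.1, t ++ z.2); rewrite act_vx; split=> //.
    by apply: fixed_t => //; lia.
  - move=> v [z [[zY fz] ->]]; rewrite iter_act act_vx /vx /=; congr pair.
    by apply: hP => //; lia.
  - by exists x; split=> //; apply: fixed_pt_le fx; lia.
  - move=> k Z; rewrite iter_acte c0E /c /wpow -[nseq k.+1 t]/(t :: nseq k t).
    have E : flatten (t :: nseq k t) = flatten (nseq k t) ++ t.
      by elim: k => [|k IHk] /=; rewrite ?cats0 // -catA -IHk.
    by rewrite E -catA (path_chain_shift (flatten (nseq k t)) x (x.1, t ++ x.2)).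
  - move=> Z; rewrite /c.
    rewrite (eq_bigr (fun k : 'I_p => (pot (tower j) (x.1, wpow t k.+1 ++ x.2) Z)%:~R
        - (pot (tower j) (x.1, wpow t k ++ x.2) Z)%:~R)) => [|k _]; last first.
      by rewrite path_chainE.
    rewrite -(big_mkord predT (fun k => (pot (tower j) (x.1, wpow t k.+1 ++ x.2) Z)%:~R
        - (pot (tower j) (x.1, wpow t k ++ x.2) Z)%:~R)) telescope_sumr //.
    apply/eqP; rewrite subr_eq0; apply/eqP; apply: (pot_class K_gt1 _ p_pr pK).
    rewrite /vx /=; congr pair; apply: (hP j.+1); [lia | by case: fx | ].
    by apply: fixes_le fx.2; lia.
  - move=> th; rewrite act_vx -path_chain_pairing.
    by apply: eq_bigr => Z _; rewrite c0E.
exists z; split=> // h; rewrite inE => /predU1P[->|/fz//].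
by rewrite cls_cat; case: gv.
Qed.

(** [path_chain x y] does not depend on the family, so its edges are fixed by both. *)
Lemma conn_cat M d H H' : conn M d H -> conn M d H' -> conn M d.+1 (H ++ H').
Proof.
move=> c1 c2 j x y jM [xY fx] [yY fy].
have jM1 : (j.+1 + d <= M)%N by lia.
have [fx1 fx2] := proj1 (fixes_cat _ _ _ _ _) fx.
have [fy1 fy2] := proj1 (fixes_cat _ _ _ _ _) fy.
have l1 : level_linked j.+1 H x y by apply: c1 => //; split=> //; rewrite addSnnS.
have l2 : level_linked j.+1 H' x y by apply: c2 => //; split=> //; rewrite addSnnS.
apply: (@linked_of_chain _ _ _ _ 'F_p _ (path_chain x y)) => [Z nz|]; last exact: path_chain_pairing.
have [w [wY fw EZ]] := path_chain_support l1 nz.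
have [w' [_ fw' EZ']] := path_chain_support l2 nz.
exists w; split=> //; apply/fixes_cat; split=> // h hH.
by rewrite cls_cat -EZ EZ' -cls_cat; apply: fw'.
Qed.

(** The path from [x] to [y] is the sum of those from [x] to [z] and from [z] to [y]. So its edges,
    all fixed by [H1], are each fixed by [H2] or [H3]; it starts at a vertex fixed by [H2] and ends
    at one fixed by [H3], and somewhere both hold. *)
Lemma helly3 M d H1 H2 H3 :
  conn M d H1 -> conn M d H2 -> conn M d H3 ->
  nonempty M d (H1 ++ H2) -> nonempty M d (H1 ++ H3) -> nonempty M d (H2 ++ H3) ->
  nonempty M (d + d.+1) (H1 ++ H2 ++ H3).
Proof.
move=> c1 c2 c3 n12 n13 n23 j jM.
have jM1 : (j.+1 + d <= M)%N by lia.
have jM2 : (j.+1 + d + d <= M)%N by lia.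
have [x [xY /fixes_cat[x1 x2]]] := n12 _ jM2.
have [y [yY /fixes_cat[y1 y3]]] := n13 _ jM2.
have [z [zY /fixes_cat[z2 z3]]] := n23 _ jM2.
have l1 : level_linked j.+1 H1 x y by apply: c1.
have l2 : level_linked j.+1 H2 x z by apply: c2.
have l3 : level_linked j.+1 H3 z y by apply: c3.
pose I (v : bool * {set tower j}) := fixed_vertex H1 v /\ fixed_vertex H2 v.
pose A (v : bool * {set tower j}) := fixed_vertex H1 v /\ fixed_vertex H3 v.
have le : (j <= j.+1 + d)%N by lia.
have [v [[[w [[wY f1] Ew]] [w2 [[_ f2] Ew2]]] [_ [w3 [[_ f3] Ew3]]]]] : exists v, I v /\ A v.
  apply: (@helly_edges _ _ end0 end1 'F_p I A (path_chain x y) (vert (tower j) x) (vert (tower j) y)).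
  - move=> Z nz; have [e10 e11] := fixed_edge_ends (path_chain_support l1 nz).
    have : (path_chain x z Z != 0) || (path_chain z y Z != 0).
      rewrite -negb_and; apply: contra nz => /andP[/eqP E1 /eqP E2].
      have -> : path_chain x y Z = path_chain x z Z + path_chain z y Z.
        by rewrite !path_chainE [RHS]addrC subrKA.
      by rewrite E1 E2 addr0.
    case/orP=> [/(path_chain_support l2)|/(path_chain_support l3)] /fixed_edge_ends[? ?].
      by left.
    by right.
  - exact: path_chain_pairing.
  - by split; exists x; split=> //; split=> //; apply: fixes_le le _.
  - by split; exists y; split=> //; split=> //; apply: fixes_le le _.
have move_fix H (w' : bool * seq V) : fixes j (side w'.1) H w'.2 -> v = vert (tower j) w' -> fixes j (side w.1) H w.2.
  move=> fw' Ew' h hH; have := fw' h hH; rewrite !cls_cat.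
  by move: Ew'; rewrite Ew => -[-> ->].
exists w; split=> //; apply/fixes_cat; split=> //; apply/fixes_cat; split.
  exact: move_fix f2 Ew2.
exact: move_fix f3 Ew3.
Qed.

End Chain.

Variable N : nat.
Hypothesis N_gt1 : (1 < N)%N.
Hypothesis K_primes : forall p, prime p -> (p <= N)%N -> (p %| K)%N.

Lemma conn_all M : conn M 0 [::].
Proof.
move=> j [tx x] [ty y] _ [/= xY _] [/= yY _].
have edge w : all (mem Y) w -> level_linked j [::] (true, w) (false, w).
  move=> wY; rewrite /level_linked -end0_cls -end1_cls; apply: linked_edge.
  by exists w; split.
have toA tau w : all (mem Y) w -> level_linked j [::] (tau, w) (false, w).
  by move=> wY; case: tau; [exact: edge | exact: linked_refl].
have base w : all (mem Y) w -> level_linked j [::] (false, w) (false, [::]).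
  elim/last_ind: w => [|w s IHw]; first by move=> _; apply: linked_refl.
  rewrite all_rcons => /andP[sY wY]; apply: linked_trans (IHw wY).
  have [sa|sa] := eqVneq s a; last first.
    rewrite /level_linked (_ : vert _ (false, rcons w s) = vert _ (false, w)); first exact: linked_refl.
    by rewrite /vx -cats1 cls_catr //= !inE sa.
  apply: linked_trans (edge _ wY); apply: linked_trans (linked_sym (edge (rcons w s) _)) _.
    by rewrite all_rcons; apply/andP.
  rewrite /level_linked (_ : vert _ (true, rcons w s) = vert _ (true, w)); first exact: linked_refl.
  by rewrite /vx -cats1 cls_catr //= !inE sa ab.
apply: linked_trans (toA tx _ xY) _; apply: linked_trans (base _ xY) _.
by apply: linked_sym; apply: linked_trans (toA ty _ yY) (base _ yY).
Qed.

Lemma nonempty_all M : nonempty M 0 [::].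
Proof. by move=> j _; exists (false, [::]); split. Qed.

Lemma fixes_ev j X H w : fixes j X H w <->
  forall h, h \in H -> (ev (tower j) h *: cls (tower j) X w)%g = cls (tower j) X w.
Proof. by split=> fw h /fw; rewrite cls_cat. Qed.

Lemma lcosetX (q : finquot e m) (g : q) (Z : {set q}) n : (g *: Z)%g = Z -> (g ^+ n *: Z)%g = Z.
Proof.
by move=> gZ; elim: n => [|n IHn]; rewrite ?lcoset1 // expgS lcosetM IHn.
Qed.

(** Induction through a prime factor [p] of [n]: the [p]-th power of [r] is covered by [n / p], and
    [r] acts on its fixed subgraph with trivial [p]-th power. *)
Lemma cyclic_fixed n : (0 < n <= N)%N -> exists d, forall M r, all (mem Y) r ->
  ev (tower M) (flatten (nseq n r)) = 1%g -> conn M d [:: r] /\ nonempty M d [:: r].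
Proof.
have [k] := ubnP n; elim: k n => // k IHk n; rewrite ltnS => nk /andP[n0 nN].
have [n1|n1] := leqP n 1.
  have -> : n = 1%N by lia.
  exists 0%N => M r rY; rewrite /= cats0 => r1.
  have S : same_fixed M [::] [:: r].
    move=> j X w jM wY; split=> // _; apply/fixes_ev => h; rewrite inE => /eqP->.
    have -> : ev (tower j) r = 1%g.
      by apply: (tower_refines jM).
    by rewrite lcoset1.
  by split; [apply: conn_same S (@conn_all M) | apply: nonempty_same S (@nonempty_all M)].
pose p := pdiv n; pose n' := (n %/ p)%N.
have p_pr : prime p by apply: pdiv_prime.
have En : n = (p * n')%N by rewrite mulnC divnK // pdiv_dvd.
have n'0 : (0 < n')%N by rewrite divn_gt0 ?prime_gt0 // dvdn_leq // pdiv_dvd.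
have n'n : (n' < n)%N by rewrite ltn_Pdiv // prime_gt1.
have n'N : (0 < n' <= N)%N by rewrite n'0 (leq_trans (ltnW n'n)).
have [d Hd] := IHk n' (leq_trans n'n nk) n'N.
exists (d + d.+1)%N => M r rY rn.
have pK : (p %| K)%N by apply: K_primes => //; apply: leq_trans nN; apply: pdiv_leq.
pose r' := flatten (nseq p r).
have r'Y : all (mem Y) r' by rewrite /r'; elim: (p) => //= i IHi; rewrite all_cat rY.
have [|c n_] := Hd M r' r'Y.
  by rewrite ev_flatten /r' ev_flatten -expgM -En -ev_flatten.
have [||c' n_'] := smith p_pr pK rY _ _ c n_.
- move=> j X w jM wY /fixes_ev f; apply/fixes_ev => h; rewrite inE => /eqP->.
  have := f r' (mem_head _ _); rewrite cls_cat /r' ev_flatten => E.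
  by rewrite -lcosetM -expgSr expgS lcosetM E.
- by move=> j X w jM wY f; apply: f; rewrite inE eqxx.
have S : same_fixed M [:: r; r'] [:: r].
  move=> j X w jM wY; split=> [f h|/fixes_ev f]; first by rewrite inE => /eqP->; apply: f; rewrite inE eqxx.
  apply/fixes_ev => h; rewrite !inE => /predU1P[->|/eqP->]; first by apply: f; rewrite inE.
  by rewrite /r' ev_flatten; apply: lcosetX; apply: f; rewrite inE.
by split; [apply: conn_same S c' | apply: nonempty_same S n_'].
Qed.

(** [t1] inverts [t1 t2], so it preserves the fixed subgraph; a Smith step at the prime 2 gives a
    point fixed by [t1] and [t1 t2], hence by [t2]. *)
Lemma dihedral_fixed n : (0 < n <= N)%N -> exists d, forall M (t1 t2 : seq V),
  all (mem Y) t1 -> all (mem Y) t2 ->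
  ev (tower M) (t1 ++ t1) = 1%g -> ev (tower M) (t2 ++ t2) = 1%g ->
  ev (tower M) (flatten (nseq n (t1 ++ t2))) = 1%g -> nonempty M d [:: t1; t2].
Proof.
move=> nN; have [d Hd] := cyclic_fixed nN; exists (d + d.+1)%N => M t1 t2 t1Y t2Y s1 s2 r1.
have rY : all (mem Y) (t1 ++ t2) by rewrite all_cat t1Y.
have [c n_] := Hd M _ rY r1.
have K2 : (2 %| K)%N by apply: K_primes.
have sq j (t : seq V) : (j <= M)%N -> ev (tower M) (t ++ t) = 1%g ->
    (ev (tower j) t * ev (tower j) t = 1)%g.
  by move=> jM tt; rewrite -ev_cat; apply: (tower_refines jM).
have [||_ n'] := smith (isT : prime 2) K2 t1Y _ _ c n_.
- move=> j X w jM wY /fixes_ev f; apply/fixes_ev => h; rewrite inE => /eqP->.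
  have := f _ (mem_head _ _); rewrite cls_cat !ev_cat.
  set g1 := ev _ t1; set g2 := ev _ t2; set Z := cls _ _ w => E.
  have E' : ((g2 * g1) *: Z = Z)%g.
    rewrite -{1}E -lcosetM -mulgA (mulgA g1) /g1 (sq j) // mul1g /g2 (sq j) //.
    by rewrite lcoset1.
  by rewrite -[in RHS]E' -!lcosetM !mulgA.
- move=> j X w jM wY _; rewrite cls_cat /= cats0 ev_cat (sq j) //.
  by rewrite lcoset1.
apply: nonempty_same n' => j X w jM wY; split=> /fixes_ev f; apply/fixes_ev => h;
    rewrite !inE => /predU1P[->|/eqP->].
- by apply: f; rewrite inE eqxx.
- have F1 := f t1 (mem_head _ _).
  have F2 : (ev (tower j) (t1 ++ t2) *: cls (tower j) X w)%g = cls (tower j) X w.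
    by apply: f; rewrite !inE eqxx orbT.
  rewrite ev_cat lcosetM in F2; apply: (@lcoset_inj _ (ev (tower j) t1)).
  by rewrite F2 F1.
- by apply: f; rewrite inE eqxx.
- rewrite ev_cat lcosetM !f ?inE ?eqxx ?orbT //.
Qed.

(** The usual Helly induction: intersect every other subgraph with the first. [conn_cat] keeps the
    intersections connected and [helly3] makes them meet in pairs. *)
Lemma helly_nonempty k d : exists d', forall M (Hs : seq (seq (seq V))),
  size Hs = k.+1 -> (forall H, H \in Hs -> conn M d H) ->
  (forall H H', H \in Hs -> H' \in Hs -> nonempty M d (H ++ H')) ->
  nonempty M d' (flatten Hs).
Proof.
have K2 : (2 %| K)%N by apply: K_primes.
elim: k d => [|k IHk] d.
  exists d => M [|H [|]] // _ _ /(_ H H (mem_head _ _) (mem_head _ _)) n_.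
  rewrite /= cats0; apply: nonempty_same n_ => j X w _ _.
  by rewrite fixes_cat; split=> [[]|].
have [d' Hd'] := IHk (d + d.+1)%N; exists d' => M [|H1 Hs] //= [sHs] cH nH.
have in1 : H1 \in H1 :: Hs by rewrite inE eqxx.
have inS H : H \in Hs -> H \in H1 :: Hs by rewrite inE orbC => ->.
have := Hd' M [seq H1 ++ H | H <- Hs]; rewrite size_map => /(_ sHs).
move=> H0; apply: nonempty_same (H0 _ _) => [j X w jM wY|_ /mapP[H HHs ->]|_ _ /mapP[H HHs ->] /mapP[H' H'Hs ->]].
- split=> f h.
    rewrite mem_cat => /orP[hH1|/flattenP[H HHs hH]]; apply: f; apply/flattenP.
      case: Hs sHs {cH nH inS H0 in1} => // H2 Hs _; exists (H1 ++ H2); first by rewrite inE eqxx.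
      by rewrite mem_cat hH1.
    by exists (H1 ++ H); [apply: map_f | rewrite mem_cat hH orbT].
  case/flattenP=> _ /mapP[H HHs ->]; rewrite mem_cat => /orP[hH|hH]; apply: f; rewrite mem_cat ?hH //.
  by rewrite (_ : h \in flatten Hs) ?orbT //; apply/flattenP; exists H.
- apply: (@conn_le _ d.+1); first by rewrite addnS ltnS leq_addr.
  by apply: (conn_cat (isT : prime 2) K2); apply: cH => //; apply: inS.
have n3 := helly3 (isT : prime 2) K2 (cH _ in1) (cH _ (inS _ HHs)) (cH _ (inS _ H'Hs))
  (nH _ _ in1 (inS _ HHs)) (nH _ _ in1 (inS _ H'Hs)) (nH _ _ (inS _ HHs) (inS _ H'Hs)).
apply: nonempty_same n3 => j X w _ _; rewrite !fixes_cat; tauto.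
Qed.

Theorem common_fixed (I : finType) (mm : I -> I -> nat) :
  (forall i j, 0 < mm i j <= N)%N -> exists L, forall t : I -> seq V,
  (forall i, all (mem Y) (t i)) -> (forall i, ev (tower L) (t i ++ t i) = 1%g) ->
  (forall i j, ev (tower L) (flatten (nseq (mm i j) (t i ++ t j))) = 1%g) ->
  exists x, fixed_pt 0 [seq t i | i <- enum I] x.
Proof.
move=> mmN.
have [Dc HDc] := cyclic_fixed (n := 2) N_gt1.
have [Dd HDd] : exists D, forall n, (0 < n <= N)%N -> forall M (t1 t2 : seq V),
  all (mem Y) t1 -> all (mem Y) t2 ->
  ev (tower M) (t1 ++ t1) = 1%g -> ev (tower M) (t2 ++ t2) = 1%g ->
  ev (tower M) (flatten (nseq n (t1 ++ t2))) = 1%g -> nonempty M D [:: t1; t2].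
  have /choice[f Hf] : forall n, exists d, (0 < n <= N)%N -> forall M (t1 t2 : seq V),
    all (mem Y) t1 -> all (mem Y) t2 ->
    ev (tower M) (t1 ++ t1) = 1%g -> ev (tower M) (t2 ++ t2) = 1%g ->
    ev (tower M) (flatten (nseq n (t1 ++ t2))) = 1%g -> nonempty M d [:: t1; t2].
    move=> n; have [/dihedral_fixed[d Hd]|_] := boolP (0 < n <= N)%N; last by exists 0%N.
    by exists d.
  (* The orders are at most [N], so one loss of levels serves all pairs. *)
  exists (\max_(n < N.+1) f n)%N => n nN M t1 t2 *.
  have nN' : (n < N.+1)%N by case/andP: nN.
  apply: (@nonempty_le _ (f n)); last exact: Hf.
  exact: (leq_bigmax (F := fun n : 'I_N.+1 => f n) (Ordinal nN')).
pose d := maxn Dc Dd; have [d' Hd'] := helly_nonempty (#|I|).-1 d.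
exists d' => t tY tt tij.
have [I0|I0] := posnP #|I|.
  exists (false, [::]); split=> // h /mapP[i _ _].
  have I1 : (0 < #|I|)%N by apply/card_gt0P; exists i.
  by rewrite I0 in I1.
have flat : flatten [seq [:: t i] | i <- enum I] = [seq t i | i <- enum I].
  by elim: (enum I) => //= i r ->.
have [||||x fx] := Hd' d' [seq [:: t i] | i <- enum I] _ _ _ 0%N.
- by rewrite size_map -cardE prednK.
- move=> _ /mapP[i _ ->]; apply: (@conn_le _ Dc); first exact: leq_maxl.
  by apply: (proj1 (HDc d' (t i) (tY i) _)); rewrite /= cats0.
- move=> _ _ /mapP[i _ ->] /mapP[j _ ->]; apply: (@nonempty_le _ Dd); first exact: leq_maxr.
  exact: (HDd (mm i j)).
- by rewrite add0n.
by exists x; rewrite -flat.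
Qed.

End Tower.

Local Close Scope ring_scope.

(** * Torsion in the profinite completion *)

Section TorsionConjugation.
Variables (V : finType) (e : rel V) (m : V -> V -> nat).
Hypotheses (cg : coxeter_graph e m) (fc : FC_type e m).
Variables (I : finType) (mm : I -> I -> nat).
Hypothesis mm_gt0 : forall i j, 0 < mm i j.
Implicit Types (u w g : seq V) (X Y : {set V}) (t : I -> seq V).
Local Notation "u ~ w" := (cox_eq e m u w) (at level 70).

Definition torsion (q : finquot e m) t :=
  (forall i, ev q (t i ++ t i) = 1) /\
  (forall i j, ev q (flatten (nseq (mm i j) (t i ++ t j))) = 1).

Lemma torsion_refines q q' t : refines q q' -> torsion q t -> torsion q' t.
Proof. by move=> r [t1 t2]; split=> *; apply: r. Qed.

Lemma torsion_conj q t t' g :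
  (forall i, ev q (t' i) = ev q (rev g ++ t i ++ g)) -> torsion q t -> torsion q t'.
Proof.
move=> E [t1 t2]; have Ec i : ev q (t' i) = (ev q (t i)) ^ (ev q g).
  by rewrite E !ev_cat ev_rev conjgE.
split=> [i|i j]; first by rewrite ev_cat !Ec -conjMg -ev_cat t1 conj1g.
by rewrite ev_flatten ev_cat !Ec -conjMg -conjXg -ev_cat -ev_flatten t2 conj1g.
Qed.

Lemma fixed_coset a b Y (G : finquot e m) : a != b -> ~~ e a b ->
  exists q, refines q G /\ forall t, (forall i, all (mem Y) (t i)) -> torsion q t ->
  exists w tau, all (mem Y) w /\
    forall i, cls G (side a b tau) (t i ++ w) = cls G (side a b tau) w.
Proof.
(* Adding 2 ensures [1 < N] even for empty [I]. The factorial of [N] is divisible by every prime up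
   to [N], so a single tower serves all Smith steps. *)
move=> ab nab; pose N := (\max_(p : I * I) mm p.1 p.2).+2.
have K1 : 1 < N`! by rewrite /N factS; have := fact_gt0 (\max_(p : I * I) mm p.1 p.2).+1; nia.
have mmN i j : 0 < mm i j <= N.
  rewrite mm_gt0 /=; apply: leq_trans (leqnSn _); apply: leq_trans (leqnSn _).
  exact: (@leq_bigmax _ (fun p : I * I => mm p.1 p.2) (i, j)).
have KN p : prime p -> p <= N -> p %| N`! by move=> /prime_gt0 p0 pN; apply: dvdn_fact; rewrite p0.
have [L HL] := common_fixed cg ab nab Y G K1 (isT : 1 < N) KN mmN.
exists (tower cg ab nab N`! G L); split.
  have H : refines (tower cg ab nab N`! G L) (tower cg ab nab N`! G 0) by apply: tower_refines.
  exact: H.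
move=> t tY [t1 t2]; have [[tau w] [/= wY fw]] := HL t tY t1 t2.
by exists w, tau; split=> // i; apply: fw; apply: map_f; rewrite mem_enum.
Qed.

(* Descends through the amalgams [W_Y = W_(Y - a) *_(W_(Y - a - b)) W_(Y - b)];
   [parabolic_intersection] brings the conjugated elements back to words over
   the smaller vertex set. *)
Theorem torsion_in_clique Y (G : finquot e m) : exists q, forall t,
  (forall i, all (mem Y) (t i)) -> torsion q t ->
  exists g X, is_clique e X /\ forall i, exists2 x, all (mem X) x &
    ev G (rev g ++ t i ++ g) = ev G x.
Proof.
have [n] := ubnP #|Y|; elim: n Y G => // n IHn Y G; rewrite ltnS => Yn.
have [cY|/existsNP[a /existsNP[b ]]] := pselect (is_clique e Y).
  exists (trivq e m) => t tY _; exists [::], Y; split=> // i; exists (t i) => //.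
  by rewrite /= cats0.
move=> /not_implyP[aY /not_implyP[bY /not_implyP[ab nab]]].
have {}nab : ~~ e a b by apply/negP.
have small c : c \in Y -> #|Y :\ c| < n.
  by move=> cY; apply: leq_trans Yn; rewrite [X in _ < X](cardsD1 c) cY.
have [Ga HGa] := IHn (Y :\ a) G (small a aY).
have [Gb HGb] := IHn (Y :\ b) G (small b bY).
(* The side of the fixed coset is known only once the words are given, so the quotients for both
   sides are included. *)
pose G1 := prodq (prodq Ga Gb) G.
have [G2 HG2] := parabolic_intersection cg fc G1 Y.
have [q [qG Hq]] := fixed_coset Y (prodq G1 G2) ab nab.
exists q => t tY tq; have [w [tau [wY fw]]] := Hq t tY tq.
have rG1 : refines q G1 by apply: refines_trans qG _; apply: prodq1.
have yY i : all (mem Y) (rev w ++ t i ++ w) by rewrite !all_cat all_mem_rev wY tY.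
pose c := if tau then b else a.
have /choice[t' Ht'] : forall i, exists y' : seq V, all (mem (Y :\ c)) y' /\
    ev G1 y' = ev G1 (rev w ++ t i ++ w).
  (* In [G2] the conjugate by [w] agrees with a word [h] that avoids [c] but may leave [Y]; the
     choice of [G2] yields a word over [Y :\ c] that agrees with the conjugate in [G1]. *)
  move=> i; have [h hX Eh] := cls_eqP (esym (fw i)).
  have E2 : ev G2 (rev w ++ t i ++ w) = ev G2 h.
    apply: (refines_eq (@prodq2 _ _ _ G1 G2)).
    by rewrite ev_cat ev_rev Eh [in RHS]/= -[LHS]/(_ * _) ev_cat mulKg.
  have ch : c \notin h.
    by apply/negP => /(allP hX); rewrite /c /side /=; case: (tau); rewrite !inE eqxx.
  by have [y' y'Y Ey'] := HG2 c _ _ (yY i) ch E2; exists y'.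
have cY : c \in Y by rewrite /c; case: (tau).
have tG1 : torsion G1 t'.
  apply: (@torsion_conj _ t _ w) => [i|]; first by case: (Ht' i).
  exact: torsion_refines tq.
have [g [X [cX Hg]]] : exists g X, is_clique e X /\ forall i, exists2 x, all (mem X) x &
    ev G (rev g ++ t' i ++ g) = ev G x.
  have tY' i : all (mem (Y :\ c)) (t' i) by case: (Ht' i).
  move: tY'; rewrite /c; case: (tau) => tY'.
    apply: HGb tY' _; apply: torsion_refines tG1.
    by apply: refines_trans (@prodq1 _ _ _ _ _) _; apply: prodq2.
  apply: HGa tY' _; apply: torsion_refines tG1.
  by apply: refines_trans (@prodq1 _ _ _ _ _) _; apply: prodq1.
exists (w ++ g), X; split=> // i; have [x xX Ex] := Hg i; exists x => //.
have E : ev G (t' i) = ev G (rev w ++ t i ++ w).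
  by apply: (refines_eq (@prodq2 _ _ _ (prodq Ga Gb) G)); case: (Ht' i).
by rewrite -Ex rev_cat !ev_cat E !ev_cat !mulgA.
Qed.

End TorsionConjugation.

(** * Profinite completions *)

Section Completion.
Variables (V : finType) (e : rel V) (m : V -> V -> nat).
Implicit Types (u w x y : seq V).
Local Notation "u ~ w" := (cox_eq e m u w) (at level 70).
Local Notation W := (coxeter_group e m).

Section Normal.
Variable N : W -> Prop.
Hypothesis finN : fin_index_normal N.

Definition eqmod u w := N (rev u ++ w).

Let Ncox u w : u ~ w -> N u -> N w.
Proof. by case: finN => -[+ _ _] _; apply. Qed.
Let N1 : N [::].
Proof. by case: finN => -[]. Qed.
Let NM u w : N u -> N w -> N (u ++ w).
Proof. by case: finN => -[_ _ H] _; apply: H. Qed.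
Let NV u : N u -> N (rev u).
Proof. by case: finN => _ [H _ _]; apply: H. Qed.
Let NJ g u : N u -> N (g ++ u ++ rev g).
Proof. by case: finN => _ [_ H _] /(H g); rewrite /= -catA. Qed.

Lemma eqmod_cox u w : u ~ w -> eqmod u w.
Proof.
move=> uw; apply: Ncox N1; apply: cox_sym; apply: cox_trans (cox_Vcat e m u).
by apply: cox_cat; [apply: cox_refl | apply: cox_sym].
Qed.

Lemma eqmod_refl u : eqmod u u. Proof. exact/eqmod_cox/cox_refl. Qed.

Lemma eqmod_sym u w : eqmod u w -> eqmod w u.
Proof. by move/NV; rewrite rev_cat revK. Qed.

Lemma eqmod_trans u w x : eqmod u w -> eqmod w x -> eqmod u x.
Proof.
move=> uw wx; apply: Ncox (NM uw wx); rewrite -catA; apply: cox_cat; first exact: cox_refl.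
exact: cox_catVw.
Qed.

Lemma eqmod_cat u u' w w' : eqmod u u' -> eqmod w w' -> eqmod (u ++ w) (u' ++ w').
Proof.
move=> uu ww; have := NM (NJ (rev w) uu) ww; rewrite revK; apply: Ncox.
rewrite rev_cat -!catA; do 3!apply: cox_cat (cox_refl _ _ _) _.
by apply: cox_catVw.
Qed.

Lemma coset_eqmod u w : eqmod u w -> Defs.coset (G := W) N u = Defs.coset (G := W) N w.
Proof.
move=> uw; apply/funext => x; apply/propext; split=> H.
  exact: eqmod_trans (eqmod_sym uw) H.
exact: eqmod_trans uw H.
Qed.

Lemma finquot_of_normal : exists q : finquot e m, forall w, ev q w = 1 -> N w.
Proof.
have [k [reps Hreps]] : exists (k : nat) (reps : 'I_k -> W), forall g, exists i,
    N (gmul (ginv (reps i)) g) by case: finN => _ [_ _].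
have [F HF] := choice Hreps.
(* With the arguments of [eqmod] swapped, the conclusion for [w] and [[::]] computes to [N w]. *)
have [|||||q Hq] := @finquot_of_rel V e m (fun u w => eqmod w u) _ _ _ _ 'I_k F.
- by move=> u w; apply: eqmod_sym.
- by move=> u z w uz zw; apply: eqmod_trans zw uz.
- by move=> s u w; apply: eqmod_cat (eqmod_refl [:: s]).
- by move=> u w /cox_sym; apply: eqmod_cox.
- move=> u w E; apply: eqmod_trans (_ : eqmod (reps (F u)) u); last exact: HF.
  by rewrite E; apply: eqmod_sym; apply: HF.
by exists q => w /Hq.
Qed.

End Normal.

Lemma kernel_normal (q : finquot e m) : fin_index_normal (G := W) (fun w => ev q w = 1).
Proof.
split; split=> /=.
- by move=> u w uw <-; rewrite (ev_cox q uw).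
- exact: ev_nil.
- by move=> u w u1 w1; rewrite ev_cat u1 w1 mulg1.
- by move=> u u1; rewrite ev_rev u1 invg1.
- by move=> g u u1; rewrite !ev_cat u1 mulg1 ev_rev mulgV.
have /choice[r Hr] : forall g : q, exists w, (exists u, ev q u = g) -> ev q w = g.
  by move=> g; have [[u Eu]|no] := pselect (exists u, ev q u = g); [exists u | exists [::]].
exists #|q|, (fun i => r (enum_val i)) => w; exists (enum_rank (ev q w)).
by rewrite enum_rankK ev_cat ev_rev (Hr (ev q w)) ?mulVg //; exists w.
Qed.

Implicit Types (a b c : completion W).

Lemma completion_eq a b : (forall N, fin_index_normal N -> exists x, sval a N x /\ sval b N x) ->
  a = b.
Proof.
move=> H; case: a H => [f Hf]; case: b => [f' Hf'] /= H.
have E : f = f'; last by subst f'; congr exist; apply: Prop_irrelevance.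
apply/funext => N; have [fN|nN] := pselect (fin_index_normal N); last first.
  by case: Hf Hf' => _ -> // _ [_ ->].
have [x []] := H N fN; case: Hf => /(_ N fN)[g ->] _ _; case: Hf' => /(_ N fN)[g' ->] _ _.
by move=> gx g'x; apply: coset_eqmod => //; apply: (eqmod_trans fN gx); apply: eqmod_sym.
Qed.

Lemma completion_coset a N x : fin_index_normal N -> sval a N x ->
  sval a N = Defs.coset (G := W) N x.
Proof.
move=> fN; case: a => f /= [/(_ N fN)[g ->] _ _] gx.
by apply: coset_eqmod.
Qed.

Lemma of_word_proof w : compl_elt (G := W) (fun N x => fin_index_normal N /\ Defs.coset (G := W) N w x).
Proof.
split=> [N fN|N nN|N M fN fM MN x [_ wx]].
- by exists w; apply/funext => x; apply/propext; split=> [[]|].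
- by apply/funext => x; apply/propext; split=> [[]|].
- by split=> //; apply: MN.
Qed.
Definition of_word w : completion W := exist _ _ (of_word_proof w).

Lemma of_word_cox u w : u ~ w -> of_word u = of_word w.
Proof.
move=> uw; apply: completion_eq => N fN; exists w; split; split=> //.
  exact: eqmod_cox.
exact: eqmod_refl.
Qed.

Lemma of_word_cat u w : compl_prod (of_word u) (of_word w) (of_word (u ++ w)).
Proof. by move=> N fN x y [_ ux] [_ wy]; split=> //; apply: eqmod_cat. Qed.

Lemma prod_proof a b : compl_elt (G := W) (fun N z => fin_index_normal N /\
  exists x y, [/\ sval a N x, sval b N y & eqmod N (x ++ y) z]).
Proof.
split=> [N fN|N nN|N M fN fM MN z [_ [x [y [ax bx xyz]]]]].
- have [x Ea] : exists x, sval a N = Defs.coset (G := W) N x by case: (svalP a) => /(_ N fN).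
  have [y Eb] : exists y, sval b N = Defs.coset (G := W) N y by case: (svalP b) => /(_ N fN).
  exists (x ++ y); apply/funext => z; apply/propext; rewrite Ea Eb; split.
    move=> [_ [x' [y' [xx' yy' xyz]]]]; apply: eqmod_trans xyz => //.
    exact: eqmod_cat.
  by move=> xyz; split=> //; exists x, y; split=> //; apply: eqmod_refl.
- by apply/funext => x; apply/propext; split=> [[]|].
split=> //; exists x, y; split; last exact: MN.
  by case: (svalP a) => _ _ /(_ N M); apply.
by case: (svalP b) => _ _ /(_ N M); apply.
Qed.

Lemma prod_exists a b : exists c, compl_prod a b c.
Proof.
exists (exist _ _ (prod_proof a b)) => N fN x y ax bx; split=> //; exists x, y; split=> //.
exact: eqmod_refl.
Qed.

Lemma prod_unique a b c c' : compl_prod a b c -> compl_prod a b c' -> c = c'.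
Proof.
move=> H H'; apply: completion_eq => N fN.
have [x Ea] : exists x, sval a N = Defs.coset (G := W) N x by case: (svalP a) => /(_ N fN).
have [y Eb] : exists y, sval b N = Defs.coset (G := W) N y by case: (svalP b) => /(_ N fN).
have ax : sval a N x by rewrite Ea; apply: eqmod_refl.
have bx : sval b N y by rewrite Eb; apply: eqmod_refl.
by exists (x ++ y); split; [exact: H | exact: H'].
Qed.

End Completion.

(** Products in a completion exist and are unique, so multiplicativity passes from [phi] to its
    inverse; this lets one transfer lemma serve both directions. *)
Lemma inverse_morphism (V1 V2 : finType) (e1 : rel V1) (m1 : V1 -> V1 -> nat)
    (e2 : rel V2) (m2 : V2 -> V2 -> nat)
    (phi : completion (coxeter_group e1 m1) -> completion (coxeter_group e2 m2))
    (psi : completion (coxeter_group e2 m2) -> completion (coxeter_group e1 m1)) :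
  cancel phi psi -> cancel psi phi ->
  (forall x y z, compl_prod x y z -> compl_prod (phi x) (phi y) (phi z)) ->
  forall x y z, compl_prod x y z -> compl_prod (psi x) (psi y) (psi z).
Proof.
move=> phiK psiK phiM x y z xyz; have [p Hp] := prod_exists (psi x) (psi y).
have := phiM _ _ _ Hp; rewrite !psiK => H.
by rewrite -(prod_unique H xyz) phiK.
Qed.

(** * Finiteness from bounded images in finite quotients *)

Section Finiteness.
Variables (V : finType) (e : rel V) (m : V -> V -> nat).
Hypothesis cg : coxeter_graph e m.
Implicit Types (u w : seq V) (X : {set V}).
Local Notation "u ~ w" := (cox_eq e m u w) (at level 70).

(** Any finite list of distinct elements of [W_X] is separated in one quotient, so it has at most
    [B] members, and a longest one is exhaustive. Images are counted through a classifying map [c],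
    because the classes will be computed in the other Coxeter group. *)
Lemma finite_of_bounded_quotients X B :
  (forall q : finquot e m, exists (T : eqType) (c : seq V -> T) (l : seq T),
    [/\ size l <= B, forall w, all (mem X) w -> c w \in l &
        forall u w, all (mem X) u -> all (mem X) w -> c u = c w -> ev q u = ev q w]) ->
  special_parabolic_finite e m X.
Proof.
move=> Hq.
pose indep (s : seq (seq V)) := [/\ uniq s, all (all (mem X)) s &
  forall u w, u \in s -> w \in s -> u ~ w -> u = w].
have bound s : indep s -> size s <= B.
  move=> [us sX sI].
  pose P (p : seq V * seq V) (q : finquot e m) := ~ (p.1 ~ p.2) -> ev q p.1 <> ev q p.2.
  have [||q Pq] := @common_refinement V e m _ [seq (u, w) | u <- s, w <- s] P.
  - by move=> p q q' r Pp np E; apply: (Pp np); apply: refines_eq E.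
  - move=> [u w]; have [uw|nuw] := pselect (u ~ w); first by exists (trivq e m).
    have [|q nq] := residually_finite cg (w := rev u ++ w).
      move=> H; apply: nuw; apply: cox_sym; rewrite -[u in _ ~ u]cats0 -[u in _ ~ u ++ _]revK.
      exact: cox_move.
    by exists q => _ /= E; apply: nq; rewrite ev_cat ev_rev E mulVg.
  have [T [c [l [lB cl cE]]]] := Hq q.
  apply: leq_trans lB; rewrite -(size_map c); apply: uniq_leq_size.
    rewrite map_inj_in_uniq // => u w us' ws' E; apply: sI => //.
    apply: contrapT => nuw; apply: (Pq (u, w) _ nuw) => /=; last first.
      by apply: cE => //; apply: (allP sX).
    exact: allpairs_f.
  by move=> _ /mapP[w ws ->]; apply: cl; apply: (allP sX).
pose P n := `[< exists s, indep s /\ size s = n >].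
have P0 : exists n, P n by exists 0%N; apply/asboolP; exists [::].
have Pb n : P n -> n <= B by move=> /asboolP[s [/bound + <-]].
case: (ex_maxnP P0 Pb) => n /asboolP[s [[us sX sI] sn]] max.
exists s => w wX; apply: contrapT => no.
have nw u : u \in s -> ~ (w ~ u) by move=> us' wu; apply: no; exists u.
have : n.+1 <= n.
  apply: max; apply/asboolP; exists (w :: s); rewrite /= sn; split=> //; split=> /=.
  - by rewrite us andbT; apply/negP=> /nw; apply; apply: cox_refl.
  - by rewrite wX.
  move=> u z; rewrite !inE => /predU1P[->|us'] /predU1P[->|zs] // uz.
  - by case: (nw z).
  - by case: (nw u) => //; apply: cox_sym.
  - exact: sI.
by rewrite ltnn.
Qed.

End Finiteness.

(** * Transfer along a profinite isomorphism *)

Section Transfer.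
Variables (V1 : finType) (e1 : rel V1) (m1 : V1 -> V1 -> nat).
Variables (V2 : finType) (e2 : rel V2) (m2 : V2 -> V2 -> nat).
Hypotheses (cg1 : coxeter_graph e1 m1) (cg2 : coxeter_graph e2 m2).
Local Notation W1 := (coxeter_group e1 m1).
Local Notation W2 := (coxeter_group e2 m2).
Variables (phi : completion W1 -> completion W2) (psi : completion W2 -> completion W1).
Hypotheses (phiK : cancel phi psi)
  (phiM : forall x y z, compl_prod x y z -> compl_prod (phi x) (phi y) (phi z))
  (psi_cont : compl_continuous psi).

Let image (w : seq V1) (N : W2 -> Prop) (x : seq V2) : Prop :=
  sval (phi (of_word e1 m1 w)) N x.

Let image_cat u w N x y : fin_index_normal N -> image u N x -> image w N y ->
  image (u ++ w) N (x ++ y).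
Proof. by move=> fN ix iy; exact: (phiM (@of_word_cat _ e1 m1 u w) fN ix iy). Qed.

Let image_ex w N : fin_index_normal N -> exists x, image w N x.
Proof.
move=> fN; case: (svalP (phi (of_word e1 m1 w))) => /(_ N fN)[x Ex] _ _; exists x.
by rewrite /image Ex; apply: eqmod_refl.
Qed.

Let image_eqmod w N x y : fin_index_normal N -> image w N x -> image w N y -> eqmod N x y.
Proof. by move=> fN ix; rewrite /image (completion_coset fN ix). Qed.

Let image_coset w N x : fin_index_normal N -> image w N x ->
  sval (phi (of_word e1 m1 w)) N = Defs.coset (G := W2) N x.
Proof. exact: completion_coset. Qed.

(** The image of the identity is idempotent, hence trivial. *)
Let image_nil N : fin_index_normal N -> image [::] N [::].
Proof.
move=> fN; have [x ix] := image_ex [::] fN.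
have E := image_eqmod fN ix (image_cat fN ix ix).
rewrite /image (image_coset fN ix) -[Defs.coset _ _ _]/(eqmod N x [::]).
have H := eqmod_cat fN (eqmod_refl fN (rev x)) E.
apply: eqmod_sym => //; apply: eqmod_trans (eqmod_trans fN H _) => //.
  by apply: eqmod_cox => //; apply: cox_sym; apply: cox_Vcat.
by apply: eqmod_cox => //; apply: cox_catVl.
Qed.

Let image_cox u w N x : cox_eq e1 m1 u w -> image u N x -> image w N x.
Proof. by move=> uw; rewrite /image (of_word_cox uw). Qed.

Let image_trivial w N x : fin_index_normal N -> cox_eq e1 m1 w [::] -> image w N x ->
  N x.
Proof.
move=> fN w1 ix; have := image_eqmod fN (image_nil fN) (image_cox w1 ix).
by [].
Qed.

Let image_flatten (I : Type) (f : I -> seq V1) (g : I -> seq V2) N l :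
  fin_index_normal N -> (forall i, image (f i) N (g i)) ->
  image (flatten [seq f i | i <- l]) N (flatten [seq g i | i <- l]).
Proof.
move=> fN H; elim: l => [|i l IHl] /=; first exact: image_nil.
exact: image_cat.
Qed.

Let image_pow w N x n : fin_index_normal N -> image w N x ->
  image (flatten (nseq n w)) N (flatten (nseq n x)).
Proof.
move=> fN H; elim: n => [|n IHn] /=; first exact: image_nil.
exact: image_cat.
Qed.

(* By continuity of [psi], the image of a finitely generated special subgroup
   in a finite quotient of [W1] is controlled by its image in one of [W2]. *)
Lemma FC_transfer : FC_type e2 m2 -> FC_type e1 m1.
Proof.
move=> fc2 X cX.
have [L LP] := FC_covers fc2.
(* The maximum is over all [Z], since the clique found below depends on [q1]. *)
apply: (@finite_of_bounded_quotients _ _ _ cg1 X (\max_Z size (L Z))) => q1.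
have fker := kernel_normal q1.
have [N [fN HN]] := psi_cont (phi (of_word e1 m1 [::])) fker.
have [q2 Hq2] := finquot_of_normal fN.
(* For [v = w], or for a letter outside [X], where [t] will be empty, the square of [t v ++ t w] is
   trivial; so 2 is a valid exponent. *)
pose mm v w := if [&& v \in X, w \in X & v != w] then m1 v w else 2.
have mm0 v w : 0 < mm v w.
  rewrite /mm; case: ifP => // /and3P[vX wX vw].
  by case: cg1 => _ _ _ /(_ v w (cX v w vX wX vw)) /ltnW.
have [q Hq] := torsion_in_clique cg2 fc2 mm0 [set: V2] q2.
pose q3 := prodq q q2; have f3 := kernel_normal q3.
have /choice[t0 Ht0] : forall v, exists x, image [:: v] (fun w => ev q3 w = 1) x.
  by move=> v; apply: image_ex.
pose t v := if v \in X then t0 v else [::].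
have sq v : ev q3 (t v ++ t v) = 1.
  rewrite /t; case: ifP => _; last exact: ev_nil.
  apply: (image_trivial (w := [:: v] ++ [:: v]) f3); last exact: image_cat.
  exact: (cox_sq e1 m1 [::] v [::]).
have tor : torsion mm q3 t.
  split=> // v w; rewrite /mm; case: ifP => [/and3P[vX wX vw]|nvw].
    rewrite /t vX wX.
    apply: (image_trivial (w := flatten (nseq (m1 v w) ([:: v] ++ [:: w]))) f3); last first.
      by apply: image_pow => //; apply: image_cat.
    have := @cox_edge V1 e1 m1 [::] v w [::] (cX v w vX wX vw).
    by rewrite !cats0.
  have s2 u : ev q3 u * ev q3 u = 1 -> ev q3 (flatten (nseq 2 u)) = 1.
    by move=> H; rewrite /= cats0 ev_cat.
  apply: s2; rewrite ev_cat.
  have := sq v; have := sq w; rewrite !ev_cat => sw sv.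
  have [vw|vw] := eqVneq v w; first by rewrite vw sw mul1g.
  move: nvw; rewrite /= vw andbT => /negbT; rewrite negb_and.
  have t1 u : u \notin X -> ev q3 (t u) = 1 by move/negPf => nX; rewrite /t nX ev_nil.
  by case/orP=> /t1->; rewrite ?mul1g ?mulg1.
have [g [Z [cZ HZ]]] : exists g Z, is_clique e2 Z /\ forall v, exists2 x, all (mem Z) x &
    ev q2 (rev g ++ t v ++ g) = ev q2 x.
  apply: Hq; first by move=> v; apply/allP => s _; rewrite inE.
  by apply: torsion_refines tor; apply: prodq1.
have /choice[x Hx] : forall v, exists x, all (mem Z) x /\ ev q2 (rev g ++ t v ++ g) = ev q2 x.
  by move=> v; have [x xZ Ex] := HZ v; exists x.
pose xs (w : seq V1) := flatten [seq x v | v <- w].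
pose ts (w : seq V1) := flatten [seq t v | v <- w].
have xsZ w : all (mem Z) (xs w).
  by elim: w => //= v w IHw; rewrite all_cat IHw (proj1 (Hx v)).
have Ets w : ev q2 (ts w) = ev q2 g * ev q2 (xs w) * (ev q2 g)^-1.
  elim: w => [|v w IHw]; first by rewrite !ev_nil mulg1 mulgV.
  rewrite /ts /xs /= !ev_cat -/(ts w) -/(xs w) IHw -(proj2 (Hx v)) !ev_cat ev_rev.
  by rewrite !mulgA mulgV mul1g.
(* In [q2] the image of every word is conjugate, by the same [g], to a word over [Z]; the entry of
   the latter in [L Z] serves as its class. *)
have /choice[c Hc] : forall w, exists u, u \in L Z /\ cox_eq e2 m2 (xs w) u.
  by move=> w; have [u uL Eu] := LP Z cZ _ (xsZ w); exists u.
exists (seq V2), c, (L Z); split.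
- exact: (leq_bigmax (F := fun Z => size (L Z))).
- by move=> w _; case: (Hc w).
move=> u w uX wX Ec.
have Euw : ev q2 (ts u) = ev q2 (ts w).
  by rewrite !Ets (ev_cox q2 (Hc u).2) (ev_cox q2 (Hc w).2) Ec.
have Erev z : ev q2 (ts (rev z)) = (ev q2 (ts z))^-1.
  elim: z => [|v z IHz]; first by rewrite ev_nil invg1.
  have v2 : ev q2 (t v) * ev q2 (t v) = 1.
    by rewrite -ev_cat; apply: (prodq2 (sq v)).
  rewrite rev_cons -cats1 /ts map_cat flatten_cat ev_cat -/(ts _) IHz /= cats0 ev_cat invMg.
  by congr (_ * _); apply/eqP; rewrite eq_sym eq_invg_mul v2.
pose z := rev u ++ w.
have tsz : ev q2 (ts z) = 1.
  by rewrite /ts map_cat flatten_cat ev_cat -!/(ts _) Erev Euw mulVg.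
have zX : all (mem X) z by rewrite all_cat all_mem_rev uX.
have iz : image z (fun w => ev q3 w = 1) (ts z).
  have -> : z = flatten [seq [:: v] | v <- z] by elim: (z) => //= v r {1}->.
  have -> : ts (flatten [seq [:: v] | v <- z]) = flatten [seq t0 v | v <- z].
    have -> : flatten [seq [:: v] | v <- z] = z by elim: (z) => //= v r ->.
    by rewrite /ts; congr flatten; apply/eq_in_map => v vz; rewrite /t (_ : v \in X) //; exact: (allP zX v vz).
  exact: image_flatten.
have izN : image z N (ts z).
  move: iz; rewrite /image; case: (svalP (phi (of_word e1 m1 z))) => _ _ H.
  apply: (H N _ fN f3) => y y3; apply: Hq2; exact: (prodq2 y3).
have E2 : sval (phi (of_word e1 m1 z)) N = sval (phi (of_word e1 m1 [::])) N.
  rewrite (image_coset fN izN) (image_coset fN (image_nil fN)).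
  apply: coset_eqmod => //; apply: eqmod_sym => //; apply: Hq2; exact: tsz.
have E3 := HN _ E2; rewrite !phiK in E3.
have : sval (of_word e1 m1 z) (fun w => ev q1 w = 1) z.
  by split=> //; exact: (eqmod_refl fker).
rewrite E3; case=> _; rewrite /Defs.coset /= ev_cat ev_rev => /eqP.
by rewrite -eq_mulVg1 => /eqP.
Qed.

End Transfer.

Theorem theorem6p6
    (V1 : finType) (e1 : rel V1) (m1 : V1 -> V1 -> nat)
    (V2 : finType) (e2 : rel V2) (m2 : V2 -> V2 -> nat) :
  coxeter_graph e1 m1 -> coxeter_graph e2 m2 ->
  profinite_iso (coxeter_group e1 m1) (coxeter_group e2 m2) ->
  (FC_type e1 m1 <-> FC_type e2 m2).
Proof.
move=> cg1 cg2 [phi [psi [phiK psiK phiM phi_cont psi_cont]]]; split.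
  exact: (FC_transfer cg2 cg1 psiK (inverse_morphism phiK psiK phiM) phi_cont).
exact: (FC_transfer cg1 cg2 phiK phiM psi_cont).
Qed.
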